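(* Let $\{(Y_t,X_t)\}_{t=1}^{\infty}$ be an ergodic hidden Markov model satisfying A1 and A2, and let $\tilde V^n=v^n(X^n)$, where the finite Viterbi alignments $v^n$ are chosen consistently. Put $$\bar R_1(v,X^n)=-\frac1n\sum_{t=1}^n\ln\mathbf P(Y_t=\tilde V_t^n\mid X^n).$$ Then there exists a constant $\bar R_1$ such that $$\lim_{n\to\infty}\bar R_1(v,X^n)=\bar R_1\quad\text{almost surely and in }L_1.$$
   Context: Hidden Markov model (HMM): $Y=\{Y_t\}$ is a stationary Markov chain with finite state space $S=\{1,\dots,|S|\}$ and irreducible aperiodic transition matrix $(P(i,j))$, also written $p_{ij}=P(i,j)$. $X=\{X_t\}$ takes values in a measurable space $(\mathcal X,\mathcal B)$ (usually $\mathbb R^d$ with the Borel sets); given $Y$, the $X_t$ are conditionally independent, and the law of $X_t$ depends on $Y$ only through $Y_t$. The emission distributions $P_s=\mathbf P(X_1\in\cdot\mid Y_1=s)$ have densities $f_s$ with respect to a reference measure $\mu$. Such a model is called ergodic. Write $X^n=(X_1,\dots,X_n)$, $Y^n=(Y_1,\dots,Y_n)$. $\mathbf P(Y_t=\tilde V_t^n\mid X^n)$ denotes $p_t(\tilde V^n_t\mid X^n)$ with $p_t(a\mid x^n)=\mathbf P(Y_t=a\mid X^n=x^n)$. Let $G_s=\{x\in\mathcal X:f_s(x)>0\}$. A set $C\subset S$ is a cluster if $\min_{j\in C}P_j(\cap_{s\in C}G_s)>0$ and $\max_{j\notin C}P_j(\cap_{s\in C}G_s)=0$. A1: there is a cluster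 $C\subset S$ such that the matrix $R=(P(i,j))_{i,j\in C}$ is primitive, i.e. $R^r$ is strictly positive for some positive integer $r$. A2: for each $l\in S$, $P_l(\{x\in\mathcal X: f_l(x)p_l^*>\max_{s\ne l}f_s(x)p_s^*\})>0$, where $p_l^*=\max_j p_{jl}$. For the cluster $C$ in A1 there exist a set $\mathcal X_o\subset\cap_{s\in C}G_s$ and $\epsilon>0$, $M<\infty$ with $\mu(\mathcal X_o)>0$ and, for all $x\in\mathcal X_o$: $\epsilon<\min_{s\in C}f_s(x)$, $\max_{s\in C}f_s(x)<M$, $\max_{s\notin C}f_s(x)=0$. Such a set (the one used in the construction of the infinite Viterbi alignment below) is fixed, and $W_t=\min\{\tau\ge t+r+1: X_{\tau-r}^{\tau}\in\mathcal X_o^{r+1}\}$, $U_t=\max\{\tau\le t-r-1: X_\tau^{\tau+r}\in\mathcal X_o^{r+1}\}$, where $X_a^b=(X_a,\dots,X_b)$. A finite Viterbi alignment is a map $v^n:\mathcal X^n\to S^n$ with $v^n(x^n)\in\arg\max_{s^n\in S^n}\mathbf P(Y^n=s^n\mid X^n=x^n)$. The alignments extend to an infinite Viterbi alignment $v:\mathcal X^\infty\to S^\infty$ if for almost every realization $x^\infty$ and every $k$ there is $m\geq k$ such that for all $n\ge m$ the first $k$ elements of $v^n(x^n)$ and $v(x^\infty)$ coincide. Put $V=\{V_t\}_{t\ge1}=v(X)$. Consistent choice: it is known that under A1, A2 the finite Viterbi alignments (ties broken suitably) can be chosen so that an infinite Viterbi alignment exists and the following holds; such a choice is called consistent. (R1)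 $Z=(X,Y,V)$ is a positive recurrent aperiodic classical regenerative process with respect to some renewal process $\{S_t\}_{t\ge0}$ (i.e. for each $k$ the shifted process $\theta_{S_k}(Z,S)$ is independent of the past up to $S_k$ and its law does not depend on $k$; $T_1=S_1-S_0$ satisfies $ET_1<\infty$ and $\mathbf P(T_1\in a\mathbb N)<1$ for all $a>1$). (R2) There is an integer $m>0$ with $S_0>m$, such that for all $j\ge0$ with $S_j+m\le n$, $\tilde V_t^n=V_t$ for all $t\le S_j$, and $S_j-S_{j-1}\ge m$ for $j\ge1$. (R3) If $S_k>t$ then $W_t\le S_k+m$; if $S_k<t$ then $U_t>S_k-m$. *)

(* Defs.v *)
From HB Require Import structures.
From mathcomp Require Import all_boot all_order all_algebra.
From mathcomp Require Import all_classical all_reals all_analysis.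

Set Implicit Arguments.
Unset Strict Implicit.
Unset Printing Implicit Defensive.
Import Order.TTheory GRing.Theory Num.Theory.
Import numFieldNormedType.Exports.
Local Open Scope classical_set_scope.
Local Open Scope ring_scope.

(* Conventions.  The state space S is 'I_K.+1, so |S| = K + 1.  Time runs over
   t = 1, 2, ...: processes are indexed by nat, and the variables with index 0
   play no role in the model.  In a tuple x : n.-tuple _ representing
   (x_1, ..., x_n), the entry x_t is tnth x i with t = i + 1. *)

HB.instance Definition _ (n : nat) := isPointed.Build 'I_n.+1 ord0.
HB.instance Definition _ (n : nat) := @isMeasurable.Build
  default_measure_display 'I_n.+1 discrete_measurable discrete_measurable0
  discrete_measurableC discrete_measurableU.

Section Chain.
Context {R : realType} {K : nat}.
Implicit Type p : 'M[R]_K.+1.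

Definition stochastic p : Prop :=
  (forall i j, 0 <= p i j) /\ (forall i, \sum_j p i j = 1).

Definition irreducible p : Prop :=
  forall i j, exists n : nat, 0 < (p ^+ n) i j.

(* every state has period 1, i.e. gcd {n >= 1 | (p ^ n)_{ii} > 0} = 1 *)
Definition aperiodic p : Prop :=
  forall (i : 'I_K.+1) (a : nat),
    (forall n : nat, (0 < n)%N -> 0 < (p ^+ n) i i -> (a %| n)%N) -> a = 1%N.

(* the matrix (p_ij) restricted to i, j in C *)
Definition submatrix p (C : {set 'I_K.+1}) : 'M[R]_(#|C|) :=
  mxsub (@enum_val _ (mem C)) (@enum_val _ (mem C)) p.

(* p*_l = max_j p_jl; the default 0 is harmless as the entries are >= 0 *)
Definition pstar p (l : 'I_K.+1) : R := \big[Num.max/0]_(j < K.+1) p j l.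

End Chain.

Section HMM.
Context {d d' : measure_display} {Omega : measurableType d}
  {X : measurableType d'} {R : realType} {K : nat}.
Variable (P : probability Omega R).
Variables (Xt : nat -> {RV P >-> X}) (Yt : nat -> {RV P >-> 'I_K.+1}).
Implicit Types (p : 'M[R]_K.+1) (Ps : 'I_K.+1 -> probability X R)
  (f : 'I_K.+1 -> X -> R) (C : {set 'I_K.+1}) (Xo : set X) (r n : nat).

(* {Y_(k+1) = y_1, ..., Y_(k+n) = y_n} *)
Definition path_event (k n : nat) (y : nat -> 'I_K.+1) : set Omega :=
  [set w | forall t, (1 <= t <= n)%N -> Yt (k + t)%N w = y t].

Definition stationary_markov_chain p : Prop :=
  (forall (n : nat) (y : nat -> 'I_K.+1), (0 < n)%N ->
     P (path_event 0 n.+1 y)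
     = (P (path_event 0 n y) * (p (y n) (y n.+1))%:E)%E) /\
  (forall (k n : nat) (y : nat -> 'I_K.+1),
     P (path_event k n y) = P (path_event 0 n y)).

(* Given Y, the X_t are independent and X_t has law P_{Y_t}.  Taking some of
   the B_t equal to setT covers the events that involve more Y's than X's. *)
Definition conditionally_independent_emissions Ps : Prop :=
  forall (n : nat) (y : nat -> 'I_K.+1) (B : nat -> set X),
    (forall t, measurable (B t)) ->
    P (path_event 0 n y `&`
       [set w | forall t, (1 <= t <= n)%N -> B t (Xt t w)])
    = (P (path_event 0 n y) *
       (\prod_(1 <= t < n.+1) fine (Ps (y t) (B t)))%:E)%E.

Definition has_densities (mu : {measure set X -> \bar R}) Ps f : Prop :=
  forall s, [/\ measurable_fun [set: X] (f s),
    (forall x, 0 <= f s x) &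
    forall B, measurable B -> Ps s B = (\int[mu]_(x in B) (f s x)%:E)%E].

Definition ergodic_hmm (mu : {measure set X -> \bar R}) p Ps f : Prop :=
  [/\ stochastic p /\ irreducible p /\ aperiodic p,
      stationary_markov_chain p,
      conditionally_independent_emissions Ps &
      has_densities mu Ps f].

Definition Gset f (s : 'I_K.+1) : set X := [set x | 0 < f s x].

Definition cluster Ps f C : Prop :=
  (forall j, j \in C -> (0 < Ps j (\bigcap_(s in [set` C]) Gset f s))%E) /\
  (forall j, j \notin C -> Ps j (\bigcap_(s in [set` C]) Gset f s) = 0%E).

(* assumption A1 with its witnesses C and r made explicit *)
Definition A1 p Ps f C r : Prop :=
  [/\ cluster Ps f C, (0 < r)%N &
      forall i j, 0 < (submatrix p C ^+ r) i j].

Definition A2 p Ps f : Prop :=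
  forall l : 'I_K.+1,
    (0 < Ps l [set x |
       (\big[Num.max/0]_(s < K.+1 | s != l) (f s x * pstar p s)
        < f l x * pstar p l)%R])%E.

Definition observation_set (mu : {measure set X -> \bar R}) f C Xo : Prop :=
  [/\ measurable Xo, Xo `<=` \bigcap_(s in [set` C]) Gset f s,
      (0 < mu Xo)%E &
      exists eps M : R, 0 < eps /\
        forall x, Xo x ->
          (forall s, s \in C -> eps < f s x < M) /\
          (forall s, s \notin C -> f s x = 0)].

(* W_t and U_t as extended reals: a minimum (maximum) over an empty set of
   times is +oo (-oo). *)
Definition Wtime Xo r (t : nat) (w : Omega) : \bar R :=
  ereal_inf [set (tau%:R)%:E | tau in [set tau : nat |
    (t + r + 1 <= tau)%N /\
    forall u, (tau - r <= u <= tau)%N -> Xo (Xt u w)]].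

Definition Utime Xo r (t : nat) (w : Omega) : \bar R :=
  ereal_sup [set (tau%:R)%:E | tau in [set tau : nat |
    (1 <= tau)%N /\ (tau + r + 1 <= t)%N /\
    forall u, (tau <= u <= tau + r)%N -> Xo (Xt u w)]].

(* X^n *)
Definition obs n (w : Omega) : n.-tuple X := [tuple Xt i.+1 w | i < n].

(* (X_1, X_2, ...), listed from index 0 *)
Definition obs_seq (w : Omega) : nat -> X := fun i => Xt i.+1 w.

(* g is a version of x |-> P(A | X^n = x) *)
Definition cond_prob_obs n (A : set Omega) (g : n.-tuple X -> R) : Prop :=
  measurable_fun [set: n.-tuple X] g /\
  forall B : set (n.-tuple X), measurable B ->
    P (A `&` (@obs n) @^-1` B)
    = (\int[P]_(w in (@obs n) @^-1` B) (g (obs n w))%:E)%E.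

(* q n s x is a version of P(Y^n = s | X^n = x) *)
Definition path_posterior
    (q : forall n, n.-tuple 'I_K.+1 -> n.-tuple X -> R) : Prop :=
  forall n (s : n.-tuple 'I_K.+1),
    cond_prob_obs [set w | forall i : 'I_n, Yt i.+1 w = tnth s i] (q n s).

(* pt n i a x is a version of P(Y_t = a | X^n = x), t = i + 1 *)
Definition state_posterior
    (pt : forall n, 'I_n -> 'I_K.+1 -> n.-tuple X -> R) : Prop :=
  forall n (i : 'I_n) (a : 'I_K.+1),
    cond_prob_obs [set w | Yt i.+1 w = a] (pt n i a).

Definition viterbi_alignment
    (q : forall n, n.-tuple 'I_K.+1 -> n.-tuple X -> R)
    (v : forall n, n.-tuple X -> n.-tuple 'I_K.+1) : Prop :=
  forall n, measurable_fun [set: n.-tuple X] (v n) /\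
    forall (x : n.-tuple X) (s : n.-tuple 'I_K.+1), q n s x <= q n (v n x) x.

(* vinf maps (x_1, x_2, ...) to (v_1, v_2, ...), both listed from index 0 *)
Definition infinite_viterbi_alignment
    (v : forall n, n.-tuple X -> n.-tuple 'I_K.+1)
    (vinf : (nat -> X) -> nat -> 'I_K.+1) : Prop :=
  {ae P, forall w, forall k : nat, exists m : nat, (k <= m)%N /\
    forall n, (m <= n)%N -> forall i : 'I_n, (i < k)%N ->
      tnth (v n (obs n w)) i = vinf (obs_seq w) i}.

(* V_t, t >= 1 *)
Definition Vt (vinf : (nat -> X) -> nat -> 'I_K.+1) (t : nat) (w : Omega) :
  'I_K.+1 := vinf (obs_seq w) t.-1.

Definition Zt (vinf : (nat -> X) -> nat -> 'I_K.+1) (t : nat) (w : Omega) :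
  X * 'I_K.+1 * 'I_K.+1 := (Xt t w, Yt t w, Vt vinf t w).

End HMM.

(* the sets generating the product sigma-algebra on E^nat *)
Definition cylinders (e : measure_display) (E : measurableType e) :
  set (set (nat -> E)) :=
  \bigcup_t preimage_set_system setT (fun z : nat -> E => z t) measurable.
Arguments cylinders {e} E.

Section Regenerative.
Context {d d' : measure_display} {Omega : measurableType d}
  {T : measurableType d'} {R : realType}.
Variable (P : probability Omega R).
Variables (Z : nat -> Omega -> T) (S : nat -> Omega -> nat).

(* theta_{S_k}(Z, S) = ((Z_{S_k + t})_{t >= 0}, (S_{k + t} - S_k)_{t >= 0}) *)
Definition shifted (k : nat) (w : Omega) : nat -> T * nat :=
  fun t => (Z (S k w + t)%N w, (S (k + t) w - S k w)%N).

(* sigma-algebra of the past up to S_k, i.e. of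
   ((Z_t)_{1 <= t < S_k}, S_0, ..., S_k) *)
Definition past (k : nat) : set (set Omega) :=
  <<s [set A | (exists (t : nat) (B : set T),
                  [/\ (1 <= t)%N, measurable B &
                      A = [set w | (t < S k w)%N /\ B (Z t w)]]) \/
               (exists i s : nat, (i <= k)%N /\ A = [set w | S i w = s])] >>.

(* positive recurrent aperiodic classical regenerative process *)
Definition regenerative : Prop :=
  [/\ (forall t, measurable_fun [set: Omega] (Z t)) /\
      (forall k, measurable_fun [set: Omega] (S k)) /\
      {ae P, forall w, forall k, (S k w < S k.+1 w)%N},
      (forall k A B, past k A -> <<s cylinders (T * nat)%type >> B ->
         P (A `&` shifted k @^-1` B) = (P A * P (shifted k @^-1` B))%E),
      (forall k B, <<s cylinders (T * nat)%type >> B ->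
         P (shifted k @^-1` B) = P (shifted 0 @^-1` B)),
      (\int[P]_w ((S 1%N w - S 0%N w)%N%:R)%:E < +oo)%E &
      forall a : nat, (1 < a)%N ->
        (P [set w | (a %| S 1%N w - S 0%N w)%N] < 1)%E].

End Regenerative.

Section Consistent.
Context {d d' : measure_display} {Omega : measurableType d}
  {X : measurableType d'} {R : realType} {K : nat}.
Variable (P : probability Omega R).
Variables (Xt : nat -> {RV P >-> X}) (Yt : nat -> {RV P >-> 'I_K.+1}).

(* the alignments v extend to an infinite alignment for which the regeneration
   properties (R1), (R2), (R3) hold *)
Definition consistent (Xo : set X) (r : nat)
    (v : forall n, n.-tuple X -> n.-tuple 'I_K.+1) : Prop :=
  exists (vinf : (nat -> X) -> nat -> 'I_K.+1) (S : nat -> Omega -> nat)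
         (m : nat),
    [/\ infinite_viterbi_alignment Xt v vinf,
        regenerative P (Zt Xt Yt vinf) S,
        (0 < m)%N,
        {ae P, forall w,
           [/\ (m < S 0%N w)%N,
               forall j n, (S j w + m <= n)%N ->
                 forall i : 'I_n, (i.+1 <= S j w)%N ->
                   tnth (v n (obs Xt n w)) i = Vt Xt vinf i.+1 w &
               forall j, (m <= S j.+1 w - S j w)%N]} &
        {ae P, forall w, forall k t : nat, (1 <= t)%N ->
           ((t < S k w)%N ->
              (Wtime Xt Xo r t w <= ((S k w + m)%N%:R)%:E)%E) /\
           ((S k w < t)%N ->
              (((S k w)%:R - m%:R)%:E < Utime Xt Xo r t w)%E)}].

(* - (1/n) sum_{t = 1}^n ln P(Y_t = v^n(X^n)_t | X^n) *)
Definition R1_risk (pt : forall n, 'I_n -> 'I_K.+1 -> n.-tuple X -> R)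
    (v : forall n, n.-tuple X -> n.-tuple 'I_K.+1) (n : nat) (w : Omega) : R :=
  - (n%:R^-1 *
     \sum_(i < n) ln (pt n i (tnth (v n (obs Xt n w)) i) (obs Xt n w))).

End Consistent.

Section Convergence.
Context {d : measure_display} {Omega : measurableType d} {R : realType}.
Variable (P : probability Omega R).

Definition cvg_as (Z : nat -> Omega -> R) (c : R) : Prop :=
  {ae P, forall w, Z n w @[n --> \oo] --> c}.

Definition cvg_L1 (Z : nat -> Omega -> R) (c : R) : Prop :=
  (forall n, Z n \in Lfun P 1%E) /\
  ('N[P]_1[EFin \o (fun w => Z n w - c)%R] @[n --> \oo] --> 0)%E.

End Convergence.

(* Main.v *)
(* Let a block be a time interval of r + 1 consecutive observations in Xo. By the
   cluster condition the transfer matrices of a block multiply to a matrix that is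
   comparable to a rank-one matrix (an anchor). Three consequences are used.
   (1) Rerouting the Viterbi path at the nearest anchors around t shows that
       l_t = - ln P(Y_t = v_t | X^n) is at most affine in the distances from t to
       these anchors. The distances have geometric tails uniformly in t, and the sum
       over t of their large parts is, after exchanging summations, at most twice
       the sum of forward shifts of one functional of the observations with small
       mean.
   (2) Each anchor contracts ratios, so between windows rich in anchors l_t is within
       a small error of a function of V_t and of the observations in a bounded window
       around t, because v_t = V_t up to the last regeneration time before n - m.
   (3) Z is regenerative, so such window functions obey a law of large numbers, by the
       ergodicity of the cycle shift.
   Hence for every eps the risk is almost surely eventually within eps of a constant,
   so it converges almost surely to a constant; (1) also gives the uniform
   integrability behind the convergence in L1. *)
Require Import Defs.
From HB Require Import structures.
From mathcomp Require Import all_boot all_order all_algebra.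
From mathcomp Require Import all_classical all_reals all_analysis.
From mathcomp Require Import measurable_realfun ring lra zify.

Set Implicit Arguments.
Unset Strict Implicit.
Unset Printing Implicit Defensive.
Import Order.TTheory GRing.Theory Num.Theory.
Import numFieldNormedType.Exports.
Local Open Scope classical_set_scope.
Local Open Scope ring_scope.

(** * Maximal inequality and ergodic sums *)

(** Each [l_t] depends on all of [X^n], hence on [n], and [Z] is not assumed stationary, so no
    ergodic theorem applies to the risk itself. The limit is not written as an expectation over an
    infinite past; it is only caught in shrinking intervals around limiting averages of bounded
    window functions. Even a bounded window reaches beyond the end of a regeneration cycle, so its
    cycle sums are dependent: a zero-one law for the shift by one cycle takes the place of
    independence. The law seen from [S_0] may differ from the law at a fixed time, so means over a
    cycle must be recovered from moment bounds at fixed times. The reference measure [mu] need not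
    be sigma-finite, so no product density of [X^n] is used: dividing every [f s] by [\sum_a f a]
    gives weights bounded by one, and a symmetry between two emission laws plays the part of Bayes'
    formula. Parameters are chosen in a fixed order: first the tail cutoff [b'] and the number [b]
    of contractions, then the window scale [J], whose geometric gain must beat a truncation level
    that grows linearly in [J]. *)

Section MaximalErgodic.
Context {d : measure_display} {E : measurableType d} {R : realType}.
Variable (P : probability E R).
Variables (tau : E -> E) (F : E -> R).
Hypothesis mtau : measurable_fun setT tau.
Hypothesis Ptau : forall B, measurable B -> P (tau @^-1` B) = P B.
Hypothesis mF : measurable_fun setT F.
Hypothesis F0 : forall x, 0 <= F x.

Lemma measurable_iter n : measurable_fun [set: E] (iter n tau).
Proof.
elim: n => [|n IH]; first exact: measurable_id.
exact: (measurableT_comp mtau IH).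
Qed.

Lemma measure_iter n B : measurable B -> P (iter n tau @^-1` B) = P B.
Proof.
move=> mB; elim: n => [//|n IH].
rewrite -IH -[RHS]Ptau; last first.
  by rewrite -[X in measurable X]setTI; exact: measurable_iter.
by congr (P _); apply/funext => x /=; rewrite -iterSr.
Qed.

Lemma integral_iter (G : E -> \bar R) n : measurable_fun [set: E] G ->
  (forall x, 0 <= G x)%E ->
  (\int[P]_x G (iter n tau x) = \int[P]_x G x)%E.
Proof.
move=> mG G0.
pose m := isMeasurableFun.Build _ _ _ _ _ (measurable_iter n).
pose phi : {mfun E >-> E} := HB.pack (iter n tau) m.
transitivity (\int[pushforward P phi]_x G x)%E.
  by rewrite ge0_integral_pushforward.
by apply: (eq_measure_integral P) => A mA _; exact: measure_iter.
Qed.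

Lemma measurable_birkhoff n :
  measurable_fun [set: E] (fun x => \sum_(i < n) F (iter i tau x)).
Proof.
apply: measurable_sum => i; exact: (measurableT_comp mF (measurable_iter i)).
Qed.

(** Covering argument: an orbit is cut greedily into pieces of length at most [M] on which [F]
    averages at least [c]. Where no such piece starts, [F] is raised by [c] so that a piece of
    length one works; the measure of these points, and with it the cost of raising [F], vanishes as
    [M] grows. *)
Lemma maximal_ergodic (c : R) : 0 <= c ->
  {ae P, forall x, exists n : nat, (0 < n)%N /\
    c * n%:R <= \sum_(i < n) F (iter i tau x)} ->
  (c%:E <= \int[P]_x (F x)%:E)%E.
Proof.
move=> c0 aeG.
pose G M := [set x | exists n : nat, (0 < n <= M)%N /\
    c * n%:R <= \sum_(i < n) F (iter i tau x)].
have mG M : measurable (G M).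
  have -> : G M = \bigcup_(n in [set n | (0 < n <= M)%N])
      [set x | c * n%:R <= \sum_(i < n) F (iter i tau x)].
    apply/seteqP; split => x.
      by case=> n [nM h]; exists n.
    by case=> n nM h; exists n.
  apply: bigcup_measurable => n _; rewrite -[X in measurable X]setTI.
  by apply: measurable_fun_le => //; exact: measurable_birkhoff.
have GT : P (~` \bigcup_M G M) = 0%E.
  apply/negligibleP; first exact/measurableC/bigcupT_measurable.
  apply: negligibleS aeG => x /= h [n [n0 hn]]; apply: h.
  by exists n => //; exists n; rewrite n0 leqnn.
have cvgG : (P (~` G M) @[M --> \oo] --> 0)%E.
  rewrite -GT setC_bigcup; apply: nonincreasing_cvg_mu.
  - by apply: (le_lt_trans (probability_le1 _ _)); [exact: measurableC|rewrite ltry].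
  - by move=> M; exact: measurableC.
  - by rewrite -setC_bigcup; exact/measurableC/bigcupT_measurable.
  - move=> a b ab; apply/subsetPset/subsetC => x [n [/andP[n0 na] hn]].
    by exists n; rewrite n0 (leq_trans na).
pose Ft M x := F x + c * \1_(~` G M) x.
have Ft0 M x : 0 <= Ft M x by rewrite addr_ge0// mulr_ge0.
(* The loss [c * M] pays for the unfinished last piece: up to length [M] the left side is
   nonpositive. *)
have cover M n x : c * (n%:R - M%:R) <= \sum_(i < n) Ft M (iter i tau x).
  elim/ltn_ind: n x => n IH x.
  have [nM|Mn] := leqP n M.
    apply: (@le_trans _ _ 0); last by rewrite sumr_ge0.
    by rewrite mulr_ge0_le0// subr_le0 ler_nat.
  have shift k y : (k <= n)%N -> \sum_(i < n) Ft M (iter i tau y) =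
      \sum_(i < k) Ft M (iter i tau y) +
      \sum_(i < n - k) Ft M (iter i tau (iter k tau y)).
    move=> kn; rewrite -(big_mkord xpredT (fun i => Ft M (iter i tau y))).
    rewrite (@big_cat_nat _ _ _ k)//= big_mkord; congr (_ + _).
    rewrite -{1}(add0n k) big_addn big_mkord.
    by apply: eq_bigr => i _; rewrite iterD.
  have [[k [/andP[k0 kM] hk]]|nG] := pselect (G M x).
    have kn : (k <= n)%N by rewrite (leq_trans kM)// ltnW.
    rewrite (shift k)//.
    apply: (@le_trans _ _ (c * k%:R + c * ((n - k)%:R - M%:R))).
      by rewrite natrB// -mulrDr ler_wpM2l//; lra.
    apply: lerD; last by apply: IH; rewrite ltn_subrL k0 (leq_trans _ Mn).
    apply: le_trans hk _; apply: ler_sum => i _.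
    by rewrite lerDl mulr_ge0.
  have n0 : (0 < n)%N by rewrite (leq_trans _ Mn).
  rewrite (shift 1%N)// big_ord1.
  apply: (@le_trans _ _ (c + c * ((n - 1)%:R - M%:R))).
    by rewrite natrB//; lra.
  apply: lerD; last by apply: IH; lia.
  rewrite /Ft indicE mem_set// mulr1 lerDr//.
have mFt M : measurable_fun setT (Ft M).
  apply: measurable_funD => //; apply: measurable_funM => //.
  by apply: measurable_indic; exact: measurableC.
have intFt M n : (n%:R%:E * \int[P]_x (Ft M x)%:E =
    \int[P]_x (\sum_(i < n) Ft M (iter i tau x))%R%:E)%E.
  under [RHS]eq_integral do rewrite -sumEFin.
  rewrite ge0_integral_sum//; last 2 first.
  - move=> i; apply/measurable_EFinP.
    exact: (measurableT_comp (mFt M) (measurable_iter i)).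
  - by move=> i x _; rewrite lee_fin.
  rewrite (eq_bigr (fun=> \int[P]_x (Ft M x)%:E)%E); last first.
    move=> i _; apply: (@integral_iter (EFin \o Ft M)) => //.
      exact/measurable_EFinP.
    by move=> x; rewrite lee_fin.
  by rewrite sumr_const card_ord mule_natl.
have lbn M n : ((c * (n%:R - M%:R))%:E <= n%:R%:E * \int[P]_x (Ft M x)%:E)%E.
  rewrite intFt; apply: (@le_trans _ _ (\int[P]_x (c * (n%:R - M%:R))%:E)%E).
    by rewrite integral_cst// [X in (_ * X)%E]probability_setT mule1.
  rewrite -subr_ge0 in c0.
  have [nM|Mn] := leP (n%:R : R) M%:R.
    apply: (@le_trans _ _ 0%E).
      by rewrite integral_cst// [X in (_ * X)%E]probability_setT mule1 lee_fin
        mulr_ge0_le0 ?subr_le0//; lra.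
    by apply: integral_ge0 => x _; rewrite lee_fin sumr_ge0.
  apply: ge0_le_integral => //.
  - by move=> x _; rewrite lee_fin mulr_ge0//; lra.
  - apply/measurable_EFinP; apply: measurable_sum => i.
    exact: (measurableT_comp (mFt M) (measurable_iter i)).
  - by move=> x _; rewrite lee_fin cover.
have splitFt M : (\int[P]_x (Ft M x)%:E =
    \int[P]_x (F x)%:E + c%:E * P (~` G M))%E.
  under eq_integral do rewrite EFinD.
  rewrite ge0_integralD//.
  - congr (_ + _)%E; under eq_integral do rewrite EFinM.
    rewrite ge0_integralZl//.
    + by rewrite integral_indic ?setIT//; exact: measurableC.
    + apply/measurable_EFinP/measurable_indic; exact: measurableC.
  - by move=> x _; rewrite lee_fin.
  - exact/measurable_EFinP.
  - by move=> x _; rewrite lee_fin mulr_ge0.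
  - apply/measurable_EFinP; apply: measurable_funM => //.
    by apply: measurable_indic; exact: measurableC.
have [->|Ffin] := eqVneq (\int[P]_x (F x)%:E)%E +oo%E; first exact: leey.
have IF : (\int[P]_x (F x)%:E)%E \is a fin_num.
  rewrite ge0_fin_numE ?ltey//; apply: integral_ge0 => x _; by rewrite lee_fin.
have bnd M : (c%:E <= \int[P]_x (F x)%:E + c%:E * P (~` G M))%E.
  rewrite -splitFt.
  have fF : (\int[P]_x (Ft M x)%:E)%E \is a fin_num.
    rewrite splitFt fin_numD IF fin_numM// fin_num_measure//; exact: measurableC.
  rewrite -(fineK fF) lee_fin.
  apply/ler_addgt0Pr => e e0.
  (* [n] is so large that the boundary loss [c * M / n] is below [e]. *)
  have [n hn] : exists n : nat, c * M%:R / e < n%:R.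
    exists (Num.bound (c * M%:R / e)); apply: le_lt_trans (archi_boundP _) => //.
    by rewrite divr_ge0 ?mulr_ge0// ltW.
  have n0 : (0 : R) < n%:R.
    by apply: le_lt_trans hn; rewrite divr_ge0 ?mulr_ge0// ltW.
  have := lbn M n; rewrite -(fineK fF) -EFinM lee_fin => h.
  rewrite -(ler_pM2l n0) mulrDr.
  rewrite ltr_pdivrMr// in hn.
  by lra.
have lim1 : (\int[P]_x (F x)%:E + c%:E * P (~` G M))%E @[M --> \oo] -->
    (\int[P]_x (F x)%:E + c%:E * 0)%E.
  apply: cvgeD; first by rewrite fin_num_adde_defl.
    exact: cvg_cst.
  exact: cvgeZl.
rewrite -[leRHS]adde0 -[X in (_ + X)%E](mule0 c%:E).
apply: (lee_cvg_to (cvg_cst _) lim1).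
by near=> M; exact: bnd.
Unshelve. all: by end_near. Qed.
End MaximalErgodic.

(** Monotone convergence over truncations. It reduces the lower bound for ergodic sums to bounded
    functions, so that [F] may have infinite mean. *)
Lemma truncated_integral_gt d (E : measurableType d) (R : realType)
    (P : {measure set E -> \bar R}) (F : E -> R) (c : R) :
  measurable_fun [set: E] F -> (forall x, 0 <= F x) ->
  (c%:E < \int[P]_x (F x)%:E)%E ->
  exists B : nat, (c%:E < \int[P]_x (Num.min (F x) B%:R)%:E)%E.
Proof.
move=> mF F0 cF.
pose g (B : nat) (x : E) := (Num.min (F x) B%:R)%:E.
have ndg x : {homo g^~ x : n m / (n <= m)%N >-> (n <= m)%E}.
  move=> n m nm; rewrite lee_fin le_min ge_min lexx/= ge_min ler_nat nm orbT//.
have mg n : measurable_fun setT (g n).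
  exact/measurable_EFinP/measurable_minr.
have g0 n x : (0 <= g n x)%E by rewrite lee_fin le_min F0/=.
have limg x : limn (g^~ x) = (F x)%:E.
  apply/cvg_lim => //; apply: cvg_near_cst; near=> n.
  rewrite /g min_l//; near: n; exact: nbhs_infty_ger.
have := cF; under eq_integral do rewrite -limg.
rewrite (monotone_convergence P measurableT mg) => [cl||]; last 2 first.
- by move=> n x _; exact: g0.
- by move=> x _; exact: ndg.
have ndi : {homo (fun n => \int[P]_x g n x)%E : n m / (n <= m)%N >-> (n <= m)%E}.
  move=> n m nm; apply: ge0_le_integral => // x _; exact: ndg.
move: cl; rewrite (cvg_lim _ (ereal_nondecreasing_cvgn ndi))//.
by move/ereal_sup_gt => [_ [N _ <-] cN]; exists N.
Unshelve. all: by end_near. Qed.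

Section ErgodicSums.
Context {d : measure_display} {E : measurableType d} {R : realType}.
Variable (P : probability E R).
Variables (tau : E -> E).
Hypothesis mtau : measurable_fun [set: E] tau.
Hypothesis Ptau : forall B, measurable B -> P (tau @^-1` B) = P B.
Hypothesis ergP : forall B, measurable B -> tau @^-1` B = B ->
  P B = 0%E \/ P B = 1%E.

(* The event that the drifted sums are unbounded above is exactly invariant, and
   if it has probability one then the maximal inequality bounds the drift. *)
Lemma ergodic_sums_ub (F : E -> R) (c : R) :
  measurable_fun [set: E] F -> (forall x, 0 <= F x) ->
  (\int[P]_x (F x)%:E < c%:E)%E ->
  {ae P, forall x, exists M : R, forall n,
     \sum_(i < n) F (iter i tau x) <= c * n%:R + M}.
Proof.
move=> mF F0 Fc.
have c0 : 0 <= c.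
  rewrite -lee_fin; apply: le_trans (ltW Fc).
  by apply: integral_ge0 => x _; rewrite lee_fin.
pose I := [set x | forall M : nat, exists n,
  M%:R <= \sum_(i < n) F (iter i tau x) - c * n%:R].
have mI : measurable I.
  have -> : I = \bigcap_M \bigcup_n
      [set x | M%:R <= \sum_(i < n) F (iter i tau x) - c * n%:R].
    apply/seteqP; split => x h M.
      by move=> _; have [n hn] := h M; exists n.
    by have [n _ hn] := h M Logic.I; exists n.
  apply: bigcapT_measurable => M; apply: bigcupT_measurable => n.
  rewrite -[X in measurable X]setTI; apply: measurable_fun_le => //.
  by apply: measurable_funB => //; exact: measurable_birkhoff.
have sumS n x : \sum_(i < n.+1) F (iter i tau x) =
    F x + \sum_(i < n) F (iter i tau (tau x)).
  rewrite big_ord_recl/=; congr (_ + _); apply: eq_bigr => i _.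
  by rewrite -iterSr.
have tauI : tau @^-1` I = I.
  apply/seteqP; split => x h M.
  - have [M' hM'] : exists M' : nat, M%:R + c <= M'%:R.
      exists (Num.bound (M%:R + c)); apply: ltW; apply: archi_boundP.
      by rewrite addr_ge0.
    have [n hn] := h M'; exists n.+1; rewrite sumS.
    have := F0 x; rewrite -natr1; lra.
  (* The added [1] makes the threshold positive; this rules out the empty sum [n = 0], so the term
     [F x] can be split off. *)
  - have [M' hM'] : exists M' : nat, M%:R + F x + 1 <= M'%:R.
      exists (Num.bound (M%:R + F x + 1)); apply: ltW; apply: archi_boundP.
      by rewrite !addr_ge0.
    have [[|n] hn] := h M'.
      move: hn; rewrite big_ord0; have := F0 x; have : (0 : R) <= M%:R by [].
      lra.
    exists n; move: hn; rewrite sumS -natr1; lra.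
have [PI|PI] := ergP mI tauI.
  exists I; split => // x /= h; apply: contrapT => nI; apply: h.
  have [M hM] : exists M : nat, forall n,
      \sum_(i < n) F (iter i tau x) - c * n%:R < M%:R.
    apply: contrapT => hM; apply: nI => M; apply: contrapT => hn.
    apply: hM; exists M => n; rewrite ltNge; apply/negP => hn'.
    by apply: hn; exists n.
  by exists M%:R => n; have := hM n; lra.
exfalso; move: Fc; apply/negP; rewrite -leNgt.
apply: (maximal_ergodic mtau Ptau mF F0 c0).
exists (~` I); split; first exact: measurableC.
  by rewrite probability_setC// PI subee.
move=> x /= + Ix; apply; have [[|n] hn] := Ix 1%N.
  by move: hn; rewrite big_ord0; lra.
by exists n.+1; split => //; lra.
Qed.

(** The upper bound is applied to [B - min F B], which is nonnegative and bounded, at a truncation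
    level [B] that keeps the mean above [c]. *)
Lemma ergodic_sums_lb (F : E -> R) (c : R) :
  measurable_fun [set: E] F -> (forall x, 0 <= F x) ->
  (c%:E < \int[P]_x (F x)%:E)%E ->
  {ae P, forall x, exists M : R, forall n,
     c * n%:R - M <= \sum_(i < n) F (iter i tau x)}.
Proof.
move=> mF F0 /(truncated_integral_gt mF F0)[B cB].
pose G x := B%:R - Num.min (F x) B%:R.
have mm : measurable_fun [set: E] (fun x => Num.min (F x) B%:R).
  exact: measurable_minr.
have G0 x : 0 <= G x by rewrite subr_ge0 ge_min lexx orbT.
have mG : measurable_fun [set: E] G by exact: measurable_funB.
have im : P.-integrable setT (EFin \o (fun x => Num.min (F x) B%:R)).
  apply: measurable_bounded_integrable => //.
    by rewrite [X in (X < _)%E]probability_setT ltry.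
  exists B%:R; split => // M BM x _ /=; rewrite ger0_norm ?le_min ?F0//=.
  by rewrite ge_min (ltW BM) orbT.
have Gc : (\int[P]_x (G x)%:E < (B%:R - c)%:E)%E.
  under eq_integral do rewrite EFinB.
  rewrite integralB_EFin//; last exact: finite_measure_integrable_cst.
  rewrite integral_cst// [X in (_ * X)%E]probability_setT mule1.
  have fm : (\int[P]_x (Num.min (F x) B%:R)%:E)%E \is a fin_num.
    exact: integrable_fin_num im.
  by move: cB; rewrite -(fineK fm) -EFinB !lte_fin; lra.
have := ergodic_sums_ub mG G0 Gc; apply: filterS => x [M hM].
exists M => n; have := hM n; rewrite sumrB sumr_const card_ord.
have : \sum_(i < n) Num.min (F (iter i tau x)) B%:R <=
    \sum_(i < n) F (iter i tau x).
  by apply: ler_sum => i _; rewrite ge_min lexx.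
rewrite -mulr_natr; lra.
Qed.

End ErgodicSums.

(** * Cycles and law of large numbers of a regenerative process *)

Notation seqspace T := (g_sigma_algebraType (cylinders T)).

Section SequenceSpace.
Context {d : measure_display} {T : measurableType d}.

Lemma measurable_coordinate (t : nat) :
  measurable_fun [set: seqspace T] (fun z : seqspace T => z t).
Proof.
move=> _ B mB; apply: sub_sigma_algebra; exists t => //.
by exists B.
Qed.

Lemma measurable_to_seqspace d' (X : measurableType d')
    (f : X -> seqspace T) :
  (forall t, measurable_fun [set: X] (fun x => f x t)) ->
  measurable_fun [set: X] f.
Proof.
move=> mf; apply: (@measurability _ _ X (seqspace T) _ _ (cylinders T)) => //.
move=> _ [_ [t _ [B mB <-]] <-]; rewrite !setTI.
rewrite -[X in measurable X]setTI; exact: mf.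
Qed.

(** Unlike [cylinders], this generating family is stable under intersection, as the Dynkin argument
    for the zero-one law requires. *)
Definition rectangles : set (set (nat -> T)) :=
  [set A | exists (N : nat) (B : nat -> set T), (forall t, measurable (B t)) /\
     A = [set z | forall t, (t <= N)%N -> B t (z t)]].

Lemma rectangles_generate :
  (@measurable _ (seqspace T) : set (set (nat -> T))) = <<s rectangles >>.
Proof.
apply/seteqP; split; last first.
  apply: smallest_sub; first exact: sigma_algebra_measurable.
  move=> _ [N [B [mB ->]]].
  have -> : [set z | forall t, (t <= N)%N -> B t (z t)] =
      \bigcap_(t in [set t | (t <= N)%N])
         ((fun z : seqspace T => z t) @^-1` (B t)).
    by apply/seteqP; split => z /=.
  apply: bigcap_measurable; first by exists 0%N.
  move=> t _; rewrite -[X in measurable X]setTI.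
  exact: measurable_coordinate.
apply: smallest_sub; first exact: smallest_sigma_algebra.
move=> _ [t _ [B mB <-]]; rewrite setTI; apply: sub_sigma_algebra.
exists t, (fun s => if s == t then B else setT); split.
  by move=> s; case: ifP.
apply/seteqP; split => z /=.
  by move=> Bz s _; case: eqP => // ->.
by move/(_ t (leqnn t)); rewrite eqxx.
Qed.

Lemma rectangles_setI : setI_closed rectangles.
Proof.
move=> _ _ [N [B [mB ->]]] [M [C [mC ->]]].
exists (maxn N M), (fun t => (if (t <= N)%N then B t else setT) `&`
  (if (t <= M)%N then C t else setT)); split.
  by move=> t; apply: measurableI; case: ifP.
apply/seteqP; split => z /=.
  by move=> [Bz Cz] t _; split; case: ifP => // h; [exact: Bz|exact: Cz].
move=> h; split => t tN.
  by have [] := h t (leq_trans tN (leq_maxl _ _)); rewrite tN.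
by have [_] := h t (leq_trans tN (leq_maxr _ _)); rewrite tN.
Qed.

End SequenceSpace.

Lemma measurable_select d d' (X : measurableType d) (T : measurableType d')
    (N : X -> nat) (g : nat -> X -> T) :
  measurable_fun [set: X] N -> (forall n, measurable_fun [set: X] (g n)) ->
  measurable_fun [set: X] (fun x => g (N x) x).
Proof.
move=> mN mg _ B mB; rewrite setTI.
have -> : (fun x => g (N x) x) @^-1` B =
    \bigcup_n (N @^-1` [set n] `&` g n @^-1` B).
  apply/seteqP; split => x /=; first by move=> h; exists (N x).
  by move=> [n _ [/= ->]].
apply: bigcupT_measurable => n; apply: measurableI.
  by rewrite -[X in measurable X]setTI; exact: mN.
by rewrite -[X in measurable X]setTI; exact: mg.
Qed.

Lemma ae_measure_eq d (X : measurableType d) (R : realType)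
    (P : {measure set X -> \bar R}) (A B : set X) :
  measurable A -> measurable B -> {ae P, forall x, A x <-> B x} -> P A = P B.
Proof.
move=> mA mB AB; rewrite -[A]setIT -[B]setIT -!integral_indic//.
apply: ae_eq_integral => //.
- exact/measurable_EFinP/measurable_indic.
- exact/measurable_EFinP/measurable_indic.
- move: AB; apply: filterS => x ABx _; rewrite /= !indicE; congr (_%:R)%:E.
  by congr nat_of_bool; apply/idP/idP; rewrite !inE ABx.
Qed.

Section RegenerativeErgodic.
Context {d d' : measure_display} {Omega : measurableType d}
  {T : measurableType d'} {R : realType}.
Variable (P : probability Omega R).
Variables (Z : nat -> Omega -> T) (S : nat -> Omega -> nat).
Hypothesis regZ : regenerative P Z S.
Hypothesis S0 : {ae P, forall w, (0 < S 0%N w)%N}.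

Let E := seqspace (T * nat)%type.

(** The two components of [z] run on different clocks: the first by time after [S_0], the second by
    the index of the regeneration. So [(z 1).2] is the length of the first cycle, and dropping that
    cycle moves the first clock by this length and the second by one. *)
Definition cycle_shift (z : E) : E :=
  fun t => ((z ((z 1%N).2 + t)%N).1, ((z t.+1).2 - (z 1%N).2)%N).

Lemma measurable_cycle_shift : measurable_fun [set: E] cycle_shift.
Proof.
apply: measurable_to_seqspace => t; apply: measurable_fun_pair.
  apply: (measurable_select (N := fun z : E => (z 1%N).2)
    (g := fun n (z : E) => (z (n + t)%N).1)).
    exact: (measurableT_comp measurable_snd (measurable_coordinate 1%N)).
  by move=> n; exact: (measurableT_comp measurable_fst (measurable_coordinate _)).
apply: measurable_fun_subn.
  exact: (measurableT_comp measurable_snd (measurable_coordinate _)).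
exact: (measurableT_comp measurable_snd (measurable_coordinate _)).
Qed.

Lemma measurable_shifted k : measurable_fun [set: Omega] (shifted Z S k : Omega -> E).
Proof.
case: regZ => [[mZ [mS _]] _ _ _ _].
apply: measurable_to_seqspace => t; apply: measurable_fun_pair.
  apply: (measurable_select (N := S k) (g := fun n w => Z (n + t)%N w)) => //.
exact: measurable_fun_subn.
Qed.

Lemma regenerative_increasing :
  {ae P, forall w, forall j k, (S j w + k <= S (j + k) w)%N}.
Proof.
case: regZ => [[_ [_ incS]] _ _ _ _]; move: incS; apply: filterS => w incS j.
elim=> [|k IH]; first by rewrite !addn0.
by rewrite !addnS; exact: leq_ltn_trans IH (incS _).
Qed.

(** Only almost sure: the truncated differences in [shifted] compose correctly only when the
    regeneration times increase. *)
Lemma shiftedE : {ae P, forall w, forall k,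
  iter k cycle_shift (shifted Z S 0 w) = shifted Z S k w}.
Proof.
move: regenerative_increasing; apply: filterS => w incS.
elim=> [//|k IH]; rewrite iterS IH.
have kk1 : (S k w <= S (k + 1) w)%N by have := incS k 1%N; lia.
apply/funext => t; rewrite /cycle_shift /shifted/=; congr (Z _ _, _).
  by rewrite addnA subnKC// addn1.
by rewrite addn1 in kk1; rewrite addn1 addnS -addSn; lia.
Qed.

Let mixin := isMeasurableFun.Build _ _ _ _ _ (measurable_shifted 0).
Let cycles : {mfun Omega >-> E} := HB.pack (shifted Z S 0) mixin.

Definition cycle_law : probability E R := distribution P cycles.

Lemma cycle_lawE B : cycle_law B = P (shifted Z S 0 @^-1` B).
Proof. by []. Qed.

Lemma integral_cycle_law (G : E -> \bar R) : measurable_fun [set: E] G ->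
  (forall z, 0 <= G z)%E ->
  (\int[cycle_law]_z G z = \int[P]_w G (shifted Z S 0 w))%E.
Proof. by move=> mG G0; rewrite ge0_integral_distribution. Qed.

Lemma ae_cycle_law (Q : E -> Prop) : {ae cycle_law, forall z, Q z} ->
  {ae P, forall w, Q (shifted Z S 0 w)}.
Proof.
move=> [N [mN N0 QN]]; exists (shifted Z S 0 @^-1` N); split => //.
  by rewrite -[X in measurable X]setTI; exact: measurable_shifted.
by move=> w /= nQ; exact: QN.
Qed.

Lemma cycle_law_shift B : measurable B ->
  cycle_law (cycle_shift @^-1` B) = cycle_law B.
Proof.
move=> mB; rewrite !cycle_lawE.
case: regZ => [_ _ eqlaw _ _]; rewrite -(eqlaw 1%N B)//.
apply: ae_measure_eq.
- rewrite -[X in measurable X]setTI -comp_preimage.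
  exact: (measurableT_comp measurable_cycle_shift (measurable_shifted 0)).
- by rewrite -[X in measurable X]setTI; exact: measurable_shifted.
- by move: shiftedE; apply: filterS => w /(_ 1%N)/= <-.
Qed.

Let past_generators (k : nat) : set (set Omega) :=
  [set A | (exists (t : nat) (B : set T),
              [/\ (1 <= t)%N, measurable B &
                  A = [set w | (t < S k w)%N /\ B (Z t w)]]) \/
           (exists i s : nat, (i <= k)%N /\ A = [set w | S i w = s])].

Let pastT k := g_sigma_algebraType (past_generators k).

Lemma past_eq_S k i s : (i <= k)%N ->
  measurable ([set w | S i w = s] : set (pastT k)).
Proof. by move=> ik; apply: sub_sigma_algebra; right; exists i, s. Qed.

Lemma past_Z k t B : (1 <= t)%N -> measurable B ->
  measurable ([set w | (t < S k w)%N /\ B (Z t w)] : set (pastT k)).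
Proof. by move=> t1 mB; apply: sub_sigma_algebra; left; exists t, B. Qed.

(* A rectangle in the first N + 1 coordinates seen from [S 0] is, up to a null
   set, an event of the past of the (N + 1)-st regeneration. *)
Lemma rectangle_past (N : nat) (B : nat -> set (T * nat)) :
  (forall t, measurable (B t)) ->
  exists A : set Omega, past Z S N.+1 A /\
    {ae P, forall w, A w <-> forall t, (t <= N)%N -> B t (shifted Z S 0 w t)}.
Proof.
move=> mB.
(* The values of [S 0] and [S t] are fixed because the past records [Z] at deterministic positive
   times. The time [s.+1 + t] precedes [S N.+1] since [t <= N] and every cycle has length at least
   one. *)
pose A := \bigcup_s ([set w | S 0%N w = s.+1] `&`
  \bigcap_(t in [set t | (t <= N)%N]) \bigcup_u ([set w | S t w = u] `&`
    [set w | (s.+1 + t < S N.+1 w)%N /\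
       ysection (B t) (u - s.+1)%N (Z (s.+1 + t)%N w)])).
exists A; split.
  suff : measurable (A : set (pastT N.+1)) by [].
  apply: bigcupT_measurable => s; apply: measurableI; first exact: past_eq_S.
  apply: bigcap_measurable; first by exists 0%N.
  move=> t /= tN; apply: bigcupT_measurable => u; apply: measurableI.
    by apply: past_eq_S; rewrite ltnW.
  apply: past_Z => //; exact: measurable_ysection.
move: regenerative_increasing S0; apply: filterS2 => w incS S0w.
have memB t s u : ysection (B t) u (Z s w) <-> B t (Z s w, u).
  by rewrite /ysection/= inE.
split.
  move=> [s _ [/= S0s h]] t tN; have [u _ [/= Stu [_ /memB]]] := h t tN.
  by rewrite /shifted add0n S0s Stu.
move=> h; exists (S 0%N w).-1 => //; split => /=; first by rewrite prednK.
move=> t /= tN; exists (S t w) => //; split => //=; rewrite prednK//; split.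
  have := incS 0%N N.+1; rewrite add0n; lia.
by apply/memB; have := h t tN; rewrite /shifted add0n.
Qed.

(** Kolmogorov's argument: an invariant event agrees almost surely with the same event seen from
    [S N.+1], hence is independent of every rectangle in the coordinates [0, ..., N]. By Dynkin's
    lemma it is independent of itself. *)
Lemma cycle_law_ergodic B : measurable B -> cycle_shift @^-1` B = B ->
  cycle_law B = 0%E \/ cycle_law B = 1%E.
Proof.
move=> mB invB.
have mz k (A : set E) : measurable A -> measurable (shifted Z S k @^-1` A).
  by move=> mA; rewrite -[X in measurable X]setTI; exact: measurable_shifted.
have invk k : {ae P, forall w, B (shifted Z S k w) <-> B (shifted Z S 0 w)}.
  move: shiftedE; apply: filterS => w /(_ k) <-.
  suff -> : B (iter k cycle_shift (shifted Z S 0 w)) = B (shifted Z S 0 w) by [].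
  elim: k => [//|k IH]; rewrite iterS -IH.
  by rewrite -[in RHS]invB.
suff indep (A : set E) : measurable A ->
    P (shifted Z S 0 @^-1` A `&` shifted Z S 0 @^-1` B) =
    (P (shifted Z S 0 @^-1` A) * P (shifted Z S 0 @^-1` B))%E.
  have := indep B mB; rewrite setIid -cycle_lawE => h.
  have fB : cycle_law B \is a fin_num by exact: fin_num_measure.
  move: h; rewrite -(fineK fB) -EFinM => -[] /eqP.
  rewrite -{1}[fine _]mulr1 -subr_eq0 -mulrBr mulf_eq0 subr_eq0.
  by case/orP => /eqP h; [left|right]; rewrite -?h// h.
rewrite rectangles_generate; move: A.
apply: (@dynkin_induction _ E rectangles (fun A => P (shifted Z S 0 @^-1` A `&`
  shifted Z S 0 @^-1` B) =
  (P (shifted Z S 0 @^-1` A) * P (shifted Z S 0 @^-1` B))%E)).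
- exact: rectangles_generate.
- exact: rectangles_setI.
- by rewrite preimage_setT setTI probability_setT mul1e.
- move=> A [N [C [mC AE]]].
  have [A' [pA' A'E]] := rectangle_past N mC.
  have mA : measurable (A : set E).
    rewrite rectangles_generate; apply: sub_sigma_algebra.
    by exists N, C.
  have mA' : measurable A'.
    move: A' pA' {A'E}; apply: smallest_sub.
      exact: sigma_algebra_measurable.
    case: regZ => [[mZ [mS _]] _ _ _ _].
    move=> _ [[t [D [t1 mD ->]]]|[i [s [iN ->]]]].
      apply: measurableI; rewrite -[X in measurable X]setTI.
        exact: (mS _ measurableT [set k | (t < k)%N]).
      exact: mZ.
    by rewrite -[X in measurable X]setTI; exact: (mS _ measurableT [set s]).
  have e1 : P (shifted Z S 0 @^-1` A) = P A'.
    apply: ae_measure_eq => //; first exact: mz.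
    by move: A'E; apply: filterS => w A'w; rewrite /= AE; split=> h; exact/A'w.
  have e2 : P (shifted Z S N.+1 @^-1` B) = P (shifted Z S 0 @^-1` B).
    by apply: ae_measure_eq; [exact: mz|exact: mz|exact: invk].
  case: regZ => [_ indep _ _ _].
  rewrite e1 -e2 -indep//.
  apply: ae_measure_eq.
  + by apply: measurableI; exact: mz.
  + by apply: measurableI => //; exact: mz.
  + move: A'E (invk N.+1); apply: filterS2 => w A'w Bw.
    rewrite /= AE; split=> -[h1 h2]; split; [exact/A'w|exact/Bw|exact/A'w|].
    exact/Bw.
- move=> A mA IH; rewrite preimage_setC probability_setC; last exact: mz.
  rewrite setIC -setDE measureD; [|exact: mz|exact: mz|]; last first.
    by apply: (le_lt_trans (probability_le1 _ _)); [exact: mz|rewrite ltry].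
  have fP k (D : set E) : measurable D -> P (shifted Z S k @^-1` D) \is a fin_num.
    by move=> mD; rewrite fin_num_measure//; exact: mz.
  rewrite (setIC (shifted Z S 0 @^-1` B)) [X in (_ - X)%E]IH.
  rewrite -(fineK (fP 0%N _ mA)) -(fineK (fP 0%N _ mB)).
  rewrite -EFinM -!EFinB -EFinM mulrBl mul1r EFinB.
  by rewrite (fineK (fP 0%N _ mB)).
- move=> F mF tF IH.
  have tz : trivIset setT (fun k => shifted Z S 0 @^-1` F k).
    by move=> i j _ _ [w [h1 h2]]; apply: (tF i j) => //; exists (shifted Z S 0 w).
  have fB : P (shifted Z S 0 @^-1` B) \is a fin_num.
    by rewrite fin_num_measure//; exact: mz.
  rewrite preimage_bigcup setI_bigcupl measure_bigcup//; last 2 first.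
  + by move=> k _; apply: measurableI; exact: mz.
  + exact: trivIset_setIr.
  rewrite measure_bigcup//; last by move=> k _; exact: mz.
  rewrite -(fineK fB) muleC -nneseriesZl//.
  by apply: eq_eseriesr => k _; rewrite [LHS]IH muleC fineK.
Qed.

End RegenerativeErgodic.

(** * Passing from sums over cycles to sums over time *)

Section RenewalSums.
Context {R : realType}.
Variables (S : nat -> nat) (a : nat -> R).
Hypothesis a0 : forall t, 0 <= a t.
Hypothesis S0 : (0 < S 0%N)%N.
Hypothesis incS : forall j k, (S j + k <= S (j + k))%N.

Let U N := \sum_(S 0%N <= t < S N) a t.

Let ndS j k : (j <= k)%N -> (S j <= S k)%N.
Proof. by move=> jk; have := incS j (k - j); rewrite subnKC//; lia. Qed.

Let sum1E n : \sum_(i < n) a i.+1 = \sum_(1 <= t < n.+1) a t.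
Proof. by rewrite big_add1 big_mkord. Qed.

Let le_sum (m1 n1 m2 n2 : nat) : (m2 <= m1)%N -> (n1 <= n2)%N ->
  \sum_(m1 <= t < n1) a t <= \sum_(m2 <= t < n2) a t.
Proof.
move=> m12 n12; have [n1m1|m1n1] := leqP n1 m1.
  by rewrite big_geq// sumr_ge0.
rewrite (@big_cat_nat _ _ _ m1 m2 n2)//=; last by lia.
rewrite (@big_cat_nat _ _ _ n1 m1 n2)//=; last by lia.
have := @sumr_ge0 _ _ (index_iota m2 m1) xpredT a (fun i _ => a0 i).
have := @sumr_ge0 _ _ (index_iota n1 n2) xpredT a (fun i _ => a0 i).
by lra.
Qed.

(** With [N] the last index such that [S N <= n + 1], the complete cycles give a lower bound for the
    sum, and [S N.+1 > n + 1] turns the growth bound on [S] into a lower bound for [N]. *)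
Lemma renewal_sums_lb (b c M1 M2 : R) : 0 <= c -> 0 < b ->
  (forall N, c * N%:R - M1 <= U N) -> (forall N, (S N)%:R <= b * N%:R + M2) ->
  exists M, forall n, c / b * n%:R - M <= \sum_(i < n) a i.+1.
Proof.
move=> c0 b0 hU hS.
have cb0 : 0 <= c / b by rewrite divr_ge0// ltW.
exists (c / b * (S 0%N)%:R + `|M1| + c + c / b * `|M2|) => n.
have hM1 := ler_norm M1; have hM2 := ler_norm M2.
have [nS|Sn] := ltnP n.+1 (S 0%N).
  apply: (@le_trans _ _ 0); last by rewrite sumr_ge0.
  have : c / b * n%:R <= c / b * (S 0%N)%:R by rewrite ler_wpM2l// ler_nat; lia.
  have : 0 <= c / b * `|M2| by rewrite mulr_ge0.
  have := normr_ge0 M1; lra.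
have exN : exists N, (S N <= n.+1)%N by exists 0%N.
have ubN N : (S N <= n.+1)%N -> (N <= n.+1)%N.
  by have := incS 0%N N; rewrite add0n; lia.
case: (ex_maxnP exN ubN) => N SN maxN.
have SN1 : (n.+1 < S N.+1)%N.
  by rewrite ltnNge; apply/negP => /maxN; rewrite ltnn.
rewrite sum1E; apply: (@le_trans _ _ (U N)); last exact: le_sum.
apply: le_trans (hU N).
have h1 : (n%:R : R) <= b * N.+1%:R + M2.
  by apply: le_trans (hS N.+1); rewrite ler_nat; lia.
have h2 : c / b * n%:R <= c / b * (b * N.+1%:R + M2) by rewrite ler_wpM2l.
have h3 : c / b * (b * N.+1%:R + M2) = c * N%:R + c + c / b * M2.
  by rewrite -natr1; field; rewrite gt_eqF.
have h4 : c / b * M2 <= c / b * `|M2| by rewrite ler_wpM2l.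
have h5 : 0 <= c / b * (S 0%N)%:R by rewrite mulr_ge0.
lra.
Qed.

(** Dually, [N] is the first index with [n < S N]: the cycles up to [N] cover [1, ..., n] except for
    the times before [S 0], whose sum [M0] goes into the constant. *)
Lemma renewal_sums_ub (b c M1 M2 : R) : 0 <= c -> 0 < b ->
  (forall N, U N <= c * N%:R + M1) -> (forall N, b * N%:R - M2 <= (S N)%:R) ->
  exists M, forall n, \sum_(i < n) a i.+1 <= c / b * n%:R + M.
Proof.
move=> c0 b0 hU hS.
have cb0 : 0 <= c / b by rewrite divr_ge0// ltW.
pose M0 := \sum_(1 <= t < S 0%N) a t.
exists (M0 + `|M1| + c + c / b * `|M2|) => n.
have hM1 := ler_norm M1; have hM2 := ler_norm M2.
have exN : exists N, (n < S N)%N.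
  by exists n.+1; have := incS 0%N n.+1; rewrite add0n; lia.
case: (ex_minnP exN) => N SN minN.
have hle : \sum_(i < n) a i.+1 <= M0 + U N.
  rewrite sum1E (_ : M0 + U N = \sum_(1 <= t < S N) a t).
    exact: le_sum.
  by rewrite (@big_cat_nat _ _ _ (S 0%N))//=; exact: ndS.
apply: le_trans hle _; have := hU N.
have h4 : c / b * M2 <= c / b * `|M2| by rewrite ler_wpM2l.
have h5 : 0 <= c / b * n%:R by rewrite mulr_ge0.
suff : c * N%:R <= c + c / b * M2 + c / b * n%:R \/ N = 0%N.
  case=> [|->]; rewrite ?mulr0; first by lra.
  have : 0 <= c / b * `|M2| by rewrite mulr_ge0.
  lra.
case: N SN minN => [|N] SN minN; [by right|left].
have SNn : (S N <= n)%N.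
  by rewrite leqNgt; apply/negP => /minN; rewrite ltnn.
have h1 : b * N%:R - M2 <= n%:R by apply: le_trans (hS N) _; rewrite ler_nat.
have h2 : c / b * (b * N%:R - M2) <= c / b * n%:R by rewrite ler_wpM2l.
have h3 : c / b * (b * N%:R - M2) = c * N%:R - c / b * M2.
  by field; rewrite gt_eqF.
rewrite -natr1; lra.
Qed.

End RenewalSums.

Lemma cvg_average (R : realType) (u : nat -> R) (l : R) :
  (forall e, 0 < e -> exists M, forall n,
     (l - e) * n%:R - M <= u n <= (l + e) * n%:R + M) ->
  n%:R^-1 * u n @[n --> \oo] --> l.
Proof.
move=> h; apply/cvgrPdist_le => e e0.
have [M hM] := h (e / 2) (divr_gt0 e0 (ltr0n _ 2)).
have [k hk] : exists k : nat, `|M| / (e / 2) < k%:R.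
  exists (Num.bound (`|M| / (e / 2))).
  by apply: archi_boundP; rewrite divr_ge0// divr_ge0// ltW.
near=> n.
have kn : (k < n)%N by near: n; exact: nbhs_infty_gt.
have n0 : (0 : R) < n%:R by rewrite ltr0n; lia.
have hkn : `|M| <= e / 2 * n%:R.
  rewrite ltr_pdivrMr ?divr_gt0// in hk; apply/ltW/(lt_le_trans hk).
  by rewrite mulrC ler_pM2l ?divr_gt0// ler_nat ltnW.
rewrite -(ler_pM2l n0) -{1}[n%:R]gtr0_norm// -normrM mulrBr mulVKf ?gt_eqF//.
have := ler_norm M; have := hM n.
rewrite ler_norml => /andP[h1 h2] h3; apply/andP; split; lra.
Unshelve. all: by end_near. Qed.

(** * Law of large numbers for functions of the future of a regenerative process *)

Section RegenerativeLLN.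
Context {d d' : measure_display} {Omega : measurableType d}
  {T : measurableType d'} {R : realType}.
Variable (P : probability Omega R).
Variables (Z : nat -> Omega -> T) (S : nat -> Omega -> nat).
Hypothesis regZ : regenerative P Z S.
Hypothesis S0 : {ae P, forall w, (0 < S 0%N w)%N}.

Let E := seqspace (T * nat)%type.
Let Q := cycle_law regZ.

Let ub (F : E -> R) c mF F0 Fc := @ergodic_sums_ub _ E R Q
  _ (@measurable_cycle_shift _ T) (cycle_law_shift regZ)
  (cycle_law_ergodic regZ S0) F c mF F0 Fc.
Let lb (F : E -> R) c mF F0 Fc := @ergodic_sums_lb _ E R Q
  _ (@measurable_cycle_shift _ T) (cycle_law_shift regZ)
  (cycle_law_ergodic regZ S0) F c mF F0 Fc.

Let L (z : E) : R := (z 1%N).2%:R.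

Let mL : measurable_fun [set: E] L.
Proof.
apply: (measurableT_comp (f := fun n : nat => n%:R : R)) => //.
exact: (measurableT_comp measurable_snd (measurable_coordinate 1%N)).
Qed.

Let mEL : measurable_fun [set: E] (EFin \o L).
Proof. exact: (measurable_EFinP (T := E) _ _).2. Qed.

Let sumL w N : (forall j k, (S j w + k <= S (j + k) w)%N) ->
  (forall k, iter k cycle_shift (shifted Z S 0 w) = shifted Z S k w) ->
  \sum_(i < N) L (iter i cycle_shift (shifted Z S 0 w)) =
  (S N w)%:R - (S 0%N w)%:R.
Proof.
move=> incS itS; elim: N => [|N IH]; first by rewrite big_ord0 subrr.
have := incS N 1%N => h.
rewrite big_ord_recr/= IH itS /L /shifted/= natrB; last by lia.
by rewrite addn1; lra.
Qed.

Lemma mean_cycle_length_ge1 : (1%:E <= \int[Q]_z (L z)%:E)%E.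
Proof.
rewrite integral_cycle_law; [|exact: mEL|by move=> z; rewrite lee_fin ler0n].
rewrite -[leLHS]mule1 -[X in (_ * X)%E](@probability_setT _ _ _ P).
rewrite -integral_cst//; apply: ae_ge0_le_integral => //.
- by move=> w _; rewrite lee_fin ler0n.
- apply/measurable_EFinP; apply: (measurableT_comp mL).
  exact: measurable_shifted regZ 0.
- move: (regenerative_increasing regZ); apply: filterS => w incS _ /=.
  by rewrite lee_fin /L /shifted/= ler1n; have := incS 0%N 1%N; rewrite add0n; lia.
Qed.

Lemma mean_cycle_length_fin : (\int[Q]_z (L z)%:E < +oo)%E.
Proof.
rewrite integral_cycle_law; [|exact: mEL|by move=> z; rewrite lee_fin ler0n].
by case: regZ.
Qed.

Let tau : R := fine (\int[Q]_z (L z)%:E).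

Let tauE : (\int[Q]_z (L z)%:E = tau%:E)%E.
Proof.
rewrite /tau fineK// ge0_fin_numE ?mean_cycle_length_fin//.
by apply: integral_ge0 => z _; rewrite lee_fin ler0n.
Qed.

Let tau1 : 1 <= tau.
Proof. by rewrite -lee_fin -tauE mean_cycle_length_ge1. Qed.

Let S_ub c : tau < c -> {ae P, forall w, exists M, forall N,
  (S N w)%:R <= c * N%:R + M}.
Proof.
move=> tc; have /ae_cycle_law := @ub L c mL (fun=> ler0n _ _)
  ltac:(by rewrite tauE lte_fin).
move: (regenerative_increasing regZ) (shiftedE regZ).
apply: filterS3 => w incS itS [M hM].
by exists (M + (S 0%N w)%:R) => N; have := hM N; rewrite sumL//; lra.
Qed.

Let S_lb c : c < tau -> {ae P, forall w, exists M, forall N,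
  c * N%:R - M <= (S N w)%:R}.
Proof.
move=> tc; have /ae_cycle_law := @lb L c mL (fun=> ler0n _ _)
  ltac:(by rewrite tauE lte_fin).
move: (regenerative_increasing regZ) (shiftedE regZ).
apply: filterS3 => w incS itS [M hM].
exists M => N; have := hM N; rewrite sumL//.
have : (0 : R) <= (S 0%N w)%:R by []; lra.
Qed.

(** The bound for a fixed slope holds off a null set depending on the slope, so the countably many
    slopes [tau + dl k] and [tau - dl k] are treated first and [e] is quantified afterwards. *)
Lemma regeneration_times_ratio : {ae P, forall w,
  forall e : R, 0 < e -> exists M : R, forall N,
    (tau - e) * N%:R - M <= (S N w)%:R <= (tau + e) * N%:R + M}.
Proof.
pose dl (k : nat) : R := k.+1%:R^-1.
have dl0 k : 0 < dl k by rewrite invr_gt0.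
have h1 : {ae P, forall w, forall k, exists M, forall N,
    (S N w)%:R <= (tau + dl k) * N%:R + M}.
  by apply/ae_foralln => k; apply: S_ub; rewrite ltrDl.
have h2 : {ae P, forall w, forall k, exists M, forall N,
    (tau - dl k) * N%:R - M <= (S N w)%:R}.
  by apply/ae_foralln => k; apply: S_lb; rewrite gtrBl.
move: h1 h2; apply: filterS2 => w h1 h2 e e0.
have [k hk] : exists k, dl k <= e.
  exists (Num.bound e^-1); rewrite /dl -[leRHS]invrK lef_pV2 ?posrE ?invr_gt0//.
  apply: ltW; apply: (lt_le_trans (archi_boundP _)); first by rewrite invr_ge0 ltW.
  by rewrite ler_nat.
have [M1 hM1] := h1 k; have [M2 hM2] := h2 k.
exists (`|M1| + `|M2|) => N; have := hM1 N; have := hM2 N.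
have := ler_norm M1; have := ler_norm M2.
have := normr_ge0 M1; have := normr_ge0 M2.
have : dl k * N%:R <= e * N%:R by rewrite ler_wpM2r.
move=> *; apply/andP; split; lra.
Qed.

(** The finite alignment is known to agree with the infinite one only up to some [S j] with
    [S j + m <= n]. A remainder of order [e * n] is harmless for averages, and it follows from the
    linear growth of [S] alone. *)
Lemma regeneration_gap (m : nat) : {ae P, forall w, forall e : R, 0 < e ->
  exists M : R, forall n, exists s : nat,
    [/\ (s <= n)%N, s = 0%N \/ exists j, s = S j w /\ (S j w + m <= n)%N &
        (n - s)%:R <= e * n%:R + M]}.
Proof.
move: (regenerative_increasing regZ) regeneration_times_ratio.
apply: filterS2 => w incS ratio e e0.
(* The error enters twice, in the upper bound on [S N.+1] and in the lower bound on [S N]. *)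
have [M hM] := ratio (e / 2) (divr_gt0 e0 (ltr0n _ 2)).
have t1 := tau1.
exists ((S 0%N w)%:R + m%:R + tau + e + 2 * `|M|) => n.
have := ler_norm M; have := normr_ge0 M => M0 M1.
have en0 : 0 <= e * n%:R by rewrite mulr_ge0// ltW.
have m0 : (0 : R) <= m%:R by [].
have s0 : (0 : R) <= (S 0%N w)%:R by [].
have [nS|Sn] := ltnP n (S 0%N w + m)%N.
  exists 0%N; split; [by []|by left|].
  have : (n%:R : R) <= (S 0%N w)%:R + m%:R by rewrite -natrD ler_nat ltnW.
  by rewrite subn0; lra.
have exN : exists N, (S N w + m <= n)%N by exists 0%N.
have ubN N : (S N w + m <= n)%N -> (N <= n)%N.
  by have := incS 0%N N; rewrite add0n; lia.
case: (ex_maxnP exN ubN) => N SN maxN.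
have SN1 : (n < S N.+1 w + m)%N.
  by rewrite ltnNge; apply/negP => /maxN; rewrite ltnn.
exists (S N w); split; [by lia|by right; exists N|].
rewrite natrB; last by lia.
have /andP[_ h1] := hM N.+1; have /andP[h2 _] := hM N.
have h3 : (n%:R : R) <= (S N.+1 w)%:R + m%:R by rewrite -natrD ler_nat ltnW.
have h4 : e * N%:R <= e * n%:R by rewrite ler_pM2l// ler_nat; exact: ubN.
move: h1; rewrite -[N.+1%:R]natr1; lra.
Qed.

Section Functional.
Variable (Phi : seqspace T -> R).
Hypothesis mPhi : measurable_fun [set: seqspace T] Phi.
Hypothesis Phi0 : forall z, 0 <= Phi z.

(** [Phi] may look past the end of the cycle, so successive cycle sums are dependent in general;
    their averages are controlled by the ergodicity of [cycle_shift]. *)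
Definition cycle_sum (z : E) : R :=
  \sum_(t < (z 1%N).2) Phi (fun s => (z (t + s)%N).1).

Lemma measurable_cycle_sum : measurable_fun [set: E] cycle_sum.
Proof.
apply: (measurable_select (N := fun z : E => (z 1%N).2)
  (g := fun n (z : E) => \sum_(t < n) Phi (fun s => (z (t + s)%N).1))).
  exact: (measurableT_comp measurable_snd (measurable_coordinate 1%N)).
move=> n; apply: measurable_sum => t; apply: (measurableT_comp mPhi).
apply: measurable_to_seqspace => s.
exact: (measurableT_comp measurable_fst (measurable_coordinate _)).
Qed.

Lemma cycle_sum_ge0 z : 0 <= cycle_sum z.
Proof. exact: sumr_ge0. Qed.

Lemma sum_cycle_sum w N : (forall j k, (S j w + k <= S (j + k) w)%N) ->
  (forall k, iter k cycle_shift (shifted Z S 0 w) = shifted Z S k w) ->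
  \sum_(i < N) cycle_sum (iter i cycle_shift (shifted Z S 0 w)) =
  \sum_(S 0%N w <= t < S N w) Phi (fun s => Z (t + s)%N w).
Proof.
move=> incS itS; elim: N => [|N IH]; first by rewrite big_ord0 big_geq.
have := incS N 1%N; have := incS 0%N N; rewrite add0n !addn1 => h0 h.
rewrite big_ord_recr/= IH itS [in RHS](@big_cat_nat _ _ _ (S N w))//=; last 2 first.
- by lia.
- by lia.
congr (_ + _); rewrite /cycle_sum /shifted/= addn1.
rewrite -[in RHS](add0n (S N w)) big_addn big_mkord.
by apply: eq_bigr => t _; congr Phi; apply/funext => s; congr (Z _ w); lia.
Qed.

Let A n w := \sum_(i < n) Phi (fun s => Z (i.+1 + s)%N w).

Let regular_paths : {ae P, forall w,
  [/\ forall j k, (S j w + k <= S (j + k) w)%N,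
      forall k, iter k cycle_shift (shifted Z S 0 w) = shifted Z S k w &
      (0 < S 0%N w)%N]}.
Proof.
by move: (regenerative_increasing regZ) (shiftedE regZ) S0; apply: filterS3.
Qed.

Let A_lb b c : tau < b -> 0 <= c -> (c%:E < \int[Q]_z (cycle_sum z)%:E)%E ->
  {ae P, forall w, exists M, forall n, c / b * n%:R - M <= A n w}.
Proof.
move=> tb c0 /(@lb cycle_sum c measurable_cycle_sum cycle_sum_ge0)/ae_cycle_law h1.
have h2 := regular_paths.
move: (S_ub tb) h1 h2; apply: filterS3 => w [M2 hS] [M1 hU] [incS itS S0w].
have b0 : 0 < b by apply: lt_trans tb; apply: lt_le_trans tau1.
apply: (@renewal_sums_lb R (S ^~ w) (fun t => Phi (fun s => Z (t + s)%N w))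
  _ S0w incS b c M1 M2 c0 b0) => [t||//]; first exact: Phi0.
by move=> N; have := hU N; rewrite sum_cycle_sum.
Qed.

Let A_ub b c : b < tau -> 0 < b -> (\int[Q]_z (cycle_sum z)%:E < c%:E)%E ->
  {ae P, forall w, exists M, forall n, A n w <= c / b * n%:R + M}.
Proof.
move=> tb b0 ec.
have c0 : 0 <= c.
  by rewrite -lee_fin; apply: le_trans (ltW ec); apply: integral_ge0 => z _;
    rewrite lee_fin cycle_sum_ge0.
have h1 := ae_cycle_law (ub measurable_cycle_sum cycle_sum_ge0 ec).
have h2 := regular_paths.
move: (S_lb tb) h1 h2; apply: filterS3 => w [M2 hS] [M1 hU] [incS itS S0w].
apply: (@renewal_sums_ub R (S ^~ w) (fun t => Phi (fun s => Z (t + s)%N w))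
  _ S0w incS b c M1 M2 c0 b0) => [t||//]; first exact: Phi0.
by move=> N; have := hU N; rewrite sum_cycle_sum.
Qed.

Variable Kc : R.
Hypothesis EPhi : forall t : nat, (0 < t)%N ->
  (\int[P]_w (Phi (fun s => Z (t + s)%N w))%:E <= Kc%:E)%E.

Let mA n : measurable_fun [set: Omega] (A n).
Proof.
apply: measurable_sum => t; apply: (measurableT_comp mPhi).
by apply: measurable_to_seqspace => s; case: regZ => [[]].
Qed.

Let EA n : (\int[P]_w (A n w)%:E <= (Kc * n%:R)%:E)%E.
Proof.
under eq_integral do rewrite -sumEFin.
rewrite ge0_integral_sum//; last 2 first.
- move=> i; apply/measurable_EFinP; apply: (measurableT_comp mPhi).
  by apply: measurable_to_seqspace => s; case: regZ => [[]].
- by move=> i w _; rewrite lee_fin.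
rewrite (_ : (Kc * n%:R)%:E = \sum_(i < n) Kc%:E)%E; last first.
  by rewrite sumEFin sumr_const card_ord mulr_natr.
by apply: lee_sum => i _; apply: EPhi.
Qed.

(* Fatou's argument: a linear lower bound for the partial sums that holds almost
   surely holds on average as well. *)
Let slope_le_mean c : 0 <= c ->
  {ae P, forall w, exists M, forall n, c * n%:R - M <= A n w} -> c <= Kc.
Proof.
move=> c0 aeA.
pose B (M : nat) := [set w | forall n, c * n%:R - M%:R <= A n w].
have mB M : measurable (B M).
  have -> : B M = \bigcap_n [set w | c * n%:R - M%:R <= A n w].
    by apply/seteqP; split => w h n; [move=> _; exact: h|exact: h].
  apply: bigcapT_measurable => n; rewrite -[X in measurable X]setTI.
  exact: measurable_fun_le.
have BT : P (\bigcup_M B M) = 1%E.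
  rewrite -(@probability_setT _ _ _ P); apply: ae_measure_eq => //.
    exact: bigcupT_measurable.
  move: aeA; apply: filterS => w [M hM]; split => // _.
  have [k hk] : exists k : nat, M <= k%:R.
    exists (Num.bound `|M|); apply: le_trans (ler_norm _) _.
    exact/ltW/archi_boundP.
  by exists k => // n; have := hM n; lra.
have cvgB : (P (B M) @[M --> \oo] --> 1)%E.
  rewrite -BT; apply: nondecreasing_cvg_mu => //; first exact: bigcupT_measurable.
  move=> i j ij; apply/subsetPset => w h n; have := h n.
  have : (i%:R : R) <= j%:R by rewrite ler_nat.
  lra.
have bnd M : (c%:E * P (B M) <= Kc%:E)%E.
  have fB : P (B M) \is a fin_num by exact: fin_num_measure.
  have p0 : 0 <= fine (P (B M)) by exact: fine_ge0.
  (* On [B M] one constant serves all paths; integrating there gives an inequality linear in [n],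
     whose slopes are then compared for large [n]. *)
  have hn n : (c * n%:R - M%:R) * fine (P (B M)) <= Kc * n%:R.
    have [neg|pos] := leP (c * n%:R - M%:R) 0.
      apply: (@le_trans _ _ 0); first exact: mulr_le0_ge0.
      rewrite -lee_fin; apply: le_trans (EA n); apply: integral_ge0 => w _.
      by rewrite lee_fin sumr_ge0.
    rewrite -lee_fin; apply: le_trans (EA n).
    rewrite EFinM fineK// -integral_cst//.
    apply: (@le_trans _ _ (\int[P]_(w in B M) (A n w)%:E)%E).
      apply: ge0_le_integral => //.
      - by move=> w _; rewrite lee_fin ltW.
      - exact/measurable_EFinP/measurable_funTS.
      - by move=> w h; rewrite lee_fin; exact: h.
    apply: ge0_subset_integral => //; first exact/measurable_EFinP.
    by move=> w _; rewrite lee_fin sumr_ge0.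
  rewrite -(fineK fB) -EFinM lee_fin leNgt; apply/negP => h.
  pose e := c * fine (P (B M)) - Kc.
  have e0 : 0 < e by rewrite subr_gt0.
  have [n hM] : exists n : nat, M%:R * fine (P (B M)) / e < n%:R.
    exists (Num.bound (M%:R * fine (P (B M)) / e)); apply: archi_boundP.
    by rewrite divr_ge0 ?mulr_ge0// ltW.
  rewrite ltr_pdivrMr// in hM; have := hn n; rewrite /e in hM; nra.
have lim1 : (c%:E * P (B M) @[M --> \oo] --> c%:E * 1)%E by exact: cvgeZl.
rewrite -lee_fin -[leLHS]mule1.
apply: (lee_cvg_to lim1 (cvg_cst _)).
by near=> M; exact: bnd.
Unshelve. all: by end_near. Qed.

(** The hypothesis bounds means at fixed times, not at times inside a random cycle. A larger mean
    under [Q] would make the time averages grow almost surely with a slope above [Kc], against the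
    bound at fixed times. *)
Lemma cycle_sum_fin : (\int[Q]_z (cycle_sum z)%:E <= (Kc * tau)%:E)%E.
Proof.
rewrite leNgt; apply/negP => h.
have Kc0 : 0 <= Kc.
  rewrite -lee_fin; apply: le_trans (EPhi (ltn0Sn 0)); apply: integral_ge0 => w _.
  by rewrite lee_fin.
have [c hc ce] : exists2 c, Kc * tau < c & (c%:E < \int[Q]_z (cycle_sum z)%:E)%E.
  move: h; case: (\int[Q]_z (cycle_sum z)%:E)%E => [e||].
  - by rewrite lte_fin => h; exists ((Kc * tau + e) / 2); rewrite ?lte_fin; lra.
  - by move=> _; exists (Kc * tau + 1); [lra|rewrite ltry].
  - by [].
have tau0 : 0 < tau by have := tau1; lra.
have c0 : 0 <= c by apply/ltW/(le_lt_trans _ hc); rewrite mulr_ge0// ltW.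
pose g := c - Kc * tau; have g0 : 0 < g by rewrite subr_gt0.
(* The margin over [tau] is so small that [Kc * b < c], hence [c / b] exceeds [Kc]. *)
pose b := tau + g / (Kc + 1).
have b0 : 0 < g / (Kc + 1) by rewrite divr_gt0//; lra.
have tb : tau < b by rewrite ltrDl.
have := slope_le_mean _ (A_lb tb c0 ce).
have bp : 0 < b by exact: lt_trans tb.
rewrite ler_pdivrMr// divr_ge0 ?(ltW bp)// => /(_ isT).
rewrite /b mulrDr.
have : Kc * (g / (Kc + 1)) < g.
  rewrite mulrCA gtr_pMr// ltr_pdivrMr; lra.
rewrite /g; lra.
Qed.

(** The limit is the mean cycle sum over the mean cycle length. The bound by [Kc] carries smallness
    of the means at fixed times over to the limiting frequencies. *)
Theorem regenerative_lln : exists c : R, [/\ 0 <= c, c <= Kc &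
  {ae P, forall w, n%:R^-1 * (\sum_(i < n) Phi (fun s => Z (i.+1 + s)%N w))
     @[n --> \oo] --> c}].
Proof.
have tau0 : 0 < tau by have := tau1; lra.
have Q0 : (0 <= \int[Q]_z (cycle_sum z)%:E)%E.
  by apply: integral_ge0 => z _; rewrite lee_fin cycle_sum_ge0.
have Qfin : (\int[Q]_z (cycle_sum z)%:E)%E \is a fin_num.
  by rewrite ge0_fin_numE// (le_lt_trans cycle_sum_fin)// ltry.
have [e QE] : exists e : R, (\int[Q]_z (cycle_sum z)%:E = e%:E)%E.
  by exists (fine (\int[Q]_z (cycle_sum z)%:E)%E); rewrite fineK.
have e0 : 0 <= e by rewrite -lee_fin -QE.
exists (e / tau); split; first by rewrite divr_ge0// ltW.
  by rewrite ler_pdivrMr// -lee_fin -QE cycle_sum_fin.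
(* Starting at [1/2] keeps [tau - dl k] positive, as [tau >= 1]. *)
pose dl (k : nat) : R := k.+2%:R^-1.
have dl0 k : 0 < dl k by rewrite invr_gt0.
have dl1 k : dl k <= 2^-1 by rewrite lef_pV2 ?posrE// ler_nat.
have h1 : {ae P, forall w, forall k, exists M, forall n,
    (e - dl k) / (tau + dl k) * n%:R - M <= A n w}.
  apply/ae_foralln => k.
  have [h|h] := leP 0 (e - dl k).
    by apply: A_lb => //; [rewrite ltrDl|rewrite QE lte_fin gtrBl].
  apply: aeW => w; exists 0 => n; rewrite subr0.
  apply: (@le_trans _ _ 0); last by rewrite /A sumr_ge0.
  rewrite mulr_le0_ge0// mulr_le0_ge0// ?(ltW h)// invr_ge0 addr_ge0//; exact: ltW.
have h2 : {ae P, forall w, forall k, exists M, forall n,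
    A n w <= (e + dl k) / (tau - dl k) * n%:R + M}.
  apply/ae_foralln => k; apply: A_ub.
  - by rewrite gtrBl.
  - by have := dl1 k; have := tau1; lra.
  - by rewrite QE lte_fin ltrDl.
move: h1 h2; apply: filterS2 => w h1 h2.
apply: cvg_average => eps eps0.
have [k hk] : exists k, 2 * (1 + e) * dl k <= eps.
  exists (Num.bound (eps^-1 * (2 * (1 + e)))); rewrite /dl.
  rewrite ler_pdivrMr// -ler_pdivrMl//.
  apply: ltW; apply: (lt_le_trans (archi_boundP _)).
    by rewrite mulr_ge0// ?invr_ge0 ?(ltW eps0)// mulr_ge0// addr_ge0.
  by rewrite ler_nat; exact: (leq_addl 2).
have [M1 hM1] := h1 k; have [M2 hM2] := h2 k.
exists (`|M1| + `|M2|) => n; have := hM1 n; have := hM2 n.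
have := ler_norm M1; have := ler_norm M2.
have := normr_ge0 M1; have := normr_ge0 M2.
have d0 := dl0 k; have d1 := dl1 k; have t1 := tau1.
have b1 : (e + dl k) / (tau - dl k) <= e / tau + eps.
  apply: (@le_trans _ _ (e / tau + 2 * (1 + e) * dl k)); last by rewrite lerD2l.
  rewrite ler_pdivrMr; last by lra.
  have -> : (e / tau + 2 * (1 + e) * dl k) * (tau - dl k) = e + dl k
      + (2 * (1 + e) * dl k * (tau - dl k) - dl k - e / tau * dl k).
    by field; rewrite gt_eqF.
  rewrite lerDl.
  have h3 : e / tau * dl k <= e * dl k.
    by rewrite ler_wpM2r ?(ltW d0)// ler_pdivrMr// ler_peMr.
  have h4 : (1 + e) * dl k <= 2 * (1 + e) * dl k * (tau - dl k).
    rewrite -[leLHS]mulr1 mulrC -!mulrA (mulrC (1 + e)).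
    have : 0 <= dl k * (1 + e) by rewrite mulr_ge0 ?(ltW d0)//; lra.
    nra.
  lra.
have b2 : e / tau - eps <= (e - dl k) / (tau + dl k).
  apply: (@le_trans _ _ (e / tau - 2 * (1 + e) * dl k)).
    by rewrite lerD2l lerN2.
  rewrite ler_pdivlMr; last by lra.
  have -> : (e / tau - 2 * (1 + e) * dl k) * (tau + dl k) = e - dl k
      - (2 * (1 + e) * dl k * (tau + dl k) - dl k - e / tau * dl k).
    by field; rewrite gt_eqF.
  rewrite gerBl.
  have h3 : e / tau * dl k <= e * dl k.
    by rewrite ler_wpM2r ?(ltW d0)// ler_pdivrMr// ler_peMr.
  have h4 : (1 + e) * dl k <= 2 * (1 + e) * dl k * (tau + dl k).
    have : 0 <= dl k * (1 + e) by rewrite mulr_ge0 ?(ltW d0)//; lra.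
    nra.
  lra.
have h5 : (e + dl k) / (tau - dl k) * n%:R <= (e / tau + eps) * n%:R.
  by rewrite ler_wpM2r.
have h6 : (e / tau - eps) * n%:R <= (e - dl k) / (tau + dl k) * n%:R.
  by rewrite ler_wpM2r.
rewrite -/(A n w) => *; apply/andP; split; lra.
Qed.

End Functional.
End RegenerativeLLN.

(** * Products of nonnegative matrices and optimal paths *)

Section NonnegativeMatrices.
Context {R : realType} {K : nat}.
Notation mat := 'M[R]_K.+1.
Implicit Types (A B Q : mat) (i j k : 'I_K.+1).

Definition nonneg_mx A := forall i j, 0 <= A i j.

Lemma nonneg_mulmx A B : nonneg_mx A -> nonneg_mx B -> nonneg_mx (A * B).
Proof.
by move=> A0 B0 i j; rewrite -mulmxE mxE sumr_ge0// => k _; rewrite mulr_ge0.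
Qed.

Lemma nonneg_mx1 : nonneg_mx 1.
Proof. by move=> i j; rewrite mxE ler0n. Qed.

Lemma mulmx_ge A B i k j : nonneg_mx A -> nonneg_mx B ->
  A i k * B k j <= (A * B) i j.
Proof.
move=> A0 B0; rewrite -mulmxE mxE (bigD1 k)//= lerDl sumr_ge0// => l _.
by rewrite mulr_ge0.
Qed.

(* B is comparable to a rank-one matrix: this is the property that makes a product
   of nonnegative matrices forget its initial vector. *)
Definition anchored (delta : R) B := exists a b : 'I_K.+1 -> R,
  [/\ forall i, 0 <= a i, forall j, 0 <= b j &
      forall i j, delta * (a i * b j) <= B i j <= a i * b j].

Lemma anchored_tr delta B : anchored delta B -> anchored delta B^T.
Proof.
move=> [a [b [a0 b0 ab]]]; exists b, a; split=> // i j.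
by rewrite mxE mulrC [b i * _]mulrC [_ * delta]mulrC; exact: ab.
Qed.

Lemma anchored_mull delta B Q : nonneg_mx Q -> anchored delta B ->
  anchored delta (Q * B).
Proof.
move=> Q0 [a [b [a0 b0 ab]]].
exists (fun i => \sum_k Q i k * a k), b; split=> // [i|i j].
  by rewrite sumr_ge0// => k _; rewrite mulr_ge0.
rewrite -mulmxE mxE mulr_suml mulr_sumr; apply/andP; split; apply: ler_sum => k _.
  rewrite -mulrA mulrCA ler_wpM2l//; by have /andP[] := ab k j.
by rewrite -mulrA ler_wpM2l//; have /andP[] := ab k j.
Qed.

Lemma anchored_mulr delta B Q : nonneg_mx Q -> anchored delta B ->
  anchored delta (B * Q).
Proof.
move=> Q0 /anchored_tr aB; rewrite -[_ * _]trmxK; apply: anchored_tr.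
rewrite -mulmxE trmx_mul; apply: anchored_mull => // i j.
by rewrite mxE.
Qed.

Section Products.
Variable A : nat -> mat.
Hypothesis A0 : forall t, nonneg_mx (A t).

Definition mprod (s t : nat) : mat := \prod_(s <= u < t) A u.

Lemma mprod_ge0 s t : nonneg_mx (mprod s t).
Proof.
rewrite /mprod; elim/big_ind : _ => //; first exact: nonneg_mx1.
by move=> *; exact: nonneg_mulmx.
Qed.

Lemma mprod_cat u s t : (s <= u)%N -> (u <= t)%N ->
  mprod s t = mprod s u * mprod u t.
Proof. by move=> su ut; rewrite /mprod (@big_cat_nat _ _ _ u). Qed.

Lemma mprodS s t : (s <= t)%N -> mprod s t.+1 = mprod s t * A t.
Proof. by move=> st; rewrite /mprod big_nat_recr. Qed.

Lemma mprod0 s : mprod s s = 1.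
Proof. by rewrite /mprod big_geq. Qed.

Definition pathw (y : nat -> 'I_K.+1) (s t : nat) : R :=
  \prod_(s <= u < t) A u (y u) (y u.+1).

Lemma pathw_ge0 y s t : 0 <= pathw y s t.
Proof. by apply: prodr_ge0 => u _; exact: A0. Qed.

Lemma pathw_cat u y s t : (s <= u)%N -> (u <= t)%N ->
  pathw y s t = pathw y s u * pathw y u t.
Proof. by move=> su ut; rewrite /pathw (@big_cat_nat _ _ _ u). Qed.

Lemma eq_pathw y z s t : (forall u, (s <= u <= t)%N -> y u = z u) ->
  pathw y s t = pathw z s t.
Proof.
move=> yz; apply: eq_big_nat => u /andP[su ut].
by rewrite !yz//; lia.
Qed.

Lemma pathw_le_mprod y s t : (s <= t)%N ->
  pathw y s t <= mprod s t (y s) (y t).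
Proof.
elim: t => [|t IH].
  by rewrite leqn0 => /eqP ->; rewrite /pathw big_geq// mprod0 mxE eqxx.
rewrite leq_eqVlt => /orP[/eqP ->|].
  by rewrite /pathw big_geq// mprod0 mxE eqxx.
rewrite ltnS => st; rewrite mprodS// /pathw big_nat_recr//=.
apply: (@le_trans _ _ (mprod s t (y s) (y t) * A t (y t) (y t.+1))).
  by rewrite ler_wpM2r//; [exact: A0|exact: IH].
by apply: mulmx_ge => //; exact: mprod_ge0.
Qed.

(** An entry is a sum over at most [(K + 1) ^ (t - s)] paths; a path carrying its share is found by
    choosing the best intermediate state at each step. *)
Lemma mprod_le_pathw s t i j : (s <= t)%N -> 0 < mprod s t i j ->
  exists y, [/\ y s = i, y t = j &
    mprod s t i j <= K.+1%:R ^+ (t - s) * pathw y s t].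
Proof.
elim: t j => [|t IH] j.
  rewrite leqn0 => /eqP ->; rewrite mprod0 mxE.
  case: eqP => [->|]; last by rewrite ltxx.
  by exists (fun=> j); split; rewrite ?subnn// /pathw big_geq// mulr1.
rewrite leq_eqVlt => /orP[/eqP ->|].
  rewrite mprod0 mxE.
  case: eqP => [->|]; last by rewrite ltxx.
  by exists (fun=> j); split; rewrite ?subnn// /pathw big_geq// mulr1.
rewrite ltnS => st; rewrite mprodS// -mulmxE mxE => M0.
pose k := [arg max_(k > ord0) (mprod s t i k * A t k j)]%O.
have kmax l : mprod s t i l * A t l j <= mprod s t i k * A t k j.
  by rewrite /k; case: arg_maxP => // m _; exact.
have sumle : \sum_l mprod s t i l * A t l j <=
    K.+1%:R * (mprod s t i k * A t k j).
  apply: (@le_trans _ _ (\sum_(l < K.+1) mprod s t i k * A t k j)).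
    by apply: ler_sum => l _.
  by rewrite sumr_const card_ord mulr_natl.
have ka : 0 < mprod s t i k * A t k j.
  by rewrite -(pmulr_rgt0 _ (ltr0Sn R K)); exact: lt_le_trans sumle.
have Ak : 0 < A t k j.
  rewrite lt_neqAle A0 andbT; apply: contraTneq ka => <-.
  by rewrite mulr0 ltxx.
have Mk : 0 < mprod s t i k by rewrite -(pmulr_lgt0 _ Ak).
have [y [ys yt hy]] := IH k st Mk.
exists (fun u => if (u <= t)%N then y u else j); split.
- by rewrite st.
- by rewrite ltnn.
apply: le_trans sumle _.
rewrite subSn// exprS -mulrA ler_pM2l// /pathw big_nat_recr//=.
rewrite leqnn ltnn yt mulrA ler_wpM2r ?(ltW Ak)//.
apply: le_trans hy _; rewrite ler_wpM2l ?exprn_ge0// /pathw.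
rewrite le_eqVlt; apply/orP; left; apply/eqP; apply: eq_big_nat => u /andP[su ut].
by rewrite (ltnW ut) ut.
Qed.

Definition glue (m : nat) (y z : nat -> 'I_K.+1) (u : nat) :=
  if (u <= m)%N then y u else z u.

Lemma glueL m y z u : (u <= m)%N -> glue m y z u = y u.
Proof. by rewrite /glue => ->. Qed.

Lemma glueR m y z u : y m = z m -> (m <= u)%N -> glue m y z u = z u.
Proof.
rewrite /glue => yz; rewrite leq_eqVlt => /orP[/eqP <-|mu].
  by rewrite leqnn.
by rewrite leqNgt mu.
Qed.

(** * Rerouting an optimal path between two anchors *)

Section LowerBound.
Variables (N u u' w w' : nat) (v : nat -> 'I_K.+1) (delta : R) (k0 : nat).
Hypothesis uu' : (u <= u')%N.
Hypothesis u'w : (u' <= w)%N.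
Hypothesis ww' : (w <= w')%N.
Hypothesis w'N : (w' <= N)%N.
Hypothesis delta0 : 0 < delta.
Hypothesis anchL : anchored delta (mprod u u').
Hypothesis anchR : anchored delta (mprod w w').
Hypothesis uk0 : (u' - u <= k0)%N.
Hypothesis wk0 : (w' - w <= k0)%N.
Hypothesis vopt : forall y, y 0%N = v 0%N -> y N = v N ->
  pathw y 0 N <= pathw v 0 N.
Hypothesis v0 : 0 < pathw v 0 N.

Let kappa : R := K.+1%:R ^+ k0.

Let kappa1 : 0 < kappa. Proof. by rewrite exprn_gt0. Qed.

Let connect s t i j (a b : 'I_K.+1 -> R) : (s <= t)%N -> (t - s <= k0)%N ->
  (forall i j, delta * (a i * b j) <= mprod s t i j <= a i * b j) ->
  0 < a i -> 0 < b j ->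
  exists y, [/\ y s = i, y t = j & delta * (a i * b j) <= kappa * pathw y s t].
Proof.
move=> st tsk ab ai bj; have /andP[h _] := ab i j.
have M0 : 0 < mprod s t i j by apply: lt_le_trans h; rewrite !mulr_gt0.
have [y [ys yt hy]] := mprod_le_pathw st M0.
exists y; split => //; apply: le_trans h _; apply: le_trans hy _.
by rewrite ler_wpM2r ?pathw_ge0// ler_weXn2l// ler1n.
Qed.

(* Rerouting the optimal path through z between the two anchors cannot increase its
   weight, so every path between the anchors is dominated by the optimal one. *)
Lemma optimal_path_dominates a b a' b' :
  (forall i, 0 <= a i) -> (forall j, 0 <= b j) ->
  (forall i j, delta * (a i * b j) <= mprod u u' i j <= a i * b j) ->
  (forall i, 0 <= a' i) -> (forall j, 0 <= b' j) ->
  (forall i j, delta * (a' i * b' j) <= mprod w w' i j <= a' i * b' j) ->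
  forall k l, b k * mprod u' w k l * a' l <=
    K.+1%:R ^+ (w - u') * (kappa / delta) ^+ 2 *
    (b (v u') * pathw v u' w * a' (v w)).
Proof.
move=> a0 b0 ab a'0 b'0 ab' k l.
have rhs0 : 0 <= K.+1%:R ^+ (w - u') * (kappa / delta) ^+ 2 *
    (b (v u') * pathw v u' w * a' (v w)).
  by rewrite !mulr_ge0 ?exprn_ge0 ?mulr_ge0 ?invr_ge0 ?pathw_ge0 ?(ltW kappa1) ?(ltW delta0).
have [|bk] := ltP 0 (b k); last first.
  have -> : b k = 0 by apply/eqP; rewrite eq_le bk b0.
  by rewrite !mul0r.
have [|bk] := ltP 0 (a' l); last first.
  have -> : a' l = 0 by apply/eqP; rewrite eq_le bk a'0.
  by rewrite !mulr0.
have [|bk] := ltP 0 (mprod u' w k l); last first.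
  have -> : mprod u' w k l = 0 by apply/eqP; rewrite eq_le bk mprod_ge0.
  by rewrite !mulr0 !mul0r.
move=> Mkl a'l bk.
have split5 y : pathw y 0 N = pathw y 0 u * pathw y u u' * pathw y u' w *
    pathw y w w' * pathw y w' N.
  rewrite (@pathw_cat w' y 0 N)//.
  rewrite (@pathw_cat w y 0 w')//.
  rewrite (@pathw_cat u' y 0 w)//.
  by rewrite (@pathw_cat u y 0 u').
have := v0; rewrite split5 => v0'.
have pos5 (x1 x2 x3 x4 x5 : R) : 0 <= x1 -> 0 <= x2 -> 0 <= x3 -> 0 <= x4 ->
    0 <= x5 -> 0 < x1 * x2 * x3 * x4 * x5 ->
    [/\ 0 < x1, 0 < x2, 0 < x4 & 0 < x5].
  move=> h1 h2 h3 h4 h5 h; split; rewrite lt_neqAle ?h1 ?h2 ?h4 ?h5 andbT;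
  by apply: contraTneq h => <-; rewrite ?(mul0r, mulr0) ltxx.
have [p1 p2 p4 p5] := pos5 _ _ _ _ _ (pathw_ge0 v 0 u) (pathw_ge0 v u u')
  (pathw_ge0 v u' w) (pathw_ge0 v w w') (pathw_ge0 v w' N) v0'.
have c2 : pathw v u u' <= a (v u) * b (v u').
  apply: le_trans (pathw_le_mprod v uu') _; by have /andP[] := ab (v u) (v u').
have c4 : pathw v w w' <= a' (v w) * b' (v w').
  apply: le_trans (pathw_le_mprod v ww') _; by have /andP[] := ab' (v w) (v w').
have av : 0 < a (v u).
  rewrite lt_neqAle a0 andbT; apply: contraTneq (lt_le_trans p2 c2) => <-.
  by rewrite mul0r ltxx.
have bv : 0 < b' (v w').
  rewrite lt_neqAle b'0 andbT; apply: contraTneq (lt_le_trans p4 c4) => <-.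
  by rewrite mulr0 ltxx.
have [y1 [y1u y1u' hy1]] := connect uu' uk0 ab av bk.
have [y2 [y2w y2w' hy2]] := connect ww' wk0 ab' a'l bv.
have [z [zu' zw hz]] := mprod_le_pathw u'w Mkl.
(* [g] follows [v] up to [u], [y1] through the left anchor to the state [k], [z] from [k] to [l],
   [y2] through the right anchor, and [v] again from [w'] on. *)
pose g3 := glue w' y2 v.
pose g2 := glue w z g3.
pose g1 := glue u' y1 g2.
pose g := glue u v g1.
have g3w : z w = g3 w by rewrite /g3 glueL// zw y2w.
have g2u' : y1 u' = g2 u' by rewrite /g2 glueL// y1u' zu'.
have g1u : v u = g1 u by rewrite /g1 glueL.
have uw : (u <= w)%N := leq_trans uu' u'w.
have uw' : (u <= w')%N := leq_trans uw ww'.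
have u'w' : (u' <= w')%N := leq_trans u'w ww'.
have gE3 t : (w' <= t)%N -> g3 t = v t := glueR y2w'.
have gE2 t : (w <= t)%N -> g2 t = g3 t := glueR g3w.
have gE1 t : (u' <= t)%N -> g1 t = g2 t := glueR g2u'.
have gE t : (u <= t)%N -> g t = g1 t := glueR g1u.
have gw' t : (w' <= t)%N -> g t = v t.
  move=> w't; rewrite gE ?(leq_trans uw' w't)// gE1 ?(leq_trans u'w' w't)//.
  by rewrite gE2 ?(leq_trans ww' w't)// gE3.
have gw t : (w <= t)%N -> (t <= w')%N -> g t = y2 t.
  move=> wt tw'; rewrite gE ?(leq_trans uw wt)// gE1 ?(leq_trans u'w wt)//.
  by rewrite gE2// /g3 glueL.
have gu' t : (u' <= t)%N -> (t <= w)%N -> g t = z t.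
  by move=> ut tw; rewrite gE ?(leq_trans uu' ut)// gE1// /g2 glueL.
have gu t : (u <= t)%N -> (t <= u')%N -> g t = y1 t.
  by move=> ut tw; rewrite gE// /g1 glueL.
have := vopt (y := g) (glueL _ _ (leq0n _)) (gw' N w'N).
rewrite !split5.
have -> : pathw g 0 u = pathw v 0 u.
  by apply: eq_pathw => t /andP[_ tu]; exact: glueL.
have -> : pathw g u u' = pathw y1 u u'.
  by apply: eq_pathw => t /andP[]; exact: gu.
have -> : pathw g u' w = pathw z u' w.
  by apply: eq_pathw => t /andP[]; exact: gu'.
have -> : pathw g w w' = pathw y2 w w'.
  by apply: eq_pathw => t /andP[]; exact: gw.
have -> : pathw g w' N = pathw v w' N.
  by apply: eq_pathw => t /andP[wt _]; exact: gw'.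
rewrite ler_pM2r// -!mulrA ler_pM2l// => hopt.
set X1 := pathw y1 u u' in hopt hy1 *.
set X3 := pathw y2 w w' in hopt hy2 *.
set X2 := pathw z u' w in hopt hz *.
set V := pathw v u' w in hopt *.
have V0 : 0 <= V by exact: pathw_ge0.
have X20 : 0 <= X2 by exact: pathw_ge0.
have h1 : X1 * (X2 * X3) <= a (v u) * b (v u') * (V * (a' (v w) * b' (v w'))).
  apply: le_trans hopt _; rewrite ler_pM ?pathw_ge0 ?mulr_ge0 ?pathw_ge0//.
  by rewrite ler_pM ?pathw_ge0.
have h2 : (delta * (a (v u) * b k)) * (X2 * (delta * (a' l * b' (v w')))) <=
    (kappa * X1) * (X2 * (kappa * X3)).
  rewrite ler_pM ?mulr_ge0 ?(ltW delta0)//.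
  by rewrite ler_pM// !mulr_ge0// ltW.
have h3 : (delta * (a (v u) * b k)) * (X2 * (delta * (a' l * b' (v w')))) <=
    kappa ^+ 2 * (a (v u) * b (v u') * (V * (a' (v w) * b' (v w')))).
  apply: le_trans h2 _.
  rewrite (_ : _ * _ = kappa ^+ 2 * (X1 * (X2 * X3))); last by ring.
  by rewrite ler_wpM2l// exprn_ge0// ltW.
have h4 : b k * X2 * a' l <= (kappa / delta) ^+ 2 * (b (v u') * V * a' (v w)).
  have ab0 : 0 < delta ^+ 2 * (a (v u) * b' (v w')).
    by rewrite mulr_gt0 ?exprn_gt0 ?mulr_gt0.
  rewrite -(ler_pM2l ab0).
  rewrite [leLHS](_ : _ =
    (delta * (a (v u) * b k)) * (X2 * (delta * (a' l * b' (v w'))))); last by ring.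
  apply: le_trans h3 _; rewrite le_eqVlt; apply/orP; left; apply/eqP.
  by field; rewrite gt_eqF.
apply: (@le_trans _ _ (K.+1%:R ^+ (w - u') * (b k * X2 * a' l))).
  rewrite [leLHS](_ : _ = (b k * a' l) * mprod u' w k l); last by ring.
  rewrite [leRHS](_ : _ = (b k * a' l) * (K.+1%:R ^+ (w - u') * X2));
    last by ring.
  by rewrite ler_wpM2l// mulr_ge0.
apply: (@le_trans _ _ (K.+1%:R ^+ (w - u') *
    ((kappa / delta) ^+ 2 * (b (v u') * V * a' (v w))))).
  by rewrite ler_wpM2l// exprn_ge0.
by rewrite le_eqVlt; apply/orP; left; apply/eqP; ring.
Qed.

(** Let [x] and [y] be the masses that reach the anchors from outside. The total weight is at most
    [x * y] times a sum of inner weights over pairs [(k, l)], each dominated by the optimal path;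
    the weight through [v t] is at least [delta ^ 2 * x * y] times that of the optimal path. The
    other factor [delta ^ 2] and [kappa ^ 2] come from the rerouting, and two factors [K + 1] count
    the pairs. *)
Lemma optimal_state_lb t : (u' <= t)%N -> (t <= w)%N ->
  delta ^+ 4 / (kappa ^+ 2 * K.+1%:R ^+ (w - u' + 2)) *
    mprod 0 N (v 0%N) (v N) <=
  mprod 0 t (v 0%N) (v t) * mprod t N (v t) (v N).
Proof.
move=> u't tw.
have [a [b [a0 b0 ab]]] := anchL; have [a' [b' [a'0 b'0 ab']]] := anchR.
have dom := optimal_path_dominates a0 b0 ab a'0 b'0 ab'.
set c := K.+1%:R ^+ (w - u') * _ * _ in dom.
pose al i := mprod 0 u (v 0%N) i.
pose be j := mprod w' N j (v N).
pose x := \sum_i al i * a i.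
pose y := \sum_j b' j * be j.
have al0 i : 0 <= al i by exact: mprod_ge0.
have be0 j : 0 <= be j by exact: mprod_ge0.
have x0 : 0 <= x by apply: sumr_ge0 => i _; rewrite mulr_ge0.
have y0 : 0 <= y by apply: sumr_ge0 => i _; rewrite mulr_ge0.
have lx j : delta * x * b j <= mprod 0 u' (v 0%N) j.
  rewrite (@mprod_cat u)// -mulmxE mxE /x mulr_sumr mulr_suml.
  apply: ler_sum => i _; rewrite mulrCA -mulrA ler_wpM2l// -mulrA.
  by have /andP[] := ab i j.
have ux j : mprod 0 u' (v 0%N) j <= x * b j.
  rewrite (@mprod_cat u)// -mulmxE mxE /x mulr_suml.
  apply: ler_sum => i _; rewrite -mulrA ler_wpM2l//.
  by have /andP[] := ab i j.
have ly i : delta * a' i * y <= mprod w N i (v N).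
  rewrite (@mprod_cat w')// -mulmxE mxE /y mulr_sumr.
  apply: ler_sum => j _; rewrite mulrA ler_wpM2r// -mulrA.
  by have /andP[] := ab' i j.
have uy i : mprod w N i (v N) <= a' i * y.
  rewrite (@mprod_cat w')// -mulmxE mxE /y mulr_sumr.
  apply: ler_sum => j _; rewrite mulrA ler_wpM2r ?mprod_ge0//.
  by have /andP[] := ab' i j.
have num : delta ^+ 2 * (x * y) * (b (v u') * pathw v u' w * a' (v w)) <=
    mprod 0 t (v 0%N) (v t) * mprod t N (v t) (v N).
  have n1 : delta * x * b (v u') * pathw v u' t <= mprod 0 t (v 0%N) (v t).
    rewrite (@mprod_cat u' 0 t)//.
    apply: le_trans (mulmx_ge _ (v u') _ (mprod_ge0 _ _) (mprod_ge0 _ _)).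
    by rewrite ler_pM ?mulr_ge0 ?pathw_ge0 ?pathw_le_mprod// ltW.
  have n2 : pathw v t w * (delta * a' (v w) * y) <= mprod t N (v t) (v N).
    rewrite (@mprod_cat w t N)//; last by lia.
    apply: le_trans (mulmx_ge _ (v w) _ (mprod_ge0 _ _) (mprod_ge0 _ _)).
    by rewrite ler_pM ?mulr_ge0 ?pathw_ge0 ?pathw_le_mprod// ltW.
  rewrite (@pathw_cat t v u' w)//.
  rewrite (_ : _ * _ = (delta * x * b (v u') * pathw v u' t) *
    (pathw v t w * (delta * a' (v w) * y))); last by ring.
  by rewrite ler_pM ?mulr_ge0 ?pathw_ge0// ltW.
have den : mprod 0 N (v 0%N) (v N) <= x * y * (K.+1%:R ^+ 2 * c).
  rewrite (@mprod_cat u' 0 N)//; last by lia.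
  rewrite (@mprod_cat w u' N)//; last by lia.
  rewrite -mulmxE mxE.
  apply: (@le_trans _ _ (\sum_(k < K.+1) \sum_(l < K.+1) (x * y) * c)); last first.
    rewrite !big_const_ord !iter_addr_0 -mulrnA -[_ *+ _]mulr_natl natrM expr2.
    by rewrite le_eqVlt; apply/orP; left; apply/eqP; ring.
  apply: ler_sum => k _; rewrite mxE mulr_sumr; apply: ler_sum => l _.
  apply: (@le_trans _ _ ((x * b k) * (mprod u' w k l * (a' l * y)))).
    by rewrite ler_pM ?mulr_ge0 ?mprod_ge0// ler_wpM2l ?mprod_ge0.
  rewrite (_ : _ * _ = (x * y) * (b k * mprod u' w k l * a' l)); last by ring.
  by rewrite ler_wpM2l ?mulr_ge0.
apply: le_trans num.
have kd : 0 < kappa ^+ 2 * K.+1%:R ^+ (w - u' + 2).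
  by rewrite mulr_gt0 ?exprn_gt0.
rewrite mulrAC ler_pdivrMr//.
apply: (@le_trans _ _ (delta ^+ 4 * (x * y * (K.+1%:R ^+ 2 * c)))).
  by rewrite ler_wpM2l// exprn_ge0// ltW.
rewrite le_eqVlt; apply/orP; left; apply/eqP; rewrite /c exprD.
by field; rewrite gt_eqF.
Qed.

End LowerBound.
End Products.
End NonnegativeMatrices.

(** * Contraction of ratios and forgetting of the boundary weights *)

Section Forgetting.
Context {R : realType} {K : nat}.
Notation rvec := 'rV[R]_K.+1.
Implicit Types (x y : rvec) (B : 'M[R]_K.+1) (lo hi : R).

Definition sandwich lo hi x y := forall j, lo * y 0 j <= x 0 j <= hi * y 0 j.

(* One anchored factor contracts the interval of possible ratios x_j / y_j: the
   nonnegative vectors x - lo y and hi y - x are both sent to vectors that dominate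
   a fixed proportion of y B. *)
Lemma sandwich_step delta B x y lo hi : 0 < delta <= 1 -> anchored delta B ->
  (forall j, 0 <= y 0 j) -> (exists j, 0 < (y *m B) 0 j) ->
  lo <= hi -> sandwich lo hi x y ->
  exists lo' hi', [/\ lo <= lo', lo' <= hi',
    hi' - lo' <= (1 - delta) * (hi - lo) & sandwich lo' hi' (x *m B) (y *m B)].
Proof.
move=> /andP[d0 d1] [a [b [a0 b0 ab]]] y0 [j0 yB] lohi xy.
pose ya := \sum_i y 0 i * a i.
pose X := \sum_i (x 0 i - lo * y 0 i) * a i.
pose W := \sum_i (hi * y 0 i - x 0 i) * a i.
have xlo i : 0 <= x 0 i - lo * y 0 i by have /andP[] := xy i; lra.
have xhi i : 0 <= hi * y 0 i - x 0 i by have /andP[] := xy i; lra.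
have X0 : 0 <= X by apply: sumr_ge0 => i _; rewrite mulr_ge0.
have W0 : 0 <= W by apply: sumr_ge0 => i _; rewrite mulr_ge0.
have yBle j : (y *m B) 0 j <= ya * b j.
  rewrite mxE /ya mulr_suml; apply: ler_sum => i _.
  by rewrite -mulrA ler_wpM2l//; have /andP[] := ab i j.
have ya0 : 0 < ya.
  rewrite lt_neqAle sumr_ge0 ?andbT => [|i _]; last by rewrite mulr_ge0.
  by apply: contraTneq (lt_le_trans yB (yBle j0)) => <-; rewrite mul0r ltxx.
have XW : X + W = (hi - lo) * ya.
  rewrite /X /W -big_split/= /ya mulr_sumr; apply: eq_bigr => i _; ring.
have lbX j : delta * X * b j <= (x *m B) 0 j - lo * (y *m B) 0 j.
  rewrite !mxE !mulr_sumr -sumrB /X mulr_suml; apply: ler_sum => i _.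
  rewrite (_ : x 0 i * B i j - _ = (x 0 i - lo * y 0 i) * B i j); last by ring.
  rewrite (_ : _ * b j = (x 0 i - lo * y 0 i) * (delta * (a i * b j)));
    last by ring.
  by rewrite ler_wpM2l//; have /andP[] := ab i j.
have lbW j : delta * W * b j <= hi * (y *m B) 0 j - (x *m B) 0 j.
  rewrite !mxE !mulr_sumr -sumrB /W mulr_suml; apply: ler_sum => i _.
  rewrite (_ : hi * (y 0 i * B i j) - _ = (hi * y 0 i - x 0 i) * B i j);
    last by ring.
  rewrite (_ : _ * b j = (hi * y 0 i - x 0 i) * (delta * (a i * b j)));
    last by ring.
  by rewrite ler_wpM2l//; have /andP[] := ab i j.
have share V j : 0 <= V -> delta * (V / ya) * (y *m B) 0 j <= delta * V * b j.
  move=> V0; rewrite -!mulrA ler_pM2l// ler_wpM2l// mulrC ler_pdivrMr//.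
  by rewrite mulrC.
exists (lo + delta * (X / ya)), (hi - delta * (W / ya)); split.
- by rewrite lerDl mulr_ge0 ?divr_ge0// ltW.
- rewrite -subr_ge0 (_ : _ - _ = (hi - lo) - delta * ((X + W) / ya)); last by ring.
  by rewrite XW mulfK ?gt_eqF//; nra.
- rewrite le_eqVlt; apply/orP; left; apply/eqP.
  rewrite (_ : _ - _ = (hi - lo) - delta * ((X + W) / ya)); last by ring.
  by rewrite XW mulfK ?gt_eqF//; ring.
- move=> j; have := share X j X0; have := share W j W0.
  have := lbX j; have := lbW j => *; apply/andP; split; lra.
Qed.

(** After one anchored factor every nonnegative vector is, up to the factor [delta], a multiple of
    the same vector [b]; so any two nonzero images are comparable. *)
Lemma sandwich_init delta B x y : 0 < delta <= 1 -> anchored delta B ->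
  (forall j, 0 <= x 0 j) -> (forall j, 0 <= y 0 j) ->
  (exists j, 0 < (x *m B) 0 j) -> (exists j, 0 < (y *m B) 0 j) ->
  exists lo hi, [/\ 0 < lo, lo <= hi, hi <= delta ^- 2 * lo &
    sandwich lo hi (x *m B) (y *m B)].
Proof.
move=> /andP[d0 d1] [a [b [a0 b0 ab]]] x0 y0 [j1 xB] [j2 yB].
pose s (z : rvec) := \sum_i z 0 i * a i.
have ub (z : rvec) j : (forall j, 0 <= z 0 j) -> (z *m B) 0 j <= s z * b j.
  move=> z0; rewrite mxE /s mulr_suml; apply: ler_sum => i _.
  by rewrite -mulrA ler_wpM2l//; have /andP[] := ab i j.
have lb (z : rvec) j : (forall j, 0 <= z 0 j) -> delta * (s z * b j) <= (z *m B) 0 j.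
  move=> z0; rewrite mxE /s mulr_suml mulr_sumr; apply: ler_sum => i _.
  by rewrite -mulrA mulrCA ler_wpM2l//; have /andP[] := ab i j.
have spos (z : rvec) j : (forall j, 0 <= z 0 j) -> 0 < (z *m B) 0 j -> 0 < s z.
  move=> z0 zB; rewrite lt_neqAle sumr_ge0 ?andbT => [|i _]; last by rewrite mulr_ge0.
  by apply: contraTneq (lt_le_trans zB (ub z j z0)) => <-; rewrite mul0r ltxx.
have sx := spos _ _ x0 xB; have sy := spos _ _ y0 yB.
have rxy : 0 < s x / s y by rewrite divr_gt0.
exists (delta * (s x / s y)), (delta^-1 * (s x / s y)); split.
- by rewrite mulr_gt0.
- rewrite ler_pM2r//; apply: (@le_trans _ _ 1) => //.
  by rewrite -[leLHS]invr1 lef_pV2 ?posrE.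
- rewrite le_eqVlt; apply/orP; left; apply/eqP; field.
  by rewrite !gt_eqF.
- move=> j; apply/andP; split.
    apply: le_trans (lb x j x0).
    rewrite -mulrA ler_pM2l// -mulrA ler_pM2l// ler_pdivrMl//.
    exact: ub.
  apply: le_trans (ub x j x0) _.
  apply: (@le_trans _ _ (delta^-1 * (s x / s y) * (delta * (s y * b j)))).
    rewrite le_eqVlt; apply/orP; left; apply/eqP; field.
    by rewrite !gt_eqF.
  by rewrite ler_wpM2l ?lb// mulr_ge0 ?invr_ge0 ?ltW.
Qed.

(** Factor [0] makes the vectors comparable, and each of the next [n] contracts the width [hi - lo].
    As [lo] only increases, the width relative to [lo] contracts as well. *)
Lemma sandwich_iter delta (B : nat -> 'M[R]_K.+1) (x y : nat -> rvec) n :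
  0 < delta <= 1 -> (forall i, (i <= n)%N -> anchored delta (B i)) ->
  (forall i, (i <= n)%N -> x i.+1 = x i *m B i) ->
  (forall i, (i <= n)%N -> y i.+1 = y i *m B i) ->
  (forall i j, (i <= n)%N -> 0 <= x i 0 j) ->
  (forall i j, (i <= n)%N -> 0 <= y i 0 j) ->
  (forall i, (i <= n.+1)%N -> exists j, 0 < x i 0 j) ->
  (forall i, (i <= n.+1)%N -> exists j, 0 < y i 0 j) ->
  exists lo hi, [/\ 0 < lo, lo <= hi,
    hi - lo <= delta ^- 2 * (1 - delta) ^+ n * lo &
    sandwich lo hi (x n.+1) (y n.+1)].
Proof.
move=> dl; have /andP[d0 d1] := dl; elim: n => [|n IH] aB xB yB x0 y0 xp yp.
  have [j1 xj] := xp 1%N isT; have [j2 yj] := yp 1%N isT.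
  have [||lo [hi [lo0 lohi hilo sw]]] := sandwich_init dl (aB 0%N isT)
    (fun j => x0 0%N j isT) (fun j => y0 0%N j isT).
  - by exists j1; rewrite -xB.
  - by exists j2; rewrite -yB.
  exists lo, hi; split => //; last by rewrite xB// yB.
  by rewrite expr0 mulr1; lra.
have [lo [hi [lo0 lohi hilo sw]]] : exists lo hi, [/\ 0 < lo, lo <= hi,
    hi - lo <= delta ^- 2 * (1 - delta) ^+ n * lo &
    sandwich lo hi (x n.+1) (y n.+1)].
  apply: IH.
  - by move=> i h; apply: aB; rewrite leqW.
  - by move=> i h; apply: xB; rewrite leqW.
  - by move=> i h; apply: yB; rewrite leqW.
  - by move=> i j h; apply: x0; rewrite leqW.
  - by move=> i j h; apply: y0; rewrite leqW.
  - by move=> i h; apply: xp; rewrite leqW.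
  - by move=> i h; apply: yp; rewrite leqW.
have [|lo' [hi' [l1 l2 l3 l4]]] := sandwich_step dl (aB n.+1 (leqnn _))
  (fun j => y0 n.+1 j (leqnn _)) _ lohi sw.
  by rewrite -yB//; exact: yp.
exists lo', hi'; split => //; [exact: lt_le_trans l1| |by rewrite xB// yB].
apply: le_trans l3 _; rewrite [(1 - delta) ^+ _]exprS.
have dd : 0 <= 1 - delta by rewrite subr_ge0.
have : 0 <= delta ^- 2 by rewrite invr_ge0 exprn_ge0// ltW.
move: (delta ^- 2) hilo => q hilo q0.
apply: (@le_trans _ _ ((1 - delta) * (q * (1 - delta) ^+ n * lo))).
  by rewrite ler_wpM2l.
rewrite [leRHS](_ : _ = (1 - delta) * (q * (1 - delta) ^+ n * lo')); last by ring.
by rewrite ler_wpM2l// ler_wpM2l// mulr_ge0 ?exprn_ge0.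
Qed.

(** Normalization cancels the common scale: the two posteriors differ at most by the factor
    [(hi / lo) * (hi2 / lo2)], and [ln z <= z - 1]. *)
Lemma posterior_ln_close (al al' be be' : 'I_K.+1 -> R) lo hi lo2 hi2 a :
  (forall i, 0 <= al i) -> (forall i, 0 <= be i) ->
  (forall i, 0 <= al' i) -> (forall i, 0 <= be' i) ->
  0 < lo -> lo <= hi -> 0 < lo2 -> lo2 <= hi2 ->
  (forall i, lo * al' i <= al i <= hi * al' i) ->
  (forall i, lo2 * be' i <= be i <= hi2 * be' i) ->
  0 < al a * be a ->
  `| ln (al a * be a / \sum_i al i * be i) -
     ln (al' a * be' a / \sum_i al' i * be' i) | <=
  (hi - lo) / lo + (hi2 - lo2) / lo2.
Proof.
move=> al0 be0 al'0 be'0 lo0 lohi lo20 lohi2 hal hbe pa.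
have hi0 := lt_le_trans lo0 lohi; have hi20 := lt_le_trans lo20 lohi2.
have up i : al i * be i <= hi * hi2 * (al' i * be' i).
  rewrite mulrACA; apply: ler_pM => //; first by have /andP[] := hal i.
  by have /andP[] := hbe i.
have dn i : lo * lo2 * (al' i * be' i) <= al i * be i.
  rewrite mulrACA; apply: ler_pM; rewrite ?mulr_ge0 ?(ltW lo0) ?(ltW lo20)//.
    by have /andP[] := hal i.
  by have /andP[] := hbe i.
have pa' : 0 < al' a * be' a.
  by rewrite -(pmulr_rgt0 _ (mulr_gt0 hi0 hi20)); exact: lt_le_trans (up a).
set Sg := \sum_i al i * be i; set Sg' := \sum_i al' i * be' i.
have Sup : Sg <= hi * hi2 * Sg' by rewrite mulr_sumr; apply: ler_sum => i _.
have Sdn : lo * lo2 * Sg' <= Sg by rewrite mulr_sumr; apply: ler_sum => i _.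
have Sg0 : 0 < Sg.
  rewrite /Sg (bigD1 a)//= ltr_pwDl// sumr_ge0// => i _; exact: mulr_ge0.
have Sg'0 : 0 < Sg'.
  rewrite /Sg' (bigD1 a)//= ltr_pwDl// sumr_ge0// => i _; exact: mulr_ge0.
pose kap := (hi / lo) * (hi2 / lo2).
have kap0 : 0 < kap by rewrite mulr_gt0 ?divr_gt0.
have lnk : ln kap <= (hi - lo) / lo + (hi2 - lo2) / lo2.
  have lnle (z : R) : 0 < z -> ln z <= z - 1.
    move=> z0; have := @le_ln1Dx R (z - 1).
    by rewrite (_ : 1 + (z - 1) = z) => [->//|]; lra.
  rewrite lnM ?posrE ?divr_gt0//; apply: lerD.
    by apply: le_trans (lnle _ _) _; rewrite ?divr_gt0// mulrBl divff// gt_eqF.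
  by apply: le_trans (lnle _ _) _; rewrite ?divr_gt0// mulrBl divff// gt_eqF.
apply: le_trans lnk.
have q0 : 0 < al a * be a / Sg by rewrite divr_gt0.
have q'0 : 0 < al' a * be' a / Sg' by rewrite divr_gt0.
have i1 : al a * be a / Sg <= kap * (al' a * be' a / Sg').
  rewrite ler_pdivrMr//.
  apply: le_trans (up a) _.
  rewrite [leLHS](_ : _ = kap * (al' a * be' a / Sg') * (lo * lo2 * Sg')).
    by rewrite ler_wpM2l// ltW// mulr_gt0.
  by rewrite /kap; field; rewrite !gt_eqF.
have i2 : al' a * be' a / Sg' <= kap * (al a * be a / Sg).
  rewrite ler_pdivrMr//.
  have h : al' a * be' a <= (lo * lo2)^-1 * (al a * be a).
    by rewrite ler_pdivlMl ?mulr_gt0.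
  apply: le_trans h _.
  have h : Sg <= hi * hi2 * Sg' := Sup.
  rewrite [leLHS](_ : _ = (lo * lo2)^-1 * (al a * be a / Sg) * Sg).
    rewrite [leRHS](_ : _ = (lo * lo2)^-1 * (al a * be a / Sg) * (hi * hi2 * Sg')).
      by rewrite ler_wpM2l// ltW// mulr_gt0// invr_gt0 mulr_gt0.
    by rewrite /kap; field; rewrite !gt_eqF.
  by field; rewrite !gt_eqF.
have kq := mulr_gt0 kap0 q0; have kq' := mulr_gt0 kap0 q'0.
rewrite ler_norml; apply/andP; split.
  by rewrite lerNl opprB lerBlDr -lnM ?posrE// ler_ln ?posrE.
by rewrite lerBlDr -lnM ?posrE// ler_ln ?posrE.
Qed.

End Forgetting.

(** * Posteriors of a hidden Markov model as matrix products *)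

Section Densities.
Context {d : measure_display} {T : measurableType d} {R : realType}.
Local Open Scope ereal_scope.
Import HBNNSimple.

(** The argument goes through simple functions and monotone convergence, so [mu] may be any measure,
    sigma-finite or not. *)
Lemma measure_of_density (mu : {measure set T -> \bar R}) (f : T -> R) :
  measurable_fun [set: T] f -> (forall x, (0 <= f x)%R) ->
  exists nu : {measure set T -> \bar R},
    (forall A, nu A = \int[mu]_(x in A) (f x)%:E) /\
    forall h, measurable_fun [set: T] h -> (forall x, 0 <= h x) ->
      \int[nu]_x h x = \int[mu]_x (h x * (f x)%:E).
Proof.
move=> mf f0; pose g x := (f x)%:E.
have mg : measurable_fun [set: T] g by exact/measurable_EFinP.
have g0 x : 0 <= g x by rewrite lee_fin.
pose m (A : set T) := \int[mu]_(x in A) g x.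
have m0 : m set0 = 0 by rewrite /m integral_set0.
have mge0 A : 0 <= m A by apply: integral_ge0.
have madd : semi_sigma_additive m.
  move=> F mF tF mUF; rewrite /m ge0_integral_bigcup//; last first.
    exact: measurable_funTS.
  apply: is_cvg_nneseries => n _ _; exact: integral_ge0.
pose mix := isMeasure.Build _ _ _ m m0 mge0 madd.
pose nu : {measure set T -> \bar R} := HB.pack m mix.
exists nu; split => // h mh h0.
rewrite -[RHS]/(\int[mu]_x (h x * g x)).
pose hn := nnsfun_approx measurableT mh.
have -> : \int[nu]_x h x = lim (\int[nu]_x (EFin \o hn n) x @[n --> \oo]).
  have hE x : h x = lim ((EFin \o hn n) x @[n --> \oo]).
    by apply/esym/cvg_lim => //; exact: cvg_nnsfun_approx.
  under eq_integral => x _ do rewrite hE.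
  apply: monotone_convergence => //.
  - by move=> n; exact/measurable_EFinP.
  - by move=> n x _ //=; rewrite lee_fin.
  - by move=> x _ a b ab; rewrite lee_fin; exact/lefP/nd_nnsfun_approx.
have -> : \int[mu]_x (h x * g x) =
    lim (\int[mu]_x ((EFin \o hn n) x * g x) @[n --> \oo]).
  have hE x : h x * g x = lim ((EFin \o hn n) x * g x @[n --> \oo]).
    apply/esym/cvg_lim => //; apply: cvgeZr => //.
    exact: cvg_nnsfun_approx.
  under eq_integral => x _ do rewrite hE.
  apply: monotone_convergence => //.
  - by move=> n; apply: emeasurable_funM => //; exact/measurable_EFinP.
  - by move=> n x _ /=; rewrite mule_ge0 ?lee_fin.
  - by move=> x _ a b ab/=; rewrite lee_wpmul2r ?lee_fin//; exact/lefP/nd_nnsfun_approx.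
suff suf n : \int[mu]_x ((EFin \o hn n) x * g x) = \int[nu]_x (EFin \o hn n) x.
  by under [in RHS]eq_fun do rewrite suf.
transitivity (\int[nu]_x
   (\sum_(y \in range (hn n)) (y * \1_(hn n @^-1` [set y]) x)%:E)); last first.
  by apply: eq_integral => t tE; rewrite /= fimfunE -fsumEFin.
have indich r : measurable_fun [set: T] (fun x => (r * \1_(hn n @^-1` [set r]) x)%:E).
  by apply/measurable_EFinP; exact: measurable_funM.
rewrite ge0_integral_fsum//; last by move=> y x _; exact: nnfun_muleindic_ge0.
transitivity (\int[mu]_x (\sum_(y \in range (hn n))
    (y * \1_(hn n @^-1` [set y]) x)%:E * g x)).
  under [RHS]eq_integral => x xE.
    rewrite -ge0_mule_fsuml => [|y]; last exact: nnfun_muleindic_ge0.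
    rewrite fsumEFin // -(fimfunE _ x); over.
  by [].
rewrite ge0_integral_fsum//; last 2 first.
  - by move=> y; exact: emeasurable_funM.
  - by move=> y x _; rewrite mule_ge0// nnfun_muleindic_ge0.
apply: eq_fsbigr => r rhn.
have r0 : (0 <= r)%R by move: rhn; rewrite inE => -[t _ <-].
under [RHS]eq_integral do rewrite EFinM.
rewrite integralZl_indic_nnsfun => //.
under eq_integral do rewrite EFinM -muleA.
rewrite ge0_integralZl//.
- under eq_integral do rewrite muleC.
  rewrite (eq_integral (g \_ (hn n @^-1` [set r]))); last first.
    by move=> x xE; rewrite epatch_indic.
  by rewrite -integral_mkcond integral_indic// setIT.
- by apply: emeasurable_funM => //; exact/measurable_EFinP.
- by move=> t Et; rewrite mule_ge0 ?lee_fin.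
Qed.

End Densities.

(** * Measures on tuples determined by boxes *)

Section TupleMeasures.
Context {d : measure_display} {X : measurableType d} {R : realType}.
Variable n : nat.

Definition box (B : 'I_n -> set X) : set (n.-tuple X) :=
  [set x | forall i, B i (tnth x i)].

Definition boxes : set (set (n.-tuple X)) :=
  [set A | exists B : 'I_n -> set X, (forall i, measurable (B i)) /\ A = box B].

Lemma measurable_box B : (forall i, measurable (B i)) -> measurable (box B).
Proof.
move=> mB; have -> : box B = \bigcap_(i in [set: 'I_n]) ((@tnth n X ^~ i) @^-1` B i).
  by apply/seteqP; split => x h i; [move=> _; exact: h|exact: h].
apply: fin_bigcap_measurable => // i _.
by rewrite -[X in measurable X]setTI; exact: measurable_tnth.
Qed.

Lemma boxes_generate : (@measurable _ (n.-tuple X)) = <<s boxes >>.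
Proof.
apply/seteqP; split; last first.
  apply: smallest_sub; first exact: sigma_algebra_measurable.
  by move=> _ [B [mB ->]]; exact: measurable_box.
apply: smallest_sub; first exact: smallest_sigma_algebra.
move=> A; rewrite -bigcup_seq => -[i _ [B mB <-]].
apply: sub_sigma_algebra.
exists (fun j => if j == i then B else setT); split.
  by move=> j; case: ifP.
apply/seteqP; split => x /=.
  by move=> [_ Bx] j; case: eqP => // ->.
by move/(_ i); rewrite eqxx.
Qed.

Lemma boxes_setI : setI_closed boxes.
Proof.
move=> _ _ [B [mB ->]] [C [mC ->]].
exists (fun i => B i `&` C i); split; first by move=> i; exact: measurableI.
by apply/seteqP; split => x; [move=> [h1 h2] i|move=> h; split=> i; have [] := h i].
Qed.

Lemma box_measure_unique (m1 m2 : {measure set (n.-tuple X) -> \bar R}) :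
  (m1 setT < +oo)%E ->
  (forall B, (forall i, measurable (B i)) -> m1 (box B) = m2 (box B)) ->
  forall A, measurable A -> m1 A = m2 A.
Proof.
move=> fin1 m12; have bT : box (fun=> setT) = setT by apply/seteqP; split.
apply: (measure_unique boxes (fun=> setT)).
- exact: boxes_generate.
- exact: boxes_setI.
- by move=> _; exists (fun=> setT); split.
- by rewrite bigcup_const//; exists 0%N.
- by move=> _ [B [mB ->]]; exact: m12.
- by [].
Qed.

End TupleMeasures.

Section IntegralBoxes.
Context {d d' : measure_display} {Omega : measurableType d}
  {X : measurableType d'} {R : realType}.
Variables (P : {measure set Omega -> \bar R}) (n : nat).
Variable theta : Omega -> n.-tuple X.
Hypothesis mtheta : measurable_fun [set: Omega] theta.

Local Open Scope ereal_scope.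

(* Two densities with the same integral over the preimages of boxes have the same
   conditional expectation given theta. *)
Lemma eq_integral_boxes (f g : Omega -> R) :
  measurable_fun [set: Omega] f -> measurable_fun [set: Omega] g ->
  (forall w, (0 <= f w)%R) -> (forall w, (0 <= g w)%R) ->
  \int[P]_w (f w)%:E < +oo ->
  (forall B : 'I_n -> set X, (forall i, measurable (B i)) ->
    \int[P]_(w in theta @^-1` box B) (f w)%:E =
    \int[P]_(w in theta @^-1` box B) (g w)%:E) ->
  forall h : n.-tuple X -> \bar R, measurable_fun [set: n.-tuple X] h ->
    (forall x, 0 <= h x) ->
    \int[P]_w (h (theta w) * (f w)%:E) = \int[P]_w (h (theta w) * (g w)%:E).
Proof.
move=> mf mg f0 g0 ffin fg h mh h0.
have [nf [nfE nfh]] := measure_of_density P mf f0.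
have [ng [ngE ngh]] := measure_of_density P mg g0.
pose mix := isMeasurableFun.Build _ _ _ _ _ mtheta.
pose th : {mfun Omega >-> n.-tuple X} := HB.pack theta mix.
have mhth : measurable_fun [set: Omega] (h \o theta).
  exact: (measurableT_comp mh mtheta).
rewrite -(nfh (h \o theta))// -?(ngh (h \o theta))//; try by move=> w; exact: h0.
transitivity (\int[pushforward nf th]_x h x).
  by rewrite [RHS]ge0_integral_pushforward// => y _; exact: h0.
transitivity (\int[pushforward ng th]_x h x); last first.
  by rewrite [LHS]ge0_integral_pushforward// => y _; exact: h0.
apply: eq_measure_integral => A mA _.
apply: box_measure_unique => //.
  by rewrite -[X in X < _]/(nf setT) nfE.
by move=> B mB; rewrite /= /pushforward nfE ngE; exact: fg.
Qed.

End IntegralBoxes.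

(** * Normalized emission weights and conditional independence *)

Section HiddenMarkov.
Context {d d' : measure_display} {Omega : measurableType d}
  {X : measurableType d'} {R : realType} {K : nat}.
Variable (P : probability Omega R).
Variables (Xt : nat -> {RV P >-> X}) (Yt : nat -> {RV P >-> 'I_K.+1}).
Variables (mu : {measure set X -> \bar R}) (p : 'M[R]_K.+1).
Variables (Ps : 'I_K.+1 -> probability X R) (f : 'I_K.+1 -> X -> R).
Hypothesis hmm : ergodic_hmm Xt Yt mu p Ps f.

(* The densities with respect to sum_a f_a mu, which are bounded by 1; the factor
   sum_a f_a cancels in all posterior probabilities. *)
Definition emis (s : 'I_K.+1) (x : X) : R := f s x / \sum_a f a x.

Lemma f_ge0 s x : 0 <= f s x.
Proof. by case: hmm => _ _ _ /(_ s)[]. Qed.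

Lemma measurable_f s : measurable_fun [set: X] (f s).
Proof. by case: hmm => _ _ _ /(_ s)[]. Qed.

Lemma sum_f_ge s x : f s x <= \sum_a f a x.
Proof.
by rewrite (bigD1 s)//= lerDl sumr_ge0// => a _; exact: f_ge0.
Qed.

Lemma emis_ge0 s x : 0 <= emis s x.
Proof.
rewrite divr_ge0 ?f_ge0//; apply: sumr_ge0 => a _; exact: f_ge0.
Qed.

Lemma emis_le1 s x : emis s x <= 1.
Proof.
have := sum_f_ge s x; have := f_ge0 s x; rewrite /emis.
set F := \sum_a _ => f0 fF; have F0 := le_trans f0 fF.
have [->|Fn0] := eqVneq F 0; first by rewrite invr0 mulr0.
by rewrite ler_pdivrMr ?mul1r// lt_neqAle eq_sym Fn0.
Qed.

(** Where all densities vanish the quotient is [0] by the convention for division by zero, in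
    agreement with [f s x = 0]. *)
Lemma emis_eq0 s x : (emis s x == 0) = (f s x == 0).
Proof.
apply/idP/idP => [|/eqP f0]; last by rewrite /emis f0 mul0r.
rewrite mulf_eq0 invr_eq0 => /orP[//|F0].
by rewrite eq_le f_ge0 andbT -(eqP F0) sum_f_ge.
Qed.

Lemma measurable_sum_f : measurable_fun [set: X] (fun x => \sum_a f a x).
Proof. by apply: measurable_sum => a; exact: measurable_f. Qed.

Lemma measurable_emis s : measurable_fun [set: X] (emis s).
Proof.
apply: measurable_funM; first exact: measurable_f.
have -> : (fun x => (\sum_a f a x)^-1) = (fun x => (\sum_a f a x) `^ (-1)).
  apply/funext => x; rewrite powR_inv1// sumr_ge0// => a _; exact: f_ge0.
exact: (measurableT_comp (measurable_powR (-1)) measurable_sum_f).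
Qed.

Lemma emissionE s B : measurable B -> Ps s B = (\int[mu]_(x in B) (f s x)%:E)%E.
Proof. by case: hmm => _ _ _ /(_ s)[_ _ +]; exact. Qed.

Lemma integral_emission s (h : X -> \bar R) : measurable_fun [set: X] h ->
  (forall x, 0 <= h x)%E ->
  (\int[Ps s]_x h x = \int[mu]_x (h x * (f s x)%:E))%E.
Proof.
move=> mh h0.
have [nu [nuE nuh]] := measure_of_density mu (measurable_f s) (f_ge0 s).
rewrite -nuh//; apply: eq_measure_integral => A mA _.
by rewrite nuE; exact: emissionE.
Qed.

(** Both sides are the integral over [B] of [f a * f b] divided by the sum of all densities. This
    symmetry lets [emis] act as a likelihood without a product reference measure. *)
Lemma emis_sym a b (B : set X) : measurable B ->
  (\int[Ps b]_x (emis a x * \1_B x)%:E = \int[Ps a]_x (emis b x * \1_B x)%:E)%E.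
Proof.
move=> mB.
have mi c : measurable_fun [set: X] (fun x => (emis c x * \1_B x)%:E).
  apply/measurable_EFinP; apply: measurable_funM; first exact: measurable_emis.
  exact: measurable_indic.
have i0 c x : (0 <= (emis c x * \1_B x)%:E)%E.
  by rewrite lee_fin mulr_ge0// emis_ge0.
rewrite !integral_emission//; apply: eq_integral => x _.
by rewrite -!EFinM /emis; congr EFin; ring.
Qed.

Lemma emis_gt0_as s : Ps s [set x | emis s x = 0] = 0%E.
Proof.
have mA : measurable [set x | emis s x = 0].
  rewrite -[X in measurable X]setTI; exact: (measurable_emis s measurableT (measurable_set1 (0 : R))).
rewrite [LHS]emissionE//.
apply: integral0_eq => x /= /eqP; rewrite emis_eq0 => /eqP ->.
by [].
Qed.

Lemma measurable_path_event k n y : measurable (path_event Yt k n y).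
Proof.
have -> : path_event Yt k n y =
    \bigcap_(t in [set t | (1 <= t <= n)%N]) (Yt (k + t)%N @^-1` [set y t]).
  by apply/seteqP; split.
apply: bigcap_measurableType => t _.
rewrite -[X in measurable X]setTI; exact: (measurable_funPT (Yt _)).
Qed.

Let integral_emission_fin s (h : X -> R) : measurable_fun [set: X] h ->
  (forall x, 0 <= h x <= 1) -> (\int[Ps s]_x (h x)%:E)%E \is a fin_num.
Proof.
move=> mh h01; rewrite ge0_fin_numE; last first.
  by apply: integral_ge0 => x _; rewrite lee_fin; have /andP[] := h01 x.
apply: (@le_lt_trans _ _ (\int[Ps s]_x cst 1%:E x)%E).
  apply: ge0_le_integral => //.
  - by move=> x _; rewrite lee_fin; have /andP[] := h01 x.
  - exact/measurable_EFinP.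
  - by move=> x _; rewrite lee_fin; have /andP[] := h01 x.
by rewrite integral_cst// [X in (_ * X)%E]probability_setT mule1 ltry.
Qed.

Let emission_product_indic n (y : nat -> 'I_K.+1) (B : nat -> set X) :
  (forall t, measurable (B t)) ->
  (\int[P]_w (\1_(path_event Yt 0 n y) w *
     \prod_(1 <= t < n.+1) \1_(B t) (Xt t w))%:E
   = P (path_event Yt 0 n y) * (\prod_(1 <= t < n.+1) fine (Ps (y t) (B t)))%:E)%E.
Proof.
move=> mB; have [_ _ ci _] := hmm; rewrite -(ci n y B mB).
rewrite -[in RHS](setIT (_ `&` _)) -integral_indic//; last first.
  apply: measurableI; first exact: measurable_path_event.
  have -> : [set w | forall t, (1 <= t <= n)%N -> B t (Xt t w)] =
      \bigcap_(t in [set t | (1 <= t <= n)%N]) (Xt t @^-1` (B t)).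
    by apply/seteqP; split.
  apply: bigcap_measurableType => t _.
  by rewrite -[X in measurable X]setTI; exact: (measurable_funPT (Xt _)).
apply: eq_integral => w _; congr EFin; rewrite indicI/=; congr (_ * _).
have [h|h] := pselect (forall t, (1 <= t <= n)%N -> B t (Xt t w)).
  rewrite indicE mem_set//; apply: big1_seq => t /=.
  by rewrite mem_index_iota ltnS => ht; rewrite indicE mem_set//; exact: h.
rewrite indicE.
rewrite memNset//; apply/esym.
have [t ht] : exists t, ~ ((1 <= t <= n)%N -> B t (Xt t w)).
  by apply: contrapT => h'; apply: h => t; apply: contrapT => h2; apply: h'; exists t.
have /not_implyP[tn nB] := ht.
rewrite (bigD1_seq t)/= ?iota_uniq ?mem_index_iota ?ltnS//.
by rewrite indicE memNset// mul0r.
Qed.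

Let formula n (y : nat -> 'I_K.+1) (h : nat -> X -> R) :=
  (\int[P]_w (\1_(path_event Yt 0 n y) w * \prod_(1 <= t < n.+1) h t (Xt t w))%:E
   = P (path_event Yt 0 n y) *
     (\prod_(1 <= t < n.+1) fine (\int[Ps (y t)]_x (h t x)%:E))%:E)%E.

Let formula_ext n y (g h : nat -> X -> R) :
  (forall t, (1 <= t < n.+1)%N -> g t = h t) -> formula n y g -> formula n y h.
Proof.
move=> gh; rewrite /formula => hg.
transitivity (\int[P]_w (\1_(path_event Yt 0 n y) w *
    \prod_(1 <= t < n.+1) g t (Xt t w))%:E)%E.
  apply: eq_integral => w _; congr (_ * _)%:E.
  by apply: eq_big_nat => t tn; rewrite gh.
rewrite hg; congr (_ * _%:E)%E; apply: eq_big_nat => t tn; by rewrite gh.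
Qed.

(** Conditional independence passes from sets to bounded functions one time at a time: with the
    other functions fixed, both sides are finite measures in the set whose indicator stands at time
    [k + 1], so they integrate functions equally. *)
Lemma emission_product n (y : nat -> 'I_K.+1) (h : nat -> X -> R) :
  (forall t, measurable_fun [set: X] (h t)) -> (forall t x, 0 <= h t x <= 1) ->
  (\int[P]_w (\1_(path_event Yt 0 n y) w * \prod_(1 <= t < n.+1) h t (Xt t w))%:E
   = P (path_event Yt 0 n y) *
     (\prod_(1 <= t < n.+1) fine (\int[Ps (y t)]_x (h t x)%:E))%:E)%E.
Proof.
move=> mh h01.
suff gen k (g : nat -> X -> R) :
    (forall t, measurable_fun [set: X] (g t)) -> (forall t x, 0 <= g t x <= 1) ->
    (forall t, (k < t)%N -> exists2 B, measurable B & g t = \1_B) ->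
    formula n y g.
  (* Times beyond [n] do not occur in the products; placing indicators there reduces the claim to
     the case [k = n] of the induction. *)
  pose g t := if (t <= n)%N then h t else \1_setT.
  apply: (@formula_ext n y g); first by move=> t /andP[_ tn]; rewrite /g -ltnS tn.
  apply: (gen n).
  - by move=> t; rewrite /g; case: ifP.
  - by move=> t x; rewrite /g; case: ifP => // _; rewrite indicT ler01 lexx.
  - by move=> t nt; exists setT => //; rewrite /g leqNgt nt.
elim: k g => [|k IH] g mg g01 gB.
  pose B t := g t @^-1` [set 1].
  have mB t : measurable (B t).
    rewrite -[X in measurable X]setTI; exact: (mg t measurableT _ (measurable_set1 (1 : R))).
  have gE t : (0 < t)%N -> g t = \1_(B t).
    move=> /gB[A _ gA]; apply/funext => x; rewrite [in LHS]gA !indicE.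
    suff -> : (x \in B t) = (x \in A) by [].
    have -> : (x \in B t) = (g t x == 1).
      by apply/idP/eqP => [|gx]; rewrite inE.
    by rewrite gA indicE; case: (x \in A); rewrite ?eqxx// eq_sym oner_eq0.
  apply: (@formula_ext n y (fun t => \1_(B t))).
    by move=> t /andP[t1 _]; rewrite gE.
  rewrite /formula emission_product_indic//; congr (_ * _%:E)%E.
  by apply: eq_bigr => t _; rewrite integral_indic// setIT.
pose gC (C : set X) t : X -> R := if t == k.+1 then \1_C else g t.
have mgC C t : measurable C -> measurable_fun [set: X] (gC C t).
  by move=> mC; rewrite /gC; case: ifP => // _; exact: measurable_indic.
have gC01 C t x : 0 <= gC C t x <= 1.
  rewrite /gC; case: ifP => // _; rewrite indicE.
  by case: (_ \in _); rewrite ?ler01 ?lexx.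
have IHC C : measurable C -> formula n y (gC C).
  move=> mC; apply: (IH (gC C) (fun t => mgC C t mC) (gC01 C)) => t kt.
  rewrite /gC; case: eqVneq => [_|tk]; first by exists C.
  by apply: gB; rewrite ltn_neqAle eq_sym tk.
have [kn|nk] := ltnP k n; last first.
  apply: formula_ext (IHC setT measurableT).
  by move=> t /andP[_ tn]; rewrite /gC; case: eqP => // tk; lia.
pose r := [seq t <- index_iota 1 n.+1 | t != k.+1].
have prodE (F : nat -> R) :
    \prod_(1 <= t < n.+1) F t = F k.+1 * \prod_(t <- r) F t.
  rewrite (bigD1_seq k.+1)/= ?iota_uniq ?mem_index_iota ?ltnS//.
  by rewrite /r big_filter.
have rE C (F : nat -> (X -> R) -> R) :
    \prod_(t <- r) F t (gC C t) = \prod_(t <- r) F t (g t).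
  rewrite /r !big_filter; apply: eq_bigr => t tk.
  by rewrite /gC (negbTE tk).
pose rest w : R := \1_(path_event Yt 0 n y) w * \prod_(t <- r) g t (Xt t w).
have mX t : measurable_fun [set: Omega] (Xt t) by exact: measurable_funPT.
have mrest : measurable_fun [set: Omega] rest.
  apply: measurable_funM; first exact/measurable_indic/measurable_path_event.
  by apply: measurable_prod => t _; exact: (measurableT_comp (mg t) (mX t)).
have rest0 w : 0 <= rest w.
  rewrite mulr_ge0//; apply: prodr_ge0 => t _; by have /andP[] := g01 t (Xt t w).
(* The law of [X_{k+1}] under the density [rest] will be [c] times the emission law. *)
pose c := fine (P (path_event Yt 0 n y)) *
  \prod_(t <- r) fine (\int[Ps (y t)]_x (g t x)%:E)%E.
have c0 : 0 <= c.
  rewrite mulr_ge0 ?fine_ge0// prodr_ge0// => t _; apply: fine_ge0.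
  by apply: integral_ge0 => x _; rewrite lee_fin; have /andP[] := g01 t x.
have fP : P (path_event Yt 0 n y) \is a fin_num.
  by rewrite fin_num_measure//; exact: measurable_path_event.
have [nu [nuE nuh]] := measure_of_density P mrest rest0.
transitivity (\int[nu]_w (g k.+1 (Xt k.+1 w))%:E)%E.
  rewrite nuh; last 2 first.
  - by apply/measurable_EFinP; exact: (measurableT_comp (mg _) (mX _)).
  - by move=> w; rewrite lee_fin; have /andP[] := g01 k.+1 (Xt k.+1 w).
  by apply: eq_integral => w _; rewrite prodE /rest -EFinM; congr EFin; ring.
transitivity (\int[pushforward nu (Xt k.+1)]_x (g k.+1 x)%:E)%E.
  rewrite [RHS]ge0_integral_pushforward//; first exact/measurable_EFinP.
  by move=> x _; rewrite lee_fin; have /andP[] := g01 k.+1 x.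
transitivity (\int[mscale (NngNum c0) (Ps (y k.+1))]_x (g k.+1 x)%:E)%E.
  apply: eq_measure_integral => C mC _.
  rewrite /= /pushforward /mscale/= nuE.
  have := IHC C mC; rewrite /formula !prodE.
  rewrite (rE C (fun t F => fine (\int[Ps (y t)]_x (F x)%:E)%E)).
  rewrite {2}/gC eqxx integral_indic// setIT => hC.
  transitivity (P (path_event Yt 0 n y) * (fine (Ps (y k.+1) C) *
    \prod_(t <- r) fine (\int[Ps (y t)]_x (g t x)%:E)%E)%:E)%E; last first.
    rewrite -[in LHS](fineK fP) -EFinM /c.
    have fC : Ps (y k.+1) C \is a fin_num by exact: fin_num_measure.
    by rewrite -{2}(fineK fC) -EFinM; congr EFin; ring.
  rewrite -hC integral_mkcond; apply: eq_integral => w _.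
  rewrite patchE /rest prodE.
  rewrite (rE C (fun t F => F (Xt t w))) {1}/gC eqxx (indicE _ C).
  rewrite -[w \in _]/(Xt k.+1 w \in C).
  by case: (Xt k.+1 w \in C) => /=; rewrite ?mulr1n ?mulr0n ?mul1r ?mul0r ?mulr0.
rewrite ge0_integral_mscale//; last 2 first.
- by apply/measurable_EFinP.
- by move=> x _; rewrite lee_fin; have /andP[] := g01 k.+1 x.
have fg := integral_emission_fin (y k.+1) (mg k.+1) (g01 k.+1).
rewrite /= -(fineK fg) prodE -(fineK fP) -!EFinM /c /=; congr EFin; ring.
Qed.

End HiddenMarkov.

Lemma integral_pushforward_real d d' (T : measurableType d) (U : measurableType d')
    (R : realType) (P : {measure set T -> \bar R}) (th : {mfun T >-> U})
    (g : U -> R) (B : set U) : measurable B -> measurable_fun [set: U] g ->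
  (\int[pushforward P th]_(x in B) (g x)%:E =
   \int[P]_(w in th @^-1` B) (g (th w))%:E)%E.
Proof.
move=> mB mg; have mG : measurable_fun B (EFin \o g).
  exact/measurable_funTS/measurable_EFinP.
rewrite [LHS]integralE [RHS]integralE; congr (_ - _)%E.
  rewrite [LHS]ge0_integral_pushforward//; last exact: measurable_funepos.
  by apply: eq_integral => w _; rewrite /= !funeposE.
rewrite [LHS]ge0_integral_pushforward//; last exact: measurable_funeneg.
by apply: eq_integral => w _; rewrite /= !funenegE.
Qed.

(** * Bayes' formula for path and state posteriors *)

Section Posterior.
Context {d d' : measure_display} {Omega : measurableType d}
  {X : measurableType d'} {R : realType} {K : nat}.
Variable (P : probability Omega R).
Variables (Xt : nat -> {RV P >-> X}) (Yt : nat -> {RV P >-> 'I_K.+1}).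

Lemma measurable_obs n : measurable_fun [set: Omega] (obs Xt n).
Proof.
apply/measurable_fun_tnthP => i; rewrite (_ : _ \o _ = Xt i.+1).
  exact: measurable_funPT.
by apply/funext => w; rewrite /= tnth_mktuple.
Qed.

(** The versions are compared as densities under the law of [X^n]; the bounds on [g2] provide
    integrability. *)
Lemma cond_prob_obs_unique n A (g1 g2 : n.-tuple X -> R) :
  cond_prob_obs Xt A g1 -> cond_prob_obs Xt A g2 -> (forall x, 0 <= g2 x <= 1) ->
  {ae P, forall w, g1 (obs Xt n w) = g2 (obs Xt n w)}.
Proof.
move=> [mg1 h1] [mg2 h2] g01.
pose mix := isMeasurableFun.Build _ _ _ _ _ (@measurable_obs n).
pose th : {mfun Omega >-> n.-tuple X} := HB.pack (obs Xt n) mix.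
pose m := distribution P th.
have mT : (m setT < +oo)%E.
  by rewrite [X in (X < _)%E]probability_setT ltry.
have : ae_eq m setT (EFin \o g2) (EFin \o g1).
  apply: integral_ae_eq => //.
  - apply: measurable_bounded_integrable => //.
    exists 1; split => // M M1 x _; have /andP[a b] := g01 x.
    by rewrite /= ger0_norm// (le_trans b)// ltW.
  - exact/measurable_EFinP.
  - move=> B _ mB.
    have mE (g : n.-tuple X -> R) : measurable_fun setT g ->
        (\int[m]_(x in B) (g x)%:E =
         \int[P]_(w in th @^-1` B) (g (th w))%:E)%E.
      exact: integral_pushforward_real.
    by rewrite [LHS]mE// [RHS]mE// -h1// -h2.
move=> [N [mN mN0 NE]]; exists (obs Xt n @^-1` N); split => //.
  by rewrite -[X in measurable X]setTI; exact: measurable_obs.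
move=> w /= ne; apply: NE => /= h; apply: ne.
by have [] := h Logic.I.
Qed.

Variables (mu : {measure set X -> \bar R}) (p : 'M[R]_K.+1).
Variables (Ps : 'I_K.+1 -> probability X R) (f : 'I_K.+1 -> X -> R).
Hypothesis hmm : ergodic_hmm Xt Yt mu p Ps f.

Definition state_event n (s : n.-tuple 'I_K.+1) : set Omega :=
  [set w | forall i : 'I_n, Yt i.+1 w = tnth s i].

Definition state_path n (s : n.-tuple 'I_K.+1) (t : nat) : 'I_K.+1 :=
  nth ord0 s t.-1.

Lemma state_eventE n (s : n.-tuple 'I_K.+1) :
  state_event s = path_event Yt 0 n (state_path s).
Proof.
apply/seteqP; split => w h.
  move=> t /andP[t1 tn]; have tn' : (t.-1 < n)%N by lia.
  have := h (Ordinal tn'); rewrite /= prednK// => ->.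
  by rewrite (tnth_nth ord0).
by move=> i; rewrite (h i.+1)//= (tnth_nth ord0).
Qed.

Lemma measurable_state_event n (s : n.-tuple 'I_K.+1) :
  measurable (state_event s).
Proof. by rewrite state_eventE; exact: measurable_path_event. Qed.

Definition prior n (s : n.-tuple 'I_K.+1) : R := fine (P (state_event s)).

Lemma prior_ge0 n (s : n.-tuple 'I_K.+1) : 0 <= prior s.
Proof. exact: fine_ge0. Qed.

Lemma prior_le1 n (s : n.-tuple 'I_K.+1) : prior s <= 1.
Proof.
rewrite -lee_fin fineK; first exact/probability_le1/measurable_state_event.
exact/fin_num_measure/measurable_state_event.
Qed.

Definition joint n (s : n.-tuple 'I_K.+1) (x : n.-tuple X) : R :=
  prior s * \prod_(i < n) emis f (tnth s i) (tnth x i).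

Definition evidence n (x : n.-tuple X) : R :=
  \sum_(s : n.-tuple 'I_K.+1) joint s x.

Lemma joint_ge0 n (s : n.-tuple 'I_K.+1) x : 0 <= joint s x.
Proof.
by rewrite mulr_ge0 ?prior_ge0// prodr_ge0// => i _; exact: (emis_ge0 hmm).
Qed.

Lemma joint_le1 n (s : n.-tuple 'I_K.+1) x : joint s x <= 1.
Proof.
rewrite mulr_ile1 ?prior_ge0 ?prior_le1//.
  by rewrite prodr_ge0// => i _; exact: (emis_ge0 hmm).
apply: prodr_ile1 => i _; by rewrite (emis_ge0 hmm) (emis_le1 hmm).
Qed.

Lemma measurable_joint n (s : n.-tuple 'I_K.+1) :
  measurable_fun [set: n.-tuple X] (joint s).
Proof.
apply: measurable_funM => //; apply: measurable_prod => i _.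
exact: (measurableT_comp (measurable_emis hmm _) (measurable_tnth i)).
Qed.

Lemma evidence_ge0 n (x : n.-tuple X) : 0 <= evidence x.
Proof. by apply: sumr_ge0 => s _; exact: joint_ge0. Qed.

Lemma joint_le_evidence n (s : n.-tuple 'I_K.+1) x : joint s x <= evidence x.
Proof.
by rewrite /evidence (bigD1 s)//= lerDl sumr_ge0// => ? _; exact: joint_ge0.
Qed.

Lemma measurable_evidence n : measurable_fun [set: n.-tuple X] (@evidence n).
Proof. by apply: measurable_sum => s; exact: measurable_joint. Qed.

Lemma joint_obs n (s : n.-tuple 'I_K.+1) w :
  joint s (obs Xt n w) =
  prior s * \prod_(1 <= t < n.+1) emis f (state_path s t) (Xt t w).
Proof.
congr (_ * _); rewrite big_add1 big_mkord; apply: eq_bigr => i _.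
by rewrite tnth_mktuple (tnth_nth ord0).
Qed.

(** Paths of prior zero are almost surely not taken, and an observation emitted in state [s] almost
    surely has positive [emis s]. Hence the evidence is almost surely positive and may be divided
    by. *)
Lemma joint_gt0_as n : {ae P, forall w, forall s : n.-tuple 'I_K.+1,
  state_event s w -> 0 < joint s (obs Xt n w)}.
Proof.
apply: filter_forall => s.
have [p0|p0] := eqVneq (P (state_event s)) 0%E.
  exists (state_event s); split => //; first exact: measurable_state_event.
  by move=> w /= h; apply: contrapT => nS; apply: h.
have pr0 : 0 < prior s.
  rewrite lt_neqAle prior_ge0 andbT eq_sym; apply: contraNneq p0 => h.
  rewrite -[P _]fineK ?fin_num_measure//; last exact: measurable_state_event.
  by rewrite -/(prior s) h.
have aei : {ae P, forall w, forall i : 'I_n, state_event s w ->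
    emis f (tnth s i) (Xt i.+1 w) != 0}.
  apply: filter_forall => i.
  pose B t := if t == i.+1 then [set x | emis f (tnth s i) x = 0] else setT.
  have mB t : measurable (B t).
    rewrite /B; case: ifP => // _; rewrite -[X in measurable X]setTI.
    exact: (measurable_emis hmm _ measurableT (measurable_set1 (0 : R))).
  exists (state_event s `&` [set w | forall t, (1 <= t <= n)%N -> B t (Xt t w)]).
  split.
  - apply: measurableI; first exact: measurable_state_event.
    have -> : [set w | forall t, (1 <= t <= n)%N -> B t (Xt t w)] =
        \bigcap_(t in [set t | (1 <= t <= n)%N]) (Xt t @^-1` (B t)).
      by apply/seteqP; split.
    apply: bigcap_measurableType => t _.
    by rewrite -[X in measurable X]setTI; exact: (measurable_funPT (Xt _)).
  - have [_ _ ci _] := hmm; rewrite state_eventE; apply: etrans (ci n _ B mB) _.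
    have ii : i.+1 \in index_iota 1 n.+1 by rewrite mem_index_iota/= ltnS ltn_ord.
    rewrite (bigD1_seq i.+1 ii)/= ?iota_uniq//.
    rewrite {1}/B eqxx /state_path/= -(tnth_nth ord0).
    have -> : Ps (tnth s i) [set x | emis f (tnth s i) x = 0] = 0%E.
      exact: (emis_gt0_as hmm).
    by rewrite mul0r mule0.
  - move=> w /= /not_implyP[sw /negP/negPn/eqP e0]; split => // t tn.
    by rewrite /B; case: eqP => // ->.
move: aei; apply: filterS => w h sw; rewrite /joint mulr_gt0//.
apply: prodr_gt0 => i _; rewrite tnth_mktuple.
by rewrite lt_neqAle eq_sym h// (emis_ge0 hmm).
Qed.

Lemma state_event_exists n w : exists s : n.-tuple 'I_K.+1, state_event s w.
Proof.
exists [tuple Yt i.+1 w | i < n] => i; by rewrite tnth_mktuple.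
Qed.

Lemma evidence_gt0_as n : {ae P, forall w, 0 < evidence (obs Xt n w)}.
Proof.
move: (joint_gt0_as n); apply: filterS => w h.
have [s sw] := state_event_exists n w.
exact: lt_le_trans (h s sw) (joint_le_evidence _ _).
Qed.

Let box_time n (B : 'I_n -> set X) (t : nat) : set X :=
  if insub t.-1 is Some i then B i else setT.

Let box_indic n (B : 'I_n -> set X) w :
  \1_(obs Xt n @^-1` box B) w =
  \prod_(1 <= t < n.+1) \1_(box_time B t) (Xt t w) :> R.
Proof.
rewrite big_add1 big_mkord.
have btE (i : 'I_n) : box_time B i.+1 = B i by rewrite /box_time/= valK.
have [h|h] := pselect (forall i, B i (Xt i.+1 w)).
  rewrite indicE mem_set => [|i]; last by rewrite tnth_mktuple; exact: h.
  by rewrite big1// => i _; rewrite btE indicE mem_set.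
rewrite indicE memNset; last first.
  by move=> h'; apply: h => i; have := h' i; rewrite tnth_mktuple.
have [i Bi] : exists i, ~ B i (Xt i.+1 w).
  by apply: contrapT => h'; apply: h => i; apply: contrapT => Bi; apply: h'; exists i.
by rewrite (bigD1 i)//= btE indicE memNset// mul0r.
Qed.

(* The law of X^n given Y^n = s has density joint s with respect to a measure that
   does not depend on s, so it suffices to exchange the roles of s and s'. *)
Let joint_exchange n (s s' : n.-tuple 'I_K.+1) (B : 'I_n -> set X) :
  (forall i, measurable (B i)) ->
  (\int[P]_(w in obs Xt n @^-1` box B) (\1_(state_event s) w * joint s' (obs Xt n w))%:E
   = \int[P]_(w in obs Xt n @^-1` box B)
       (\1_(state_event s') w * joint s (obs Xt n w))%:E)%E.
Proof.
move=> mB.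
have mBt t : measurable (box_time B t).
  by rewrite /box_time; case: insub.
have fP (u : n.-tuple 'I_K.+1) : P (state_event u) \is a fin_num.
  by rewrite fin_num_measure//; exact: measurable_state_event.
pose h (u : n.-tuple 'I_K.+1) t x : R :=
  emis f (state_path u t) x * \1_(box_time B t) x.
have mh u t : measurable_fun [set: X] (h u t).
  apply: measurable_funM; first exact: (measurable_emis hmm).
  exact: measurable_indic.
have h01 u t x : 0 <= h u t x <= 1.
  have i1 : \1_(box_time B t) x <= 1 :> R by rewrite indicE lern1 leq_b1.
  by rewrite mulr_ge0 ?(emis_ge0 hmm)//= mulr_ile1 ?(emis_ge0 hmm) ?(emis_le1 hmm).
have E (u u' : n.-tuple 'I_K.+1) :
    (\int[P]_(w in obs Xt n @^-1` box B)
       (\1_(state_event u) w * joint u' (obs Xt n w))%:E =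
     (prior u * prior u' * \prod_(1 <= t < n.+1)
        fine (\int[Ps (state_path u t)]_x (h u' t x)%:E))%:E)%E.
  have -> : (prior u * prior u' * \prod_(1 <= t < n.+1)
        fine (\int[Ps (state_path u t)]_x (h u' t x)%:E)%E)%:E =
      ((prior u')%:E * (P (state_event u) * (\prod_(1 <= t < n.+1)
        fine (\int[Ps (state_path u t)]_x (h u' t x)%:E)%E)%:E))%E.
    rewrite -[X in (_ * (X * _))%E](fineK (fP u)) -!EFinM; congr EFin.
    by rewrite /prior; ring.
  rewrite state_eventE -(emission_product hmm n (state_path u) (mh u') (h01 u')).
  rewrite -ge0_integralZl//; last 3 first.
  - apply/measurable_EFinP/measurable_funM.
      exact/measurable_indic/measurable_path_event.
    apply: measurable_prod => t _; apply: (measurableT_comp (mh u' t)).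
    exact: measurable_funPT.
  - move=> w _; rewrite lee_fin mulr_ge0// prodr_ge0// => t _.
    by have /andP[] := h01 u' t (Xt t w).
  - by rewrite lee_fin prior_ge0.
  rewrite [LHS]integral_mkcond; apply: eq_integral => w _.
  rewrite patchE joint_obs /h [in RHS]big_split/= -box_indic.
  rewrite -[w \in obs _ _ @^-1` _]/(w \in obs Xt n @^-1` box B).
  rewrite (indicE _ (obs Xt n @^-1` box B)).
  case: (w \in obs Xt n @^-1` box B); rewrite -EFinM ?mulr0 ?mulr1//.
  by congr EFin; ring.
rewrite !E; congr EFin; rewrite [prior s * _]mulrC; congr (_ * _).
apply: eq_bigr => t _; congr fine; rewrite /h.
exact: (emis_sym hmm).
Qed.

Lemma state_event_partition n w :
  \sum_(s : n.-tuple 'I_K.+1) \1_(state_event s) w = 1 :> R.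
Proof.
have [s sw] := state_event_exists n w.
rewrite (bigD1 s)//= indicE mem_set// big1 ?addr0// => u us.
rewrite indicE memNset// => uw; case/eqP: us.
by apply: eq_from_tnth => i; rewrite -uw -sw.
Qed.

(** Summing the exchange of [s] and [u] over all [u], where the events [Y^n = u] partition the
    space, shows that the indicator of [Y^n = s] times the evidence integrates over preimages of
    boxes like [joint s]. The weight [1 / evidence] is then inserted by [eq_integral_boxes]. *)
Lemma path_posterior_formula n (s : n.-tuple 'I_K.+1) :
  cond_prob_obs Xt (state_event s) (fun x => joint s x / evidence x).
Proof.
have mev : measurable_fun [set: n.-tuple X] (fun x => (evidence x)^-1).
  have -> : (fun x : n.-tuple X => (evidence x)^-1) = (fun x => (evidence x) `^ (-1)).
    by apply/funext => x; rewrite powR_inv1// evidence_ge0.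
  exact: (measurableT_comp (measurable_powR (-1)) (@measurable_evidence n)).
have mobs := @measurable_obs n.
split; first by apply: measurable_funM => //; exact: measurable_joint.
move=> B mB.
pose g1 w := \1_(state_event s) w * evidence (obs Xt n w).
pose g2 w := joint s (obs Xt n w).
have ms : measurable_fun [set: Omega] (\1_(state_event s) : Omega -> R).
  exact/measurable_indic/measurable_state_event.
have mg1 : measurable_fun [set: Omega] g1.
  by apply: measurable_funM => //; exact: (measurableT_comp (@measurable_evidence n) mobs).
have mg2 : measurable_fun [set: Omega] g2.
  exact: (measurableT_comp (@measurable_joint n s) mobs).
have g10 w : 0 <= g1 w by rewrite mulr_ge0// evidence_ge0.
have g20 w : 0 <= g2 w by exact: joint_ge0.
have boxE (C : 'I_n -> set X) : (forall i, measurable (C i)) ->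
    (\int[P]_(w in obs Xt n @^-1` box C) (g1 w)%:E =
     \int[P]_(w in obs Xt n @^-1` box C) (g2 w)%:E)%E.
  move=> mC; have mbC : measurable (obs Xt n @^-1` box C).
    by rewrite -[X in measurable X]setTI; apply: mobs => //; exact: measurable_box.
  transitivity (\sum_(u : n.-tuple 'I_K.+1) \int[P]_(w in obs Xt n @^-1` box C)
      (\1_(state_event s) w * joint u (obs Xt n w))%:E)%E.
    rewrite -ge0_integral_sum//; last 2 first.
    - move=> u; apply/measurable_EFinP/measurable_funTS/measurable_funM => //.
      exact: (measurableT_comp (@measurable_joint n u) mobs).
    - by move=> u w _; rewrite lee_fin mulr_ge0// joint_ge0.
    apply: eq_integral => w _; rewrite sumEFin; congr EFin.
    by rewrite /g1 /evidence mulr_sumr.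
  under eq_bigr do rewrite joint_exchange//.
  rewrite -ge0_integral_sum//; last 2 first.
  - move=> u; apply/measurable_EFinP/measurable_funTS/measurable_funM => //.
    exact/measurable_indic/measurable_state_event.
  - by move=> u w _; rewrite lee_fin mulr_ge0// joint_ge0.
  apply: eq_integral => w _; rewrite sumEFin; congr EFin.
  by rewrite -mulr_suml state_event_partition mul1r.
have g1fin : (\int[P]_w (g1 w)%:E < +oo)%E.
  have fT : box (fun=> setT) = setT :> set (n.-tuple X) by apply/seteqP; split.
  have := boxE (fun=> setT) (fun=> measurableT); rewrite fT preimage_setT => ->.
  apply: (@le_lt_trans _ _ (\int[P]_w cst 1%:E w)%E).
    apply: ge0_le_integral => //.
    - by move=> w _; rewrite lee_fin.
    - exact/measurable_EFinP.
    - by move=> w _; rewrite lee_fin joint_le1.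
  by rewrite integral_cst// [X in (_ * X)%E]probability_setT mul1e ltry.
pose hB x : \bar R := (\1_B x * (evidence x)^-1)%:E.
have mhB : measurable_fun [set: n.-tuple X] hB.
  by apply/measurable_EFinP/measurable_funM => //; exact: measurable_indic.
have hB0 x : (0 <= hB x)%E by rewrite lee_fin mulr_ge0// invr_ge0 evidence_ge0.
have := eq_integral_boxes mobs mg1 mg2 g10 g20 g1fin boxE mhB hB0.
have mBo : measurable (obs Xt n @^-1` B).
  by rewrite -[X in measurable X]setTI; exact: mobs.
have -> : (\int[P]_w (hB (obs Xt n w) * (g2 w)%:E) =
    \int[P]_(w in obs Xt n @^-1` B) (joint s (obs Xt n w) / evidence (obs Xt n w))%:E)%E.
  rewrite [RHS]integral_mkcond; apply: eq_integral => w _.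
  rewrite patchE /hB -EFinM /g2 indicE.
  rewrite -[w \in obs _ _ @^-1` _]/(obs Xt n w \in B).
  by case: (obs Xt n w \in B); rewrite ?mul0r// mul1r mulrC.
move=> <-.
have mA : measurable (state_event s `&` obs Xt n @^-1` B).
  by apply: measurableI => //; exact: measurable_state_event.
rewrite -[X in P X]setIT -integral_indic//.
apply: ge0_ae_eq_integral => //.
- exact/measurable_EFinP/measurable_indic.
- apply: emeasurable_funM; first exact: (measurableT_comp mhB mobs).
  exact/measurable_EFinP.
- by move=> w _; rewrite mule_ge0// lee_fin.
move: (evidence_gt0_as n); apply: filterS => w ev0 _.
rewrite /hB /g1 -EFinM indicI/=; congr EFin.
rewrite -[\1_(obs Xt n @^-1` B) w]/(\1_B (obs Xt n w) : R).
by field; rewrite gt_eqF.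
Qed.

Lemma posterior_bounds n (s : n.-tuple 'I_K.+1) x : 0 <= joint s x / evidence x <= 1.
Proof.
rewrite divr_ge0 ?joint_ge0 ?evidence_ge0//=.
have [->|e0] := eqVneq (evidence x) 0; first by rewrite invr0 mulr0.
have e1 : 0 < evidence x by rewrite lt_neqAle eq_sym e0 evidence_ge0.
by rewrite ler_pdivrMr// mul1r joint_le_evidence.
Qed.

Lemma state_posterior_formula n (i : 'I_n) a :
  cond_prob_obs Xt [set w | Yt i.+1 w = a]
    (fun x => (\sum_(s : n.-tuple 'I_K.+1 | tnth s i == a) joint s x) / evidence x).
Proof.
pose r := [seq s <- index_enum _ | tnth s i == a] : seq (n.-tuple 'I_K.+1).
have E x : (\sum_(s : n.-tuple 'I_K.+1 | tnth s i == a) joint s x) / evidence x =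
    \sum_(s <- r) (joint s x / evidence x).
  by rewrite mulr_suml -big_filter.
split.
  rewrite (_ : (fun x => _) = fun x => \sum_(s <- r) (joint s x / evidence x)).
    apply: measurable_sum => s; exact: (path_posterior_formula s).1.
  exact/funext.
move=> B mB.
have mBo : measurable (obs Xt n @^-1` B).
  by rewrite -[X in measurable X]setTI; exact: measurable_obs.
have mYa : measurable [set w | Yt i.+1 w = a].
  rewrite -[X in measurable X]/(Yt i.+1 @^-1` [set a]).
  rewrite -[X in measurable X]setTI; exact: (measurable_funPT (Yt _)).
rewrite -[LHS]integral_indic//.
transitivity (\int[P]_(w in obs Xt n @^-1` B)
     \sum_(s <- r) (\1_(state_event s) w)%:E)%E.
  apply: eq_integral => w _; rewrite sumEFin; congr EFin; rewrite big_filter.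
  have [s sw] := state_event_exists n w.
  rewrite indicE; case: (boolP (tnth s i == a)) => sa.
    rewrite mem_set; last by rewrite /= sw; exact/eqP.
    rewrite (bigD1 s)//= indicE mem_set// big1 ?addr0// => u /andP[_ us].
    rewrite indicE memNset// => uw; case/eqP: us.
    by apply: eq_from_tnth => j; rewrite -uw -sw.
  rewrite memNset; last by move=> /= ya; move: sa; rewrite -sw ya eqxx.
  rewrite big1// => u ua; rewrite indicE memNset// => uw.
  by move: sa; rewrite -sw uw ua.
have ms (s : n.-tuple 'I_K.+1) : measurable (state_event s).
  exact: measurable_state_event.
rewrite ge0_integral_sum//; last first.
  by move=> s; apply/measurable_EFinP/measurable_funTS/measurable_indic.
have mj (s : n.-tuple 'I_K.+1) : measurable_fun (obs Xt n @^-1` B)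
    (fun w => (joint s (obs Xt n w) / evidence (obs Xt n w))%:E).
  apply/measurable_funTS/measurable_EFinP.
  exact: (measurableT_comp (path_posterior_formula s).1 (@measurable_obs n)).
transitivity (\sum_(s <- r)
   \int[P]_(w in obs Xt n @^-1` B) (joint s (obs Xt n w) / evidence (obs Xt n w))%:E)%E.
  apply: eq_bigr => s _; rewrite integral_indic//.
  exact: (path_posterior_formula s).2.
rewrite -ge0_integral_sum//; last first.
  by move=> s w _; rewrite lee_fin; have /andP[] := posterior_bounds s (obs Xt n w).
by apply: eq_integral => w _; rewrite E sumEFin.
Qed.

(** For each [n] only finitely many versions occur, so one null set serves all [n], paths and
    states. *)
Lemma posteriors_as
    (q : forall n, n.-tuple 'I_K.+1 -> n.-tuple X -> R)
    (pt : forall n, 'I_n -> 'I_K.+1 -> n.-tuple X -> R) :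
  path_posterior Xt Yt q -> state_posterior Xt Yt pt ->
  {ae P, forall w, forall n, [/\ 0 < evidence (obs Xt n w),
    forall s, q n s (obs Xt n w) = joint s (obs Xt n w) / evidence (obs Xt n w) &
    forall i a, pt n i a (obs Xt n w) =
      (\sum_(s : n.-tuple 'I_K.+1 | tnth s i == a) joint s (obs Xt n w)) /
      evidence (obs Xt n w)]}.
Proof.
move=> hq hpt; apply/ae_foralln => n.
have h1 : {ae P, forall w, forall s : n.-tuple 'I_K.+1,
    q n s (obs Xt n w) = joint s (obs Xt n w) / evidence (obs Xt n w)}.
  apply: filter_forall => s.
  apply: (cond_prob_obs_unique (hq n s) (path_posterior_formula s)).
  exact: posterior_bounds.
have h2 : {ae P, forall w, forall i a, pt n i a (obs Xt n w) =
      (\sum_(s : n.-tuple 'I_K.+1 | tnth s i == a) joint s (obs Xt n w)) /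
      evidence (obs Xt n w)}.
  apply: filter_forall => i; apply: filter_forall => a.
  apply: (cond_prob_obs_unique (hpt n i a) (state_posterior_formula i a)) => x.
  rewrite divr_ge0 ?evidence_ge0//=; last by apply: sumr_ge0 => s _; exact: joint_ge0.
  have [->|e0] := eqVneq (evidence x) 0; first by rewrite invr0 mulr0.
  have e1 : 0 < evidence x by rewrite lt_neqAle eq_sym e0 evidence_ge0.
  rewrite ler_pdivrMr// mul1r /evidence [leRHS](bigID (fun s => tnth s i == a))/=.
  by rewrite lerDl sumr_ge0// => s _; exact: joint_ge0.
by move: (evidence_gt0_as n) h1 h2; apply: filterS3.
Qed.

End Posterior.

(** * Sums over paths as entries of matrix products *)

Section PathSums.
Context {R : realType} {K : nat}.
Notation mat := 'M[R]_K.+1.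

(** The default [j] of [nth] is the state at time [n + 1], so [nth j (i :: s)] is the path from [i]
    through [s] to [j]. *)
Lemma sum_pathw n (A : nat -> mat) i j :
  \sum_(s : n.-tuple 'I_K.+1) pathw A (nth j (i :: s)) 0 n.+1 =
  mprod A 0 n.+1 i j.
Proof.
elim: n A i => [|n IH] A i.
  rewrite (big_pred1 [tuple]) => [|s]; last by apply/esym/eqP; exact: tuple0.
  by rewrite /pathw /mprod !big_nat1.
have -> : \sum_(s : n.+1.-tuple 'I_K.+1) pathw A (nth j (i :: s)) 0 n.+2 =
    \sum_k \sum_(s : n.-tuple 'I_K.+1) pathw A (nth j [:: i, k & s]) 0 n.+2.
  rewrite pair_big/=.
  rewrite (reindex (fun u : 'I_K.+1 * n.-tuple 'I_K.+1 => cons_tuple u.1 u.2))//=.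
  exists (fun s => (thead s, behead_tuple s)) => [[k s] _|s _] /=.
    by rewrite theadE; congr (_, _); exact: val_inj.
  by apply: val_inj => /=; rewrite [in RHS](tuple_eta s).
rewrite /mprod big_nat_recl//= -mulmxE mxE; apply: eq_bigr => k _.
have -> : \prod_(0 <= t < n.+1) A t.+1 = mprod (fun t => A t.+1) 0 n.+1 by [].
rewrite -IH mulr_sumr; apply: eq_bigr => s _.
by rewrite /pathw big_nat_recl//=.
Qed.

(** Forcing the state [a] at time [m + 1] amounts to erasing all other columns of the factor [A m],
    which reduces the claim to a sum over all paths. *)
Lemma sum_pathw_through n (A : nat -> mat) i j (m : 'I_n) a :
  \sum_(s : n.-tuple 'I_K.+1 | tnth s m == a) pathw A (nth j (i :: s)) 0 n.+1 =
  mprod A 0 m.+1 i a * mprod A m.+1 n.+1 a j.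
Proof.
pose A' (t : nat) : mat := if t == m :> nat then \matrix_(k, l) (A t k l * (l == a)%:R) else A t.
have mn : (m.+1 <= n.+1)%N by rewrite ltnS ltnW.
have -> : mprod A 0 m.+1 i a * mprod A m.+1 n.+1 a j = mprod A' 0 n.+1 i j.
  rewrite (@mprod_cat _ _ A' m.+1)//.
  have -> : mprod A' m.+1 n.+1 = mprod A m.+1 n.+1.
    by apply: eq_big_nat => t /andP[mt _]; rewrite /A' gtn_eqF.
  rewrite -mulmxE mxE (bigD1 a)//= !mprodS//.
  have -> : mprod A' 0 m = mprod A 0 m.
    by apply: eq_big_nat => t /andP[_ mt]; rewrite /A' ltn_eqF.
  rewrite /A' eqxx big1 ?addr0 => [|l la].
    congr (_ * _); rewrite -!mulmxE !mxE; apply: eq_bigr => k _.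
    by rewrite mxE eqxx mulr1.
  rewrite -!mulmxE !mxE big1 ?mul0r// => k _.
  by rewrite mxE (negbTE la) !mulr0.
rewrite -sum_pathw big_mkcond/=; apply: eq_bigr => s _.
have -> : pathw A' (nth j (i :: s)) 0 n.+1 =
    pathw A (nth j (i :: s)) 0 n.+1 * (tnth s m == a)%:R.
  have mi : (m : nat) \in index_iota 0 n.+1.
    by rewrite mem_index_iota leq0n ltnS ltnW.
  rewrite /pathw (bigD1_seq _ mi) ?iota_uniq// [in RHS](bigD1_seq _ mi) ?iota_uniq//=.
  rewrite {1}/A' eqxx mxE (tnth_nth j) -!mulrA; congr (_ * _); rewrite mulrC.
  congr (_ * _); apply: eq_bigr => t tm.
  by rewrite /A' (negbTE tm).
by case: eqP; rewrite ?mulr1 ?mulr0.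
Qed.

End PathSums.

(** * Transfer matrices of the model and their anchors *)

Section HmmMatrices.
Context {d d' : measure_display} {Omega : measurableType d}
  {X : measurableType d'} {R : realType} {K : nat}.
Variable (P : probability Omega R).
Variables (Xt : nat -> {RV P >-> X}) (Yt : nat -> {RV P >-> 'I_K.+1}).
Variables (mu : {measure set X -> \bar R}) (p : 'M[R]_K.+1).
Variables (Ps : 'I_K.+1 -> probability X R) (f : 'I_K.+1 -> X -> R).
Hypothesis hmm : ergodic_hmm Xt Yt mu p Ps f.

Definition hmat (x : nat -> X) (t : nat) : 'M[R]_K.+1 :=
  \matrix_(i, j) (p i j * emis f j (x t.+1)).

Definition initial (j : 'I_K.+1) : R := fine (P (path_event Yt 0 1 (fun=> j))).

(* The weights of the observations x_1, ..., x_n, completed by two rank-one factors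
   at times 0 and n that play the role of anchors at the boundary. *)
Definition hmat_n (x : nat -> X) (n t : nat) : 'M[R]_K.+1 :=
  if t == 0%N then \matrix_(i, j) (initial j * emis f j (x 1%N))
  else if t == n then const_mx 1 else hmat x t.

Lemma p_ge0 i j : 0 <= p i j.
Proof. by case: hmm => [[[p0 _] _] _ _ _]. Qed.

Lemma p_sum i : \sum_j p i j = 1.
Proof. by case: hmm => [[[_ p1] _] _ _ _]. Qed.

Lemma hmat_ge0 x t : nonneg_mx (hmat x t).
Proof. by move=> i j; rewrite mxE mulr_ge0 ?p_ge0// (emis_ge0 hmm). Qed.

Lemma hmat_n_ge0 x n t : nonneg_mx (hmat_n x n t).
Proof.
move=> i j; rewrite /hmat_n; case: ifP => _.
  by rewrite mxE mulr_ge0 ?fine_ge0// (emis_ge0 hmm).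
by case: ifP => _; [rewrite mxE|exact: hmat_ge0].
Qed.

Lemma path_probE n y : (0 < n)%N ->
  fine (P (path_event Yt 0 n y)) =
  initial (y 1%N) * \prod_(1 <= t < n) p (y t) (y t.+1).
Proof.
elim: n => [//|[|n] IH] _.
  rewrite big_geq// mulr1 /initial; congr (fine (P _)).
  apply/seteqP; split => w h t t1.
    by rewrite h//; congr y; lia.
  by rewrite h//; congr y; lia.
have [_ [mk _] _ _] := hmm; rewrite mk// fineM ?fin_num_measure//; last first.
  exact: measurable_path_event.
by rewrite IH// -mulrA [in RHS]big_nat_recr.
Qed.

(** Adds virtual times [0] and [n + 1], both in state [ord0]: the first is the new head, the second
    the default of [nth]. The boundary factors of [hmat_n] do not depend on these states. *)
Definition ext_path n (s : n.-tuple 'I_K.+1) : nat -> 'I_K.+1 :=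
  nth ord0 (ord0 :: s).

Lemma joint_pathw n (s : n.-tuple 'I_K.+1) w : (0 < n)%N ->
  joint Yt f s (obs Xt n w) = pathw (hmat_n (Xt ^~ w) n) (ext_path s) 0 n.+1.
Proof.
move=> n0; rewrite joint_obs /prior state_eventE path_probE//.
rewrite (@pathw_cat _ _ _ 1 _ 0)// (@pathw_cat _ _ _ n _ 1)//.
rewrite /pathw !big_nat1 /hmat_n !eqxx (gtn_eqF n0) !mxE mulr1.
rewrite -[LHS]mulrA -[RHS]mulrA.
rewrite /state_path /ext_path/=; congr (_ * _).
rewrite [X in _ * X = _]big_ltn// mulrCA; congr (_ * _).
rewrite [X in _ * X = _]big_add1/= -big_split/=.
apply: eq_big_nat => t /andP[t1 tn].
rewrite (gtn_eqF t1) (ltn_eqF tn) mxE.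
by case: t t1 tn.
Qed.

Lemma ext_pathE n (y : nat -> 'I_K.+1) t : y 0%N = ord0 -> y n.+1 = ord0 ->
  (t <= n.+1)%N -> ext_path [tuple y i.+1 | i < n] t = y t.
Proof.
move=> y0 yn; case: t => [//|t] tn.
rewrite -[LHS]/(nth ord0 [tuple y i.+1 | i < n] t).
have [tn'|nt] := ltnP t n.
  have := tnth_mktuple (fun i : 'I_n => y i.+1) (Ordinal tn').
  by rewrite (tnth_nth ord0).
rewrite nth_default; last by rewrite size_tuple.
by have -> : t = n by lia; rewrite yn.
Qed.

Lemma ext_path_last n (s : n.-tuple 'I_K.+1) : ext_path s n.+1 = ord0.
Proof. by rewrite /ext_path/= nth_default// size_tuple. Qed.

Lemma evidence_mprod n w : (0 < n)%N ->
  evidence Yt f (obs Xt n w) = mprod (hmat_n (Xt ^~ w) n) 0 n.+1 ord0 ord0.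
Proof.
move=> n0; rewrite -sum_pathw; apply: eq_bigr => s _; exact: joint_pathw.
Qed.

Lemma joint_through_mprod n w (m : 'I_n) a :
  \sum_(s : n.-tuple 'I_K.+1 | tnth s m == a) joint Yt f s (obs Xt n w) =
  mprod (hmat_n (Xt ^~ w) n) 0 m.+1 ord0 a *
  mprod (hmat_n (Xt ^~ w) n) m.+1 n.+1 a ord0.
Proof.
rewrite -sum_pathw_through; apply: eq_bigr => s _; apply: joint_pathw.
exact: leq_trans (ltn_ord m).
Qed.

Lemma optimal_pathw n (v : n.-tuple 'I_K.+1) w : (0 < n)%N ->
  (forall s, joint Yt f s (obs Xt n w) <= joint Yt f v (obs Xt n w)) ->
  forall y, y 0%N = ext_path v 0 -> y n.+1 = ext_path v n.+1 ->
  pathw (hmat_n (Xt ^~ w) n) y 0 n.+1 <=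
  pathw (hmat_n (Xt ^~ w) n) (ext_path v) 0 n.+1.
Proof.
move=> n0 vopt y y0 yn; rewrite ext_path_last in yn.
rewrite -joint_pathw//; apply: le_trans (vopt [tuple y i.+1 | i < n]).
rewrite joint_pathw// le_eqVlt; apply/orP; left; apply/eqP.
by apply: eq_pathw => t /andP[_ tn]; rewrite ext_pathE.
Qed.

Lemma hmat_n_inner x n t : (0 < t)%N -> (t < n)%N -> hmat_n x n t = hmat x t.
Proof. by move=> t0 tn; rewrite /hmat_n gtn_eqF// ltn_eqF. Qed.

Lemma mprod_hmat_n x n s t : (0 < s)%N -> (t <= n)%N ->
  mprod (hmat_n x n) s t = mprod (hmat x) s t.
Proof.
move=> s0 tn; apply: eq_big_nat => u /andP[su ut].
by rewrite hmat_n_inner//; [exact: leq_trans su|exact: leq_trans tn].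
Qed.

Lemma anchored_first delta x n : delta <= 1 ->
  anchored delta (mprod (hmat_n x n) 0 1).
Proof.
move=> d1; exists (fun=> 1), (fun j => initial j * emis f j (x 1%N)).
have h j : 0 <= initial j * emis f j (x 1%N).
  by rewrite mulr_ge0 ?fine_ge0// (emis_ge0 hmm).
split => // i j; rewrite /mprod big_nat1 /hmat_n eqxx mxE mul1r lexx andbT.
by rewrite -[leRHS]mul1r ler_wpM2r.
Qed.

Lemma anchored_last delta x n : (0 < n)%N -> delta <= 1 ->
  anchored delta (mprod (hmat_n x n) n n.+1).
Proof.
move=> n0 d1; exists (fun=> 1), (fun=> 1); split => // i j.
by rewrite /mprod big_nat1 /hmat_n gtn_eqF// eqxx mxE !mulr1 d1 lexx.
Qed.

Variables (C : {set 'I_K.+1}) (r : nat) (Xo : set X).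
Hypothesis hA1 : A1 p Ps f C r.
Hypothesis hXo : observation_set mu f C Xo.

(** For empty [C] the intersection of the sets [Gset f s] is the whole space, of probability one,
    against the condition on states outside of [C]. *)
Lemma cluster_nonempty : exists k, k \in C.
Proof.
have [[_ cl] _ _] := hA1; apply: contrapT => nC.
have C0 j : j \notin C by apply/negP => jC; apply: nC; exists j.
have := cl ord0 (C0 ord0).
rewrite (_ : \bigcap_(s in [set` C]) _ = setT); last first.
  apply/seteqP; split => // x _ s /= sC; by have := C0 s; rewrite sC.
by rewrite probability_setT => /eqP; rewrite onee_eq0.
Qed.

(** Keeping the full index set allows powers of the cluster block to be compared entrywise with
    products of [hmat]. *)
Definition masked : 'M[R]_K.+1 :=
  \matrix_(i, j) (if (i \in C) && (j \in C) then p i j else 0).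

Lemma masked_ge0 : nonneg_mx masked.
Proof. by move=> i j; rewrite mxE; case: ifP => // _; exact: p_ge0. Qed.

Lemma masked_pow m (i j : 'I_#|C|) :
  (masked ^+ m) (enum_val i) (enum_val j) = (submatrix p C ^+ m) i j.
Proof.
elim: m i j => [|m IH] i j.
  by rewrite !expr0 !mxE (inj_eq enum_val_inj).
rewrite !exprSr -mulmxE !mxE.
rewrite (bigID (fun k => k \in C))/= [X in _ + X]big1 ?addr0; last first.
  by move=> k kC; rewrite [masked k _]mxE (negbTE kC) mulr0.
rewrite big_enum_val/=; apply: eq_bigr => k _; rewrite IH !mxE.
by rewrite !enum_valP.
Qed.

Lemma masked_pow_gt0 : exists rho : R, 0 < rho /\
  forall i j, i \in C -> j \in C -> rho <= (masked ^+ r) i j.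
Proof.
have [c cC] := cluster_nonempty.
have pos i j : i \in C -> j \in C -> 0 < (masked ^+ r) i j.
  move=> iC jC; have [_ _ Rr] := hA1.
  rewrite -(enum_rankK_in iC iC) -(enum_rankK_in iC jC) masked_pow; exact: Rr.
pose Q := [pred ij : 'I_K.+1 * 'I_K.+1 | (ij.1 \in C) && (ij.2 \in C)].
pose F ij := (masked ^+ r) ij.1 ij.2.
have Qc : Q (c, c) by rewrite /= cC.
have [/= ij /andP[iC jC] hmin] := arg_minP F Qc.
exists (F ij); split; first exact: pos.
by move=> i j iC' jC'; apply: (hmin (i, j)); rewrite /= iC' jC'.
Qed.

Lemma emis_obs_lb : exists c : R, 0 < c <= 1 /\ forall x, Xo x ->
  (forall s, s \in C -> c <= emis f s x) /\
  (forall s, s \notin C -> emis f s x = 0).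
Proof.
have [_ _ _ [eps [M [eps0 hx]]]] := hXo.
pose M' := `|M| + 1.
have M'0 : 0 < M' by rewrite ltr_wpDl.
pose c := Num.min 1 (eps / (K.+1%:R * M')).
have c0 : 0 < c by rewrite lt_min ltr01 divr_gt0// mulr_gt0.
exists c; split; first by rewrite c0 ge_min lexx.
move=> x Xox; have [h1 h2] := hx x Xox.
split=> s sC; last by rewrite /emis h2// mul0r.
have /andP[l1 l2] := h1 s sC.
have fM a : f a x <= M'.
  have [aC|aC] := boolP (a \in C).
    have /andP[_ h] := h1 a aC; apply: le_trans (ltW h) _.
    by rewrite /M' (le_trans (ler_norm M))// lerDl.
  by rewrite h2// ltW.
have sumf : \sum_a f a x <= K.+1%:R * M'.
  apply: (@le_trans _ _ (\sum_(a < K.+1) M')); first exact: ler_sum.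
  by rewrite sumr_const card_ord mulr_natl.
have sumf0 : 0 < \sum_a f a x.
  by apply: lt_le_trans (lt_trans eps0 l1) (sum_f_ge hmm s x).
rewrite /c ge_min /emis; apply/orP; right.
rewrite ler_pM ?(ltW eps0) ?invr_ge0 ?(ltW l1) ?mulr_ge0 ?(ltW M'0)//.
by rewrite lef_pV2 ?posrE// mulr_gt0.
Qed.

(** The first observation in [Xo] forces the state into [C]; the mass sent there from [i] is [a i].
    The remaining [r] factors have entries at least [c ^ r * rho] between states of [C] by
    primitivity, at most [1] because rows are substochastic, and zero in the columns outside of [C],
    so [b] is the indicator of [C]. *)
Lemma block_anchored : exists delta : R, 0 < delta <= 1 /\
  forall x s, (forall t, (s < t <= s + r.+1)%N -> Xo (x t)) ->
  anchored delta (mprod (hmat x) s (s + r.+1)).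
Proof.
have [c [/andP[c0 c1] hc]] := emis_obs_lb.
have [rho [rho0 hrho]] := masked_pow_gt0.
have [_ r0 _] := hA1.
pose delta := Num.min 1 (c ^+ r * rho).
have cr0 : 0 < c ^+ r * rho by rewrite mulr_gt0 ?exprn_gt0.
have d0 : 0 < delta by rewrite lt_min ltr01.
exists delta; split; first by rewrite d0 ge_min lexx.
move=> x s hblock.
pose M := mprod (hmat x) s.+1 (s + r.+1).
have emiC t k : (s < t <= s + r.+1)%N -> k \notin C -> emis f k (x t) = 0.
  by move=> ht kC; have [_ h] := hc _ (hblock t ht); exact: h.
have lbM k j : k \in C -> j \in C -> delta <= M k j.
  move=> kC jC.
  suff gen m i : (m <= r)%N -> forall l, c ^+ m * (masked ^+ m) i l <=
      mprod (hmat x) s.+1 (s.+1 + m) i l.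
    have := gen r k (leqnn r) j; rewrite /M addSnnS => h.
    apply: le_trans h; apply: (@le_trans _ _ (c ^+ r * rho)).
      by rewrite /delta ge_min lexx orbT.
    by rewrite ler_wpM2l ?exprn_ge0 ?(ltW c0)// hrho.
  elim: m => [|m IH] mr l.
    by rewrite !expr0 mul1r addn0 mprod0.
  rewrite addnS mprodS ?leq_addr// !exprSr -mulmxE !mxE mulr_sumr.
  apply: ler_sum => a _.
  have hm : 0 <= c ^+ m * (masked ^+ m) i a.
    rewrite mulr_ge0 ?exprn_ge0 ?(ltW c0)//.
    elim: (m) i a {IH mr} => [|m' IH'] i a; first by rewrite expr0 mxE ler0n.
    rewrite exprSr -mulmxE mxE sumr_ge0// => b _.
    by rewrite mulr_ge0// masked_ge0.
  rewrite (_ : c ^+ m * c * _ = (c ^+ m * (masked ^+ m) i a) * (c * masked a l)); last first.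
    by ring.
  apply: ler_pM => //; first by rewrite mulr_ge0 ?(ltW c0)// masked_ge0.
    by apply: IH; exact: ltnW.
  rewrite !mxE; case: ifP => [/andP[aC lC]|_]; last first.
    by rewrite mulr0 mulr_ge0 ?p_ge0// (emis_ge0 hmm).
  rewrite mulrC ler_wpM2l ?p_ge0//.
  have tm : (s < (s.+1 + m).+1 <= s + r.+1)%N.
    by rewrite addSn -2!addnS -{1}[s]addn0 ltn_add2l leq_add2l ltnS.
  by have [h _] := hc _ (hblock _ tm); exact: h.
have M0 : nonneg_mx M by apply: mprod_ge0; exact: hmat_ge0.
have rowM t k : (s.+1 <= t)%N -> \sum_j mprod (hmat x) s.+1 t k j <= 1.
  elim: t => [//|t IH]; rewrite leq_eqVlt => /orP[/eqP <-|st].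
    rewrite mprod0 (bigD1 k)//= mxE eqxx big1 ?addr0// => j jk.
    by rewrite mxE eq_sym (negbTE jk).
  apply: le_trans (IH st).
  rewrite mprodS// -mulmxE.
  under eq_bigr do rewrite mxE.
  rewrite exchange_big/=; apply: ler_sum => l _.
  rewrite -mulr_sumr ler_piMr//.
    by apply: mprod_ge0; exact: hmat_ge0.
  rewrite -(p_sum l); apply: ler_sum => j _; rewrite mxE ler_piMr ?p_ge0//.
  exact: (emis_le1 hmm).
have ubM k j : M k j <= 1.
  have sr : (s.+1 <= s + r.+1)%N by rewrite addnS ltnS leq_addr.
  apply: le_trans (rowM _ k sr).
  by rewrite (bigD1 j)//= lerDl sumr_ge0// => l _; exact: M0.
have M0C k j : j \notin C -> M k j = 0.
  move=> jC; rewrite /M -(prednK r0) !addnS.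
  rewrite mprodS; last by rewrite ltnS leq_addr.
  rewrite -mulmxE mxE big1// => l _.
  by rewrite !mxE emiC ?mulr0//; lia.
have hs k i : k \notin C -> hmat x s i k = 0.
  by move=> kC; rewrite mxE emiC ?mulr0//; lia.
exists (fun i => \sum_(k in C) hmat x s i k), (fun j => (j \in C)%:R).
split=> [i|j|i j]; [|exact: ler0n|].
  by rewrite sumr_ge0// => k _; exact: hmat_ge0.
have -> : mprod (hmat x) s (s + r.+1) i j = \sum_(k in C) hmat x s i k * M k j.
  rewrite (@mprod_cat _ _ _ s.+1)//; last by rewrite addnS ltnS leq_addr.
  rewrite {1}/mprod big_nat1 -mulmxE mxE (bigID (fun k => k \in C))/=.
  by rewrite [X in _ + X]big1 ?addr0// => k kC; rewrite hs// mul0r.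
have [jC|jC] := boolP (j \in C); last first.
  by rewrite !mulr0 big1 ?lexx// => k _; rewrite M0C// mulr0.
rewrite mulr1 mulr_sumr; apply/andP; split; apply: ler_sum => k kC.
  by rewrite mulrC ler_wpM2l ?hmat_ge0// lbM.
by rewrite ler_piMr ?hmat_ge0.
Qed.

End HmmMatrices.

(** * Tails of intervals without blocks *)

Section NoBlock.
Context {d d' : measure_display} {Omega : measurableType d}
  {X : measurableType d'} {R : realType} {K : nat}.
Variable (P : probability Omega R).
Variables (Xt : nat -> {RV P >-> X}) (Yt : nat -> {RV P >-> 'I_K.+1}).
Variables (mu : {measure set X -> \bar R}) (p : 'M[R]_K.+1).
Variables (Ps : 'I_K.+1 -> probability X R) (f : 'I_K.+1 -> X -> R).
Hypothesis hmm : ergodic_hmm Xt Yt mu p Ps f.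
Variables (C : {set 'I_K.+1}) (r : nat) (Xo : set X).
Hypothesis hA1 : A1 p Ps f C r.
Hypothesis hXo : observation_set mu f C Xo.

(** Irreducibility leads into [C] and primitivity allows [r] more steps inside [C], so a block can
    follow any state with positive probability. *)
Lemma positive_path i : exists m (z : nat -> 'I_K.+1), [/\ (r < m)%N, z 0%N = i,
  forall t, (t < m)%N -> 0 < p (z t) (z t.+1) &
  forall t, (m - r <= t <= m)%N -> z t \in C].
Proof.
have [[[_ _] [irr _]] _ _ _] := hmm.
have [_ r0 _] := hA1.
have [c cC] := cluster_nonempty hA1.
(* Irreducibility may be witnessed by the zeroth power; one step taken beforehand guarantees
   [r < m]. *)
have [j pij] : exists j, 0 < p i j.
  apply: contrapT => h; have := p_sum hmm i; rewrite big1 => [/esym/eqP|j _].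
    by rewrite oner_eq0.
  apply/eqP; rewrite eq_le (p_ge0 hmm) andbT leNgt.
  by apply/negP => h'; apply: h; exists j.
have [n pn] := irr j c.
have [rho [rho0 hrho]] := masked_pow_gt0 hA1.
pose A (t : nat) := if (t < n.+1)%N then p else masked p C.
have A0 t : nonneg_mx (A t).
  by rewrite /A; case: ifP => _; [exact: (p_ge0 hmm)|exact: (masked_ge0 hmm)].
have expE (B : 'M[R]_K.+1) s k : \prod_(s <= t < s + k) B = B ^+ k.
  elim: k => [|k IH]; first by rewrite addn0 big_geq// expr0.
  by rewrite addnS big_nat_recr ?leq_addr//= IH exprSr.
have M0 : 0 < mprod A 0 (n.+1 + r) i c.
  apply: lt_le_trans (_ : p i j * (p ^+ n) j c * (masked p C ^+ r) c c <= _).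
    by rewrite !mulr_gt0// (lt_le_trans rho0)// hrho.
  rewrite (@mprod_cat _ _ A n.+1)//; last by rewrite leq_addr.
  have g0 s t : nonneg_mx (mprod A s t) by exact: mprod_ge0.
  apply: le_trans (mulmx_ge i c c (g0 _ _) (g0 _ _)).
  have <- : mprod A n.+1 (n.+1 + r) = masked p C ^+ r.
    rewrite -(expE _ n.+1); apply: eq_big_nat => t /andP[nt _].
    by rewrite /A ltnNge nt.
  rewrite ler_wpM2r ?g0//.
  rewrite (@mprod_cat _ _ A 1)//.
  apply: le_trans (mulmx_ge i j c (g0 _ _) (g0 _ _)).
  have -> : mprod A 0 1 = p by rewrite /mprod big_nat1.
  have -> : mprod A 1 n.+1 = p ^+ n.
    rewrite -(expE _ 1%N) add1n; apply: eq_big_nat => t /andP[_ tn].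
    by rewrite /A tn.
  by [].
have [z [z0 zc hz]] := mprod_le_pathw A0 (leq0n _) M0.
have zw : pathw A z 0 (n.+1 + r) != 0.
  apply: contraTneq (lt_le_trans M0 hz) => ->.
  by rewrite mulr0 ltxx.
have Az t : (t < n.+1 + r)%N -> A t (z t) (z t.+1) != 0.
  move=> tn; apply: contraNneq zw => h; apply/eqP.
  have ti : t \in index_iota 0 (n.+1 + r) by rewrite mem_index_iota leq0n.
  by rewrite /pathw (bigD1_seq _ ti) ?iota_uniq//= h mul0r.
have mz t : (n.+1 <= t < n.+1 + r)%N -> [/\ z t \in C, z t.+1 \in C &
    p (z t) (z t.+1) != 0].
  move=> /andP[nt tn]; have := Az t tn; rewrite /A ltnNge nt/= mxE.
  by case: ifP => [/andP[-> ->]//|_]; rewrite eqxx.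
exists (n.+1 + r)%N, z; split.
- by rewrite addSn ltnS leq_addl.
- by [].
- move=> t tn; rewrite lt_neqAle (p_ge0 hmm) andbT eq_sym.
  have [tn1|nt] := ltnP t n.+1; first by have := Az t tn; rewrite /A tn1.
  by have [|_ _] := mz t; rewrite ?nt.
- move=> t; rewrite addnK => /andP[nt tn].
  have [tr|rt] := ltnP t (n.+1 + r); first by have [|h _ _] := mz t; rewrite ?nt.
  have -> : t = (n + r).+1 by apply/eqP; rewrite eqn_leq -addSn tn.
  have [|_ h _] := mz (n + r)%N; last by [].
  by rewrite addSn ltnSn andbT -(prednK r0) addnS ltnS leq_addr.
Qed.

Lemma emission_obs_gt0 s : s \in C -> 0 < fine (Ps s Xo).
Proof.
have [mXo _ muXo [eps [M [eps0 hx]]]] := hXo.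
move=> sC; rewrite fine_gt0//; apply/andP; split; last first.
  by apply: (le_lt_trans (probability_le1 _ _)); rewrite ?ltry.
have PsE : Ps s Xo = (\int[mu]_(x in Xo) (f s x)%:E)%E by exact: (emissionE hmm).
rewrite PsE; apply: (@lt_le_trans _ _ (\int[mu]_(x in Xo) eps%:E)%E).
  by rewrite integral_cst// mule_gt0.
apply: ge0_le_integral => //.
- by move=> x _; rewrite lee_fin ltW.
- exact/measurable_funTS/measurable_EFinP/(measurable_f hmm).
- move=> x Xox; have [h _] := hx x Xox; have /andP[h1 _] := h s sC.
  by rewrite lee_fin ltW.
Qed.

Lemma total_probability n (A : set Omega) : measurable A ->
  P A = (\sum_(s : n.-tuple 'I_K.+1) P (A `&` state_event Yt s))%E.
Proof.
move=> mA; have ms (s : n.-tuple 'I_K.+1) : measurable (state_event Yt s).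
  exact: measurable_state_event.
under eq_bigr do rewrite setIC -integral_indic//.
rewrite -ge0_integral_sum//; last first.
  by move=> s; apply/measurable_EFinP/measurable_funTS/measurable_indic.
under eq_integral do rewrite sumEFin state_event_partition.
by rewrite integral_cst// mul1e.
Qed.

(* Markov property at time n, with the states up to time n specified. *)
Lemma markov_future n (s : n.-tuple 'I_K.+1) m (z : nat -> 'I_K.+1)
    (Bz : nat -> set X) (B : set (n.-tuple X)) : (0 < n)%N ->
  z 0%N = state_path s n -> (forall t, measurable (Bz t)) -> measurable B ->
  P (obs Xt n @^-1` B `&` (state_event Yt s `&`
     [set w | forall c, (1 <= c <= m)%N -> Yt (n + c)%N w = z c /\ Bz c (Xt (n + c)%N w)]))
  = ((\prod_(0 <= c < m) (p (z c) (z c.+1) * fine (Ps (z c.+1) (Bz c.+1))))%:E *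
     P (obs Xt n @^-1` B `&` state_event Yt s))%E.
Proof.
move=> n0 z0 mBz mB.
set kap := \prod_(0 <= c < m) _.
set G := state_event Yt s `&` _.
have kap0 : 0 <= kap.
  by apply: prodr_ge0 => c _; rewrite mulr_ge0 ?(p_ge0 hmm)// fine_ge0.
have mX t : measurable_fun [set: Omega] (Xt t) by exact: measurable_funPT.
have ms : measurable (state_event Yt s) by exact: measurable_state_event.
have mG : measurable G.
  apply: measurableI => //.
  rewrite (_ : [set w | _] = \bigcap_(c in [set c | (1 <= c <= m)%N])
      (Yt (n + c)%N @^-1` [set z c] `&` Xt (n + c)%N @^-1` Bz c)); last first.
    by apply/seteqP; split.
  apply: bigcap_measurableType => c _; apply: measurableI.
    by rewrite -[X in measurable X]setTI; exact: (measurable_funPT (Yt _)).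
  by rewrite -[X in measurable X]setTI; exact: mX.
have mobs := @measurable_obs _ _ _ _ _ P Xt n.
pose g1 w : R := \1_G w.
pose g2 w : R := kap * \1_(state_event Yt s) w.
have mg1 : measurable_fun [set: Omega] g1 by exact: measurable_indic.
have mg2 : measurable_fun [set: Omega] g2.
  by apply: measurable_funM => //; exact: measurable_indic.
have g10 w : 0 <= g1 w by [].
have g20 w : 0 <= g2 w by rewrite mulr_ge0.
have g1fin : (\int[P]_w (g1 w)%:E < +oo)%E.
  rewrite integral_indic// setIT.
  by apply: (le_lt_trans (probability_le1 _ _)); rewrite ?ltry.
have int2 (D : set Omega) : measurable D ->
    (\int[P]_(w in D) (g2 w)%:E = kap%:E * P (D `&` state_event Yt s))%E.
  move=> mD; under eq_integral do rewrite EFinM.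
  rewrite ge0_integralZl//; last first.
    exact/measurable_funTS/measurable_EFinP/measurable_indic.
  by rewrite integral_indic// setIC.
have boxE (D : 'I_n -> set X) : (forall i, measurable (D i)) ->
    (\int[P]_(w in obs Xt n @^-1` box D) (g1 w)%:E =
     \int[P]_(w in obs Xt n @^-1` box D) (g2 w)%:E)%E.
  move=> mD; have mbD : measurable (obs Xt n @^-1` box D).
    by rewrite -[X in measurable X]setTI; apply: mobs => //; exact: measurable_box.
  rewrite int2// integral_indic//.
  (* States and sets before and after time [n] are pasted together; [BB] and [B0] differ only after
     time [n]. *)
  pose y t := if (t <= n)%N then state_path s t else z (t - n)%N.
  pose BB (t : nat) := if insub t.-1 is Some i then D i else Bz (t - n)%N.
  pose B0 (t : nat) := if insub t.-1 is Some i then D i else setT.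
  have mBB t : measurable (BB t) by rewrite /BB; case: insub.
  have mB0 t : measurable (B0 t) by rewrite /B0; case: insub.
  have lo t (i : 'I_n) : t = i.+1 -> BB t = D i /\ B0 t = D i.
    by move=> ->; rewrite /BB /B0/= valK.
  have hi c : (0 < c)%N -> BB (n + c)%N = Bz c.
    move=> c0; rewrite /BB insubN ?addKn// -leqNgt.
    by rewrite -(prednK c0) addnS/= leq_addr.
  have [_ _ ci _] := hmm.
  have -> : G `&` obs Xt n @^-1` box D = path_event Yt 0 (n + m) y `&`
      [set w | forall t, (1 <= t <= n + m)%N -> BB t (Xt t w)].
    apply/seteqP; split => w.
      move=> [[sw fw] Dw]; split => t /andP[t1 tn].
        rewrite add0n /y; case: leqP => nt.
          move: sw; rewrite state_eventE => /(_ t); rewrite add0n => -> //.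
          by rewrite t1.
        have /fw[] : (1 <= t - n <= m)%N by lia.
        by rewrite subnKC// ltnW.
      have [tn'|nt] := leqP t n.
        have ti : (t.-1 < n)%N by lia.
        have [|-> _] := lo t (Ordinal ti); first by rewrite /= prednK.
        by have := Dw (Ordinal ti); rewrite tnth_mktuple/= prednK.
      have /fw[] : (1 <= t - n <= m)%N by lia.
      rewrite subnKC; last by rewrite ltnW.
      by move=> _; rewrite -(hi (t - n)%N) ?subn_gt0// subnKC// ltnW.
    move=> [yw Bw]; split; [split|].
    - rewrite state_eventE => t /andP[t1 tn].
      by rewrite yw ?t1 ?(leq_trans tn) ?leq_addr// /y tn.
    - move=> c /andP[c1 cm]; split.
        have := yw (n + c)%N; rewrite add0n => ->; last first.
          by rewrite leq_add2l cm andbT (leq_trans c1)// leq_addl.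
        by rewrite /y leqNgt -{1}[n]addn0 ltn_add2l c1/= addKn.
      rewrite -(hi c c1); apply: Bw.
      by rewrite leq_add2l cm andbT (leq_trans c1)// leq_addl.
    - move=> i; rewrite tnth_mktuple; have [<- _] := lo i.+1 i erefl.
      by apply: Bw; rewrite /= (leq_trans (ltn_ord i))// leq_addr.
  have -> : obs Xt n @^-1` box D `&` state_event Yt s =
      path_event Yt 0 n (state_path s) `&`
      [set w | forall t, (1 <= t <= n)%N -> B0 t (Xt t w)].
    rewrite -state_eventE setIC; congr (_ `&` _); apply/seteqP; split => w h.
      move=> t /andP[t1 tn]; have ti : (t.-1 < n)%N by lia.
      have [|_ ->] := lo t (Ordinal ti); first by rewrite /= prednK.
      by have := h (Ordinal ti); rewrite tnth_mktuple/= prednK.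
    move=> i; rewrite tnth_mktuple; have [_ <-] := lo i.+1 i erefl.
    by apply: h; rewrite /= ltn_ord.
  apply: etrans (ci (n + m)%N y BB mBB) _.
  apply: etrans _ (congr1 (mule kap%:E) (esym (ci n (state_path s) B0 mB0))).
  have fP k y' : P (path_event Yt 0 k y') \is a fin_num.
    by rewrite fin_num_measure//; exact: measurable_path_event.
  rewrite -(fineK (fP _ y)) -(fineK (fP _ (state_path s))) -!EFinM; congr EFin.
  rewrite !(path_probE hmm)//; last by rewrite (leq_trans n0)// leq_addr.
  rewrite (@big_cat_nat _ _ _ n 1 (n + m))//=; last by rewrite leq_addr.
  rewrite [X in _ * X = _](@big_cat_nat _ _ _ n.+1 1 (n + m).+1)//=; last first.
    by rewrite ltnS leq_addr.
  have e1 : initial Yt (y 1%N) = initial Yt (state_path s 1) by rewrite /y n0.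
  have e2 : \prod_(1 <= t < n) p (y t) (y t.+1) =
      \prod_(1 <= t < n) p (state_path s t) (state_path s t.+1).
    by apply: eq_big_nat => t /andP[_ tn]; rewrite /y tn ltnW.
  have e3 : \prod_(1 <= t < n.+1) fine (Ps (y t) (BB t)) =
      \prod_(1 <= t < n.+1) fine (Ps (state_path s t) (B0 t)).
    apply: eq_big_nat => t /andP[t1 tn]; rewrite /y -ltnS tn.
    have ti : (t.-1 < n)%N by lia.
    by have [|-> ->] := lo t (Ordinal ti); first by rewrite /= prednK.
  have ynE c : y (n + c)%N = z c.
    rewrite /y; case: c => [|c]; first by rewrite addn0 leqnn z0.
    by rewrite leqNgt -{1}[n]addn0 ltn_add2l/= addKn.
  have e4 : \prod_(n <= t < n + m) p (y t) (y t.+1) =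
      \prod_(0 <= c < m) p (z c) (z c.+1).
    rewrite -{1}[n]add0n [(n + m)%N]addnC big_addn addnK.
    by apply: eq_bigr => c _; rewrite addnC -addnS !ynE.
  have e5 : \prod_(n.+1 <= t < (n + m).+1) fine (Ps (y t) (BB t)) =
      \prod_(0 <= c < m) fine (Ps (z c.+1) (Bz c.+1)).
    rewrite -{1}[n.+1]add0n -addnS [(n + m.+1)%N]addnC addSnnS big_addn addnK.
    by apply: eq_bigr => c _; rewrite addnC addSnnS ynE hi.
  rewrite e1 e2 e3 e4 e5 /kap big_split/=; ring.
have := eq_integral_boxes mobs mg1 mg2 g10 g20 g1fin boxE
  (h := fun x => (\1_B x)%:E) _ _.
have mBo : measurable (obs Xt n @^-1` B).
  by rewrite -[X in measurable X]setTI; exact: mobs.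
have conv g : (\int[P]_w ((\1_B (obs Xt n w))%:E * (g w)%:E) =
    \int[P]_(w in obs Xt n @^-1` B) (g w : R)%:E)%E.
  rewrite [RHS]integral_mkcond; apply: eq_integral => w _.
  rewrite patchE indicE -[w \in obs _ _ @^-1` _]/(obs Xt n w \in B).
  by case: (obs Xt n w \in B); rewrite ?mul1e ?mul0e.
rewrite !conv int2// integral_indic// setIC => ->//.
  by apply/measurable_EFinP/measurable_indic.
Qed.

(* No block of r + 1 consecutive observations in Xo within the times s + 1, ..., s + l. *)
Definition no_block (x : nat -> X) (s l : nat) : Prop := forall u, (s < u)%N ->
  (u + r <= s + l)%N -> exists t, (u <= t <= u + r)%N /\ ~ Xo (x t).

Lemma no_block_sub x s l s' l' : (s <= s')%N -> (s' + l' <= s + l)%N ->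
  no_block x s l -> no_block x s' l'.
Proof.
move=> ss sl nb u su ul; apply: nb; first exact: leq_ltn_trans su.
exact: leq_trans sl.
Qed.

(** The event as a set of tuples, in the form that [markov_future] needs. The default [point] of
    [nth] is not reached when [s + l <= n]. *)
Let tuple_no_block n (s l : nat) : set (n.-tuple X) :=
  \bigcap_(u in [set u | (s < u)%N /\ (u + r <= s + l)%N])
    \bigcup_(t in [set t | (u <= t <= u + r)%N])
      [set x : n.-tuple X | ~ Xo (nth point x t.-1)].

Let measurable_tuple_no_block n s l : measurable (@tuple_no_block n s l).
Proof.
have [mXo _ _ _] := hXo.
apply: bigcap_measurableType => u _; apply: bigcup_measurable => t _.
rewrite -[X in measurable X]/(~` ((fun x : n.-tuple X => nth point x t.-1) @^-1` Xo)).
apply: measurableC; rewrite -[X in measurable X]setTI.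
have [tn|nt] := ltnP t.-1 n.
  rewrite (_ : (fun x : n.-tuple X => nth point x t.-1) =
    (fun x => tnth x (Ordinal tn))).
    exact: measurable_tnth.
  by apply/funext => x; rewrite (tnth_nth point).
rewrite (_ : (fun x : n.-tuple X => nth point x t.-1) = cst point).
  exact: measurable_cst.
by apply/funext => x; rewrite nth_default// size_tuple.
Qed.

Let no_blockE n s l w : (s + l <= n)%N ->
  no_block (Xt ^~ w) s l <-> (obs Xt n @^-1` tuple_no_block s l) w.
Proof.
move=> sln.
have E u t : (s < u)%N -> (u + r <= s + l)%N -> (u <= t <= u + r)%N ->
    nth point (obs Xt n w) t.-1 = Xt t w.
  move=> su ul /andP[ut tu].
  have t0 : (0 < t)%N by exact: leq_ltn_trans (leq_trans su ut).
  have tn : (t.-1 < n)%N by rewrite prednK// (leq_trans tu)// (leq_trans ul).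
  have := tnth_mktuple (fun i : 'I_n => Xt i.+1 w) (Ordinal tn).
  by rewrite (tnth_nth point)/= prednK.
split=> [nb u [/= su ul]|nb u su ul].
  have [t [tu nXt]] := nb u su ul.
  by exists t => //=; rewrite (E u).
by have [t /= tu nXt] := nb u (conj su ul); exists t; rewrite -(E u t).
Qed.

Lemma measurable_no_block s l : measurable [set w | no_block (Xt ^~ w) s l].
Proof.
rewrite (_ : [set w | _] = obs Xt (s + l) @^-1` tuple_no_block s l).
  rewrite -[X in measurable X]setTI; apply: measurable_obs => //.
  exact: measurable_tuple_no_block.
by apply/seteqP; split => w /(no_blockE w (leqnn _)).
Qed.

(** Whatever the state [i] at time [N], a path of length [m i <= l0] yields a block with probability
    at least [kap i]. So each further stretch of [l0] observations multiplies the probability of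
    seeing no block by at most [rho], the maximum of [1 - kap i]. *)
Lemma no_block_tail : exists (l0 : nat) (rho : R), [/\ (0 < l0)%N, 0 <= rho < 1 &
  forall s k, (0 < s)%N ->
    (P [set w | no_block (Xt ^~ w) s (k * l0)] <= (rho ^+ k)%:E)%E].
Proof.
have [mXo _ _ _] := hXo.
have [m hm] := choice positive_path.
have [z hz] := choice hm => {hm}.
pose Bz i c : set X := if (m i - r <= c <= m i)%N then Xo else setT.
have mBz i c : measurable (Bz i c) by rewrite /Bz; case: ifP.
pose kap i := \prod_(0 <= c < m i)
  (p (z i c) (z i c.+1) * fine (Ps (z i c.+1) (Bz i c.+1))).
have kap0 i : 0 < kap i.
  have [_ _ zp zC] := hz i.
  rewrite /kap big_mkord; apply: prodr_gt0 => c _; rewrite mulr_gt0 ?zp//.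
  rewrite /Bz; case: ifP => h; first exact/emission_obs_gt0/zC.
  by rewrite probability_setT.
pose l0 := \max_i m i.
pose rho := \big[Num.max/0]_i (1 - kap i).
have ml0 i : (m i <= l0)%N by exact: leq_bigmax.
have rho_ge i : 1 - kap i <= rho by exact: le_bigmax.
have rho01 : 0 <= rho < 1.
  rewrite /rho bigmax_ge_id/=; apply/bigmax_ltP; split => // i _.
  by rewrite gtrBl.
exists l0, rho; split => //.
  have [rm _ _ _] := hz ord0; apply: leq_trans (ml0 ord0).
  exact: leq_ltn_trans rm.
move=> s k s0; elim: k => [|k IH].
  by rewrite expr0 probability_le1//; exact: measurable_no_block.
pose N := (s + k * l0)%N.
have N0 : (0 < N)%N by rewrite (leq_trans s0)// leq_addr.
pose F := obs Xt N @^-1` tuple_no_block s (k * l0).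
have FE : [set w | no_block (Xt ^~ w) s (k * l0)] = F.
  by apply/seteqP; split => w /(no_blockE w (leqnn _)).
have mF : measurable F by rewrite -FE; exact: measurable_no_block.
rewrite FE in IH.
pose A := [set w | no_block (Xt ^~ w) s (k.+1 * l0)].
have mA : measurable A by exact: measurable_no_block.
have AF : A `<=` F.
  rewrite -FE => w; apply: no_block_sub => //.
  by rewrite leq_add2l leq_mul2r leqnSn orbT.
have step (y : N.-tuple 'I_K.+1) :
    (P (A `&` state_event Yt y) <= rho%:E * P (F `&` state_event Yt y))%E.
  pose i := state_path y N.
  have [rm z0 zp zC] := hz i.
  have := markov_future (m i) N0 z0 (mBz i) (@measurable_tuple_no_block N s (k * l0)).
  rewrite -/F -/(kap i); set G := [set w | _] => hG.
  have mE : measurable (state_event Yt y) by exact: measurable_state_event.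
  have mG : measurable G.
    rewrite (_ : G = \bigcap_(c in [set c | (1 <= c <= m i)%N])
      (Yt (N + c)%N @^-1` [set z i c] `&` Xt (N + c)%N @^-1` Bz i c)); last first.
      by apply/seteqP; split.
    apply: bigcap_measurableType => c _; apply: measurableI.
      by rewrite -[X in measurable X]setTI; exact: (measurable_funPT (Yt _)).
    by rewrite -[X in measurable X]setTI; exact: (measurable_funPT (Xt _)).
  have disj : A `&` state_event Yt y `<=`
      (F `&` state_event Yt y) `\` (F `&` (state_event Yt y `&` G)).
    move=> w [Aw yw]; split; first by split => //; exact: AF.
    move=> [_ [_ Gw]].
    (* On [G] the [r + 1] observations from this time on form a block, which the event [A]
       forbids. *)
    have [||t [/andP[t1 t2] nX]] := Aw (N + (m i - r))%N.
    - apply: leq_ltn_trans (leq_addr (k * l0) s) _.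
      by rewrite -/N -[X in (X < _)%N]addn0 ltn_add2l subn_gt0.
    - rewrite -addnA subnK; last exact: ltnW.
      by rewrite /N -addnA leq_add2l mulSn addnC leq_add2r.
    have tN : (N <= t)%N by rewrite (leq_trans _ t1)// leq_addr.
    apply: nX; rewrite -(subnKC tN).
    have c1 : (m i - r <= t - N <= m i)%N.
      rewrite leq_subRL// t1/= leq_subLR (leq_trans t2)//.
      by rewrite -addnA subnK// ltnW.
    have c0 : (0 < t - N)%N.
      by have /andP[c1' _] := c1; apply: leq_trans c1'; rewrite subn_gt0.
    have [|_] := Gw (t - N)%N; first by rewrite c0; have /andP[] := c1.
    by rewrite /Bz c1.
  have mFE : measurable (F `&` state_event Yt y) by exact: measurableI.
  have mFG : measurable (F `&` (state_event Yt y `&` G)).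
    by apply: measurableI => //; exact: measurableI.
  apply: (@le_trans _ _ (P ((F `&` state_event Yt y) `\`
      (F `&` (state_event Yt y `&` G))))).
    apply: le_measure => //; rewrite inE; first exact: measurableI.
    exact: measurableD.
  rewrite measureD//; last first.
    by apply: (le_lt_trans (probability_le1 _ _)); rewrite ?ltry.
  rewrite (_ : _ `&` (F `&` _) = F `&` (state_event Yt y `&` G)); last first.
    by apply/seteqP; split => w; [move=> [_ []]|move=> [Fw [yw Gw]]; split].
  have fE : P (F `&` state_event Yt y) \is a fin_num by rewrite fin_num_measure.
  have aE := esym (fineK fE); set a := fine _ in aE.
  rewrite [X in (_ - X)%E]hG [X in (X - _)%E]aE aE -!EFinM -EFinB lee_fin.
  rewrite -[X in X - _]mul1r -mulrBl ler_wpM2r ?fine_ge0//; exact: rho_ge.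
rewrite (total_probability N mA) exprS EFinM.
apply: (@le_trans _ _ (rho%:E * P F)%E); last first.
  by rewrite lee_wpmul2l// lee_fin; have /andP[] := rho01.
rewrite (total_probability N mF) ge0_sume_distrr//.
exact: lee_sum.
Qed.

End NoBlock.

(** * Smoothing costs along an optimal path *)

Section Windows.
Context {R : realType} {K : nat}.
Notation mat := 'M[R]_K.+1.
Implicit Types A : nat -> mat.

(** Whatever weights enter at [c] may be replaced by the constant vector, up to a scale and a
    relative error geometric in the number of anchored windows. *)
Lemma left_sandwich A delta b l c (al : 'rV[R]_K.+1) :
  (forall t, nonneg_mx (A t)) -> 0 < delta <= 1 ->
  (forall i, (i <= b)%N ->
     anchored delta (mprod A (c + i * l) (c + i.+1 * l))) ->
  (forall j, 0 <= al 0 j) ->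
  (exists j, 0 < (al *m mprod A c (c + b.+1 * l)) 0 j) ->
  exists lo hi, [/\ 0 < lo, lo <= hi,
    hi - lo <= delta ^- 2 * (1 - delta) ^+ b * lo &
    sandwich lo hi (al *m mprod A c (c + b.+1 * l))
      (const_mx 1 *m mprod A c (c + b.+1 * l))].
Proof.
move=> A0 dl anch al0 [j0 pos].
pose e i := (c + i * l)%N.
have eS i : (e i <= e i.+1)%N by rewrite /e leq_add2l leq_mul2r leqnSn orbT.
have ce i : (c <= e i)%N by rewrite /e leq_addr.
have eb i : (i <= b.+1)%N -> (e i <= e b.+1)%N.
  by move=> ib; rewrite /e leq_add2l leq_mul2r ib orbT.
pose x i := al *m mprod A c (e i).
pose y i : 'rV[R]_K.+1 := const_mx 1 *m mprod A c (e i).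
have stepE (z : 'rV[R]_K.+1) i :
    z *m mprod A c (e i.+1) = (z *m mprod A c (e i)) *m mprod A (e i) (e i.+1).
  by rewrite (@mprod_cat _ _ A (e i))// -mulmxA.
have M0 s t i j : 0 <= mprod A s t i j by exact: mprod_ge0.
have x0 i j : 0 <= x i 0 j by rewrite mxE sumr_ge0// => k _; rewrite mulr_ge0.
have y0 i j : 0 <= y i 0 j.
  by rewrite mxE sumr_ge0// => k _; rewrite mulr_ge0// mxE.
have xE i : (i <= b.+1)%N -> x b.+1 = x i *m mprod A (e i) (e b.+1).
  by move=> ib; rewrite /x (@mprod_cat _ _ A (e i)) ?eb// -mulmxA.
have xp i : (i <= b.+1)%N -> exists j, 0 < x i 0 j.
  move=> ib; apply: contrapT => h.
  have z i' : x i 0 i' = 0.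
    apply/eqP; rewrite eq_le x0 andbT leNgt; apply/negP => h'; apply: h.
    by exists i'.
  move: pos; rewrite -[_ *m _]/(x b.+1) (xE i ib) mxE big1 ?ltxx// => k _.
  by rewrite z mul0r.
have yp i : (i <= b.+1)%N -> exists j, 0 < y i 0 j.
  move=> ib; have [j xj] := xp i ib; exists j.
  have [k hk] : exists k, 0 < mprod A c (e i) k j.
    apply: contrapT => h; move: xj; rewrite mxE big1 ?ltxx// => k _.
    have -> : mprod A c (e i) k j = 0; last by rewrite mulr0.
    apply/eqP; rewrite eq_le M0 andbT leNgt; apply/negP => h'; apply: h.
    by exists k.
  apply: lt_le_trans hk _; rewrite mxE (bigD1 k)//= mxE mul1r lerDl sumr_ge0//.
  by move=> i' _; rewrite mulr_ge0// mxE.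
apply: (@sandwich_iter R K delta (fun i => mprod A (e i) (e i.+1)) x y b dl anch) => //.
- by move=> i _; exact: stepE.
- by move=> i _; exact: stepE.
Qed.

Lemma mprod_rev A e s t : (s <= t)%N -> (t <= e)%N ->
  mprod (fun u => (A (e - u.+1)%N)^T) s t = (mprod A (e - t) (e - s))^T.
Proof.
elim: t => [|t IH].
  by rewrite leqn0 => /eqP -> _; rewrite !mprod0 trmx1.
rewrite leq_eqVlt => /orP[/eqP -> _|]; first by rewrite !mprod0 trmx1.
rewrite ltnS => st te; rewrite mprodS// IH//; last exact: ltnW.
rewrite [in RHS](@mprod_cat _ _ A (e - t.+1).+1)//; last 1 first.
  by rewrite subnSK// leq_sub2l.
rewrite subnSK// -!mulmxE trmx_mul; congr (_ *m _).
by rewrite /mprod -(subnSK te) big_nat1.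
Qed.

(** The left version after reversing time and transposing, under which [anchored] is stable. *)
Lemma right_sandwich A delta b l c (be : 'cV[R]_K.+1) :
  (forall t, nonneg_mx (A t)) -> 0 < delta <= 1 ->
  (forall i, (i <= b)%N ->
     anchored delta (mprod A (c + i * l) (c + i.+1 * l))) ->
  (forall j, 0 <= be j 0) ->
  (exists j, 0 < (mprod A c (c + b.+1 * l) *m be) j 0) ->
  exists lo hi, [/\ 0 < lo, lo <= hi,
    hi - lo <= delta ^- 2 * (1 - delta) ^+ b * lo &
    forall j, lo * (mprod A c (c + b.+1 * l) *m const_mx 1 : 'cV_K.+1) j 0 <=
      (mprod A c (c + b.+1 * l) *m be) j 0 <=
      hi * (mprod A c (c + b.+1 * l) *m const_mx 1 : 'cV_K.+1) j 0].
Proof.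
move=> A0 dl anch be0 [j0 pos].
pose e := (c + b.+1 * l)%N.
pose A' u := (A (e - u.+1)%N)^T.
have revE m : (m <= b.+1)%N -> (e - m * l = c + (b.+1 - m) * l)%N.
  by move=> mb; rewrite /e mulnBl addnBA// leq_mul2r mb orbT.
have full : mprod A' 0 (0 + b.+1 * l) = (mprod A c e)^T.
  rewrite add0n mprod_rev//; last by rewrite /e leq_addl.
  by rewrite subn0 revE// subnn addn0.
have [||||lo [hi [lo0 lohi hilo sw]]] :=
  @left_sandwich A' delta b l 0 be^T _ dl _ _ _.
- by move=> t i j; rewrite mxE; exact: A0.
- move=> i ib; rewrite !add0n mprod_rev; last 2 first.
  + by rewrite leq_mul2r leqnSn orbT.
  + by rewrite /e (leq_trans _ (leq_addl _ _))// leq_mul2r ltnS ib orbT.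
  rewrite !revE//; last exact: leqW.
  apply: anchored_tr; rewrite subSS (subSn ib); apply: anch.
  by rewrite leq_subr.
- by move=> j; rewrite mxE.
- by exists j0; rewrite full -trmx_mul mxE.
exists lo, hi; split => // j; have := sw j.
have -> : (const_mx 1 : 'rV[R]_K.+1) = (const_mx 1 : 'cV[R]_K.+1)^T.
  by rewrite trmx_const.
by rewrite full -!trmx_mul ![(_ *m _)^T 0 j]mxE.
Qed.

End Windows.

Lemma sum_shift_le (F : nat -> nat) m n :
  (\sum_(1 <= t < n.+1 | (m < t)%N) F (t - m)%N <= \sum_(1 <= s < n.+1) F s)%N.
Proof.
have [nm|mn] := leqP n m.
  rewrite big_nat_cond big_pred0// => t; apply/negbTE/negP.
  by move=> /andP[/andP[_ tn] mt]; lia.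
rewrite (@big_cat_nat _ _ _ m.+1)//=; last by rewrite ltnS ltnW.
rewrite big_nat_cond big_pred0 ?add0n; last first.
  by move=> t; apply/negbTE/negP => /andP[/andP[_ tn] mt]; lia.
rewrite big_nat_cond.
rewrite (eq_bigl (fun t => (m.+1 <= t < n.+1)%N)); last first.
  by move=> t /=; lia.
rewrite -big_nat -[m.+1]add1n big_addn.
rewrite [leqRHS](@big_cat_nat _ _ _ (n.+1 - m))//=; try lia.
apply: leq_trans (leq_addr _ _); rewrite leq_eqVlt; apply/orP; left; apply/eqP.
by apply: eq_bigr => i _; rewrite addnK.
Qed.

Lemma sum_shift_ge (F : nat -> nat) m n :
  (\sum_(1 <= t < n.+1 | (t + m <= n)%N) F (t + m)%N <= \sum_(1 <= s < n.+1) F s)%N.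
Proof.
have [nm|mn] := leqP n m.
  rewrite big_nat_cond big_pred0// => t; apply/negbTE/negP.
  by move=> /andP[/andP[t0 _] tm]; lia.
rewrite [leqRHS](@big_cat_nat _ _ _ m.+1)//=; last exact: leqW.
apply: leq_trans (leq_addl _ _); rewrite -[m.+1]add1n big_addn.
rewrite [leqLHS](@big_cat_nat _ _ _ (n.+1 - m))//=; try lia.
rewrite [X in (_ + X)%N]big_nat_cond [X in (_ + X)%N]big_pred0 ?addn0; last first.
  by move=> t; apply/negbTE/negP => /andP[/andP[h _] h']; lia.
by rewrite [leqRHS](bigID (fun t => (t + m <= n)%N))/= leq_addr.
Qed.

(** A window centred at [t] with half-length [k] has origin [t - k], which is [i + 1] in the
    indexing of the law of large numbers. *)
Lemma sum_window_shift (R : realType) (G : nat -> R) (I : pred nat) k n :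
  (forall t, I t -> (k < t)%N) ->
  \sum_(0 <= i < n | (i + k.+1 <= n)%N && I (i + k.+1)%N) G i =
  \sum_(1 <= t < n.+1 | I t) G (t - k.+1)%N.
Proof.
move=> Ik; have [nk|kn] := ltnP n k.
  rewrite big_nat_cond big_pred0; last first.
    by move=> t; apply/negbTE/negP => /andP[_ /andP[h _]]; lia.
  rewrite big_nat_cond big_pred0// => t; apply/negbTE/negP.
  by move=> /andP[/andP[_ h] /Ik]; lia.
rewrite [RHS](@big_cat_nat _ _ _ k.+1)//=.
rewrite [X in _ = X + _]big_nat_cond [X in _ = X + _]big_pred0 ?add0r; last first.
  by move=> t; apply/negbTE/negP => /andP[/andP[_ h] /Ik]; lia.
rewrite -{3}[k.+1]add0n big_addn subSS [LHS](@big_cat_nat _ _ _ (n - k))//=; last first.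
  exact: leq_subr.
rewrite [X in _ + X]big_nat_cond [X in _ + X]big_pred0 ?addr0; last first.
  by move=> t; apply/negbTE/negP => /andP[/andP[h _] /andP[h' _]]; lia.
rewrite big_nat_cond [RHS]big_nat_cond; apply: eq_big => [i|i _]; last by rewrite addnK.
case: (boolP (0 <= i < n - k)%N) => //= h; case: (I _); rewrite ?andbF// andbT; lia.
Qed.

Section Windows.
Context {R : realType} {K : nat}.

Lemma mprod_shift (A : nat -> 'M[R]_K.+1) c s t :
  mprod (fun u => A (c + u)%N) s t = mprod A (c + s) (c + t).
Proof.
have [ts|st] := leqP t s; first by rewrite /mprod !big_geq ?leq_add2l.
rewrite /mprod (addnC c s) big_addn addKn.
by apply: eq_bigr => u _; rewrite addnC.
Qed.

(* The posterior at the centre of a window of length 2 k, with the weights outside of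
   the window replaced by constant vectors. *)
Definition window_posterior (B : nat -> 'M[R]_K.+1) (k : nat) (a : 'I_K.+1) : R :=
  let al : 'rV[R]_K.+1 := const_mx 1 *m mprod B 0 k in
  let be : 'cV[R]_K.+1 := mprod B k (k + k) *m const_mx 1 in
  al 0 a * be a 0 / \sum_i al 0 i * be i 0.

End Windows.

(** * Deterministic cost bounds along an optimal path *)

Section PathBounds.
Context {R : realType} {K : nat}.
Notation mat := 'M[R]_K.+1.
Variables (A : nat -> mat) (n r l0 : nat) (v : nat -> 'I_K.+1) (delta : R).
(* [nb s J] stands for the absence of a block among the times s + 1, ..., s + J l0. *)
Variable nb : nat -> nat -> bool.
Hypothesis A0 : forall t, nonneg_mx (A t).
Hypothesis l0_gt0 : (0 < l0)%N.
Hypothesis n_gt0 : (0 < n)%N.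
Hypothesis delta01 : 0 < delta <= 1.
Hypothesis vopt : forall y, y 0%N = v 0%N -> y n.+1 = v n.+1 ->
  pathw A y 0 n.+1 <= pathw A v 0 n.+1.
Hypothesis v_gt0 : 0 < pathw A v 0 n.+1.
Hypothesis anch_first : anchored delta (mprod A 0 1).
Hypothesis anch_last : anchored delta (mprod A n n.+1).
Hypothesis nb_anch : forall s J, (0 < s)%N -> (s + J * l0 <= n)%N -> ~~ nb s J ->
  exists u, [/\ (s <= u)%N, (u + r.+1 <= s + J * l0)%N &
                anchored delta (mprod A u (u + r.+1))].
Hypothesis nb_sub : forall s J s' J', (s <= s')%N ->
  (s' + J' * l0 <= s + J * l0)%N -> nb s J -> nb s' J'.

(** Blockless windows are counted, instead of measuring the distance to the next block, because sums
    of indicators over [t] and [J] can be exchanged and their means are geometric. *)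
Definition right_gap t := (\sum_(1 <= J < n.+1) ((t + J * l0 <= n) && nb t J))%N.

Definition left_gap t :=
  (\sum_(1 <= J < n.+1) ((J * l0 < t) && nb (t - J * l0) J))%N.

Let gap_count (F : nat -> bool) m : (m <= n)%N ->
  (forall J, (0 < J <= m)%N -> F J) -> (m <= \sum_(1 <= J < n.+1) F J)%N.
Proof.
move=> mn h; rewrite (@big_cat_nat _ _ _ m.+1)//=.
apply: leq_trans (leq_addr _ _).
rewrite (eq_big_nat _ _ (F2 := fun=> 1%N)); last by move=> J hJ; rewrite h.
by rewrite sum_nat_const_nat subSS subn0 muln1.
Qed.

(** Were the first [g + 1] windows all blockless and inside the sample, they would be [g + 1] terms
    of the count [g]. So one of them contains a block, or the end [n] is near and the boundary
    factor is the anchor. *)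
Lemma right_anchor t : (0 < t <= n)%N -> exists w w',
  [/\ (t <= w)%N, (w <= w' <= n.+1)%N, (w' - w <= r.+1)%N,
      (w - t <= (right_gap t).+1 * l0)%N & anchored delta (mprod A w w')].
Proof.
move=> /andP[t0 tn]; set g := right_gap t.
have [[J [J0 Jg tJ nbJ]]|h] := pselect (exists J,
    [/\ (0 < J)%N, (J <= g.+1)%N, (t + J * l0 <= n)%N & ~~ nb t J]).
  have [u [tu uJ anch]] := nb_anch t0 tJ nbJ.
  have Jl : (J * l0 <= g.+1 * l0)%N by rewrite leq_mul2r Jg orbT.
  exists u, (u + r.+1)%N; split => //; lia.
exists n, n.+1; split => //; first lia; first lia.
rewrite leqNgt; apply/negP => lt.
have : (g.+1 <= g)%N; last by rewrite ltnn.
apply: (@gap_count (fun J => (t + J * l0 <= n)%N && nb t J)) => [|J].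
  have : (g.+1 * 1 <= g.+1 * l0)%N by rewrite leq_mul2l l0_gt0.
  lia.
move=> /andP[J0 Jg]; have Jl : (J * l0 <= g.+1 * l0)%N.
  by rewrite leq_mul2r Jg orbT.
have tJ : (t + J * l0 <= n)%N by lia.
by rewrite tJ; apply/negPn/negP => nbJ; apply: h; exists J.
Qed.

Lemma left_anchor t : (0 < t <= n)%N -> exists u u',
  [/\ (u <= u' <= t)%N, (u' - u <= r.+1)%N,
      (t - u' <= (left_gap t).+1 * l0)%N & anchored delta (mprod A u u')].
Proof.
move=> /andP[t0 tn]; set g := left_gap t.
have [[J [J0 Jg tJ nbJ]]|h] := pselect (exists J,
    [/\ (0 < J)%N, (J <= g.+1)%N, (J * l0 < t)%N & ~~ nb (t - J * l0) J]).
  have Jl : (J * l0 <= g.+1 * l0)%N by rewrite leq_mul2r Jg orbT.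
  have [||u [tu uJ anch]] := nb_anch _ _ nbJ; [lia|lia|].
  exists u, (u + r.+1)%N; split => //; lia.
exists 0%N, 1%N; split => //.
rewrite leqNgt; apply/negP => lt.
have : (g.+1 <= g)%N; last by rewrite ltnn.
apply: (@gap_count (fun J => (J * l0 < t)%N && nb (t - J * l0) J)) => [|J].
  have : (g.+1 * 1 <= g.+1 * l0)%N by rewrite leq_mul2l l0_gt0.
  lia.
move=> /andP[J0 Jg]; have Jl : (J * l0 <= g.+1 * l0)%N.
  by rewrite leq_mul2r Jg orbT.
have tJ : (J * l0 < t)%N by lia.
by rewrite tJ; apply/negPn/negP => nbJ; apply: h; exists J.
Qed.

(** For the weights [hmat_n] this is the posterior probability of the state [v t] at time [t]. *)
Definition smoothed t : R := mprod A 0 t (v 0%N) (v t) *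
  mprod A t n.+1 (v t) (v n.+1) / mprod A 0 n.+1 (v 0%N) (v n.+1).

Definition log_cost t : R := - ln (smoothed t).

(** Both cost constants come from the logarithm of [optimal_state_lb], with anchors of length at
    most [r + 1] and [w - u' <= (g + 2) * l0], where [g] is the sum of the two gaps. *)
Definition cost0 : R :=
  ln ((K.+1%:R ^+ r.+1) ^+ 2 / delta ^+ 4) + (2 * l0 + 2)%:R * ln K.+1%:R.

Definition cost1 : R := l0%:R * ln K.+1%:R.

Let total := mprod A 0 n.+1 (v 0%N) (v n.+1).

Let total_gt0 : 0 < total.
Proof. exact: lt_le_trans v_gt0 (pathw_le_mprod A0 _ _). Qed.

Lemma totalE t : (t <= n.+1)%N -> total =
  \sum_i mprod A 0 t (v 0%N) i * mprod A t n.+1 i (v n.+1).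
Proof. by move=> tn; rewrite /total (@mprod_cat _ _ A t)// mxE. Qed.

Lemma cost1_ge0 : 0 <= cost1.
Proof. by rewrite mulr_ge0// ln_ge0// ler1n. Qed.

Lemma cost0_ge0 : 0 <= cost0.
Proof.
have [d0 d1] := andP delta01.
rewrite addr_ge0 ?mulr_ge0 ?ln_ge0 ?ler1n// ler_pdivlMr ?exprn_gt0// mul1r.
apply: (@le_trans _ _ 1); first by rewrite exprn_ile1// ltW.
by rewrite !exprn_ege1// ler1n.
Qed.

Lemma smoothed_bounds t : (0 < t <= n)%N -> 0 < smoothed t <= 1 /\
  log_cost t <= cost0 + cost1 * (right_gap t + left_gap t)%:R.
Proof.
move=> tn; have [w [w' [tw ww' wk wg aw]]] := right_anchor tn.
have [u [u' [uu' uk ug au]]] := left_anchor tn.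
have [d0 d1] := andP delta01.
set g := (right_gap t + left_gap t)%N.
have k1 : 1 <= K.+1%:R :> R by rewrite ler1n.
have k0 : 0 < K.+1%:R :> R by rewrite ltr0n.
pose lb := delta ^+ 4 / ((K.+1%:R ^+ r.+1) ^+ 2 * K.+1%:R ^+ ((g + 2) * l0 + 2)).
have lb0 : 0 < lb by rewrite divr_gt0 ?mulr_gt0 ?exprn_gt0.
have lbS : lb <= smoothed t.
  rewrite /smoothed ler_pdivlMr//.
  have [uu2 ut] := andP uu'; have [ww2 wn] := andP ww'.
  have := optimal_state_lb A0 uu2 (leq_trans ut tw) ww2 wn d0 au aw uk wk vopt v_gt0 ut tw.
  apply: le_trans; rewrite ler_wpM2r ?(ltW total_gt0)// ler_wpM2l ?exprn_ge0 ?(ltW d0)//.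
  rewrite lef_pV2 ?posrE ?mulr_gt0 ?exprn_gt0// ler_wpM2l ?exprn_ge0 ?(ltW k0)//.
  rewrite ler_weXn2l// leq_add2r /g; lia.
have S0 : 0 < smoothed t by exact: lt_le_trans lbS.
split.
  rewrite S0/= /smoothed ler_pdivrMr// mul1r -/total (@totalE t); last first.
    by case/andP: tn => _ /leqW.
  rewrite (bigD1 (v t))//= lerDl sumr_ge0// => i _.
  by rewrite mulr_ge0//; apply: mprod_ge0.
rewrite /log_cost; apply: (@le_trans _ _ (- ln lb)).
  by rewrite lerN2 ler_ln.
rewrite /lb invfM mulrA lnM ?posrE ?divr_gt0 ?invr_gt0 ?exprn_gt0//.
rewrite lnV ?posrE ?exprn_gt0// lnXn// opprD opprK.
have -> : delta ^+ 4 / (K.+1%:R ^+ r.+1) ^+ 2 =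
    ((K.+1%:R ^+ r.+1) ^+ 2 / delta ^+ 4)^-1 :> R by rewrite invf_div.
rewrite lnV ?posrE ?divr_gt0 ?exprn_gt0// opprK -[ln _ *+ _]mulr_natl /cost0 -[leRHS]addrA lerD2l.
rewrite /cost1 le_eqVlt; apply/orP; left; apply/eqP.
have -> : ((g + 2) * l0 + 2)%:R = l0%:R * g%:R + (2 * l0 + 2)%:R :> R.
  by rewrite -natrM -natrD; congr (_%:R); rewrite mulnDl mulnC addnA.
ring.
Qed.

Lemma log_cost_ge0 t : (0 < t <= n)%N -> 0 <= log_cost t.
Proof.
by move=> /smoothed_bounds[/andP[s0 s1] _]; rewrite oppr_ge0 ln_le0.
Qed.

(** Bounds the part of all gaps beyond the first [b] terms. Windows may run past [n] here, so that
    each summand depends only on the observations after [s]. *)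
Definition excess b := (\sum_(1 <= s < n.+1) \sum_(b.+1 <= J < n.+1) nb s J)%N.

Lemma right_gap_le b t :
  (right_gap t <= b + \sum_(b.+1 <= J < n.+1) nb t J)%N.
Proof.
rewrite /right_gap; have [nb_|bn] := leqP n b.
  apply: leq_trans (leq_addr _ _); apply: leq_trans nb_.
  apply: (@leq_trans (\sum_(1 <= J < n.+1) 1)); first by apply: leq_sum => J _; case: (_ && _).
  by rewrite sum_nat_const_nat muln1 subn1.
rewrite (@big_cat_nat _ _ _ b.+1)//=; last by rewrite ltnS ltnW.
apply: leq_add; last by apply: leq_sum => J _; case: (nb t J); rewrite ?andbT ?andbF// leq_b1.
apply: (@leq_trans (\sum_(1 <= J < b.+1) 1)); first by apply: leq_sum => J _; case: (_ && _).
by rewrite sum_nat_const_nat muln1 subn1.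
Qed.

Lemma left_gap_le b t : (left_gap t <=
  b + \sum_(b.+1 <= J < n.+1) ((J * l0 < t)%N && nb (t - J * l0) J))%N.
Proof.
rewrite /left_gap; have [nb_|bn] := leqP n b.
  apply: leq_trans (leq_addr _ _); apply: leq_trans nb_.
  apply: (@leq_trans (\sum_(1 <= J < n.+1) 1)); first by apply: leq_sum => J _; case: (_ && _).
  by rewrite sum_nat_const_nat muln1 subn1.
rewrite (@big_cat_nat _ _ _ b.+1)//=; last by rewrite ltnS ltnW.
apply: leq_add => //.
apply: (@leq_trans (\sum_(1 <= J < b.+1) 1)); first by apply: leq_sum => J _; case: (_ && _).
by rewrite sum_nat_const_nat muln1 subn1.
Qed.

(** Windows counted by a left gap start at [t - J * l0], so for fixed [J] both kinds of gaps lead to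
    sums over starting times. The set [I] is arbitrary: for few times the first term is small, while
    the second does not depend on [I]. *)
Lemma sum_log_cost b (I : pred nat) :
  \sum_(1 <= t < n.+1 | I t) log_cost t <=
  (cost0 + cost1 * (2 * b)%:R) * (\sum_(1 <= t < n.+1 | I t) 1)%:R +
  cost1 * (2 * excess b)%:R.
Proof.
pose E t := (\sum_(b.+1 <= J < n.+1) nb t J +
  \sum_(b.+1 <= J < n.+1) ((J * l0 < t)%N && nb (t - J * l0) J))%N.
have sumE : (\sum_(1 <= t < n.+1 | I t) E t <= 2 * excess b)%N.
  apply: (@leq_trans (\sum_(1 <= t < n.+1) E t)).
    by rewrite [leqRHS](bigID I)/= leq_addr.
  rewrite big_split/= mul2n -addnn leq_add2l /excess.
  rewrite exchange_big_nat/= [leqRHS]exchange_big_nat/=.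
  apply: leq_sum => J _.
  apply: leq_trans (sum_shift_le (fun s => nb s J : nat) (J * l0) n).
  rewrite [leqRHS]big_mkcond/=; apply: leq_sum => t _.
  by case: (_ < _)%N.
apply: (@le_trans _ _ (\sum_(1 <= t < n.+1 | I t)
    (cost0 + cost1 * (2 * b)%:R + cost1 * (E t)%:R))).
  rewrite big_nat_cond [leRHS]big_nat_cond; apply: ler_sum => t /andP[tn _].
  have [_ h] := smoothed_bounds tn; apply: le_trans h _.
  rewrite -[leRHS]addrA lerD2l -mulrDr ler_wpM2l ?cost1_ge0// -natrD ler_nat.
  have := right_gap_le b t; have := left_gap_le b t; rewrite /E; lia.
rewrite big_split/= -mulr_sumr -natr_sum; apply: lerD; last first.
  by rewrite ler_wpM2l ?cost1_ge0// ler_nat.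
by rewrite natr_sum mulr_sumr; apply: ler_sum => t _; rewrite mulr1.
Qed.

Lemma window_anchored s J : (0 < s)%N -> (s + J * l0 <= n)%N -> ~~ nb s J ->
  anchored delta (mprod A s (s + J * l0)).
Proof.
move=> s0 sn nbs; have [u [su uJ anch]] := nb_anch s0 sn nbs.
rewrite (@mprod_cat _ _ A u)//; last by lia.
rewrite (@mprod_cat _ _ A (u + r.+1) u)//; last exact: leq_addr.
by apply: anchored_mull; [exact: mprod_ge0|apply: anchored_mulr => //; exact: mprod_ge0].
Qed.

(** Each of the [b + 1] stretches of length [J * l0] on either side of [t] contains a block, one
    contraction per stretch. *)
Definition good_window b J t := let k := (b.+1 * (J * l0))%N in
  [/\ (k < t)%N, (t + k <= n)%N,
      forall i, (i <= b)%N -> ~~ nb (t - k + i * (J * l0)) J &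
      forall i, (i <= b)%N -> ~~ nb (t + i * (J * l0)) J].

(** The blocks in the two stretches next to [t] bound both gaps by [J], since longer windows contain
    them too. This bound later serves as the truncation level. *)
Lemma good_window_cost b J t : (0 < J)%N -> good_window b J t ->
  log_cost t <= cost0 + cost1 * (2 * J)%:R.
Proof.
set l := (J * l0)%N => J0 [/= kt tk gl gr].
have [|_ h] := @smoothed_bounds t; first by lia.
apply: le_trans h _; rewrite lerD2l ler_wpM2l ?cost1_ge0// ler_nat mul2n -addnn.
have nJ : (J <= n)%N.
  have : (J * 1 <= J * l0)%N by rewrite leq_mul2l l0_gt0 orbT.
  rewrite -/l; move: tk; rewrite -/l mulSn; lia.
have gap_le (F : nat -> bool) : (forall J', (J <= J')%N -> ~~ F J') ->
    (\sum_(1 <= J' < n.+1) F J' <= J)%N.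
  move=> h'; rewrite (@big_cat_nat _ _ _ J)//=; last exact: leqW.
  rewrite [X in (_ + X)%N]big_nat_cond [X in (_ + X)%N]big1 ?addn0; last first.
    by move=> J' /andP[/andP[JJ' _] _]; rewrite (negbTE (h' _ JJ')).
  apply: (@leq_trans (\sum_(1 <= J' < J) 1)).
    by apply: leq_sum => J' _; case: (F J').
  by rewrite sum_nat_const_nat muln1 leq_subr.
apply: leq_add; apply: gap_le => J' JJ'; apply/negP => /andP[h' nbJ'].
  have := gr 0%N (leq0n _); rewrite mul0n addn0 => /negP; apply.
  by apply: nb_sub nbJ' => //; rewrite leq_add2l leq_mul2r JJ' orbT.
have := gl b (leqnn _) => /negP; apply.
apply: nb_sub nbJ'.
  have : (J * l0 <= J' * l0)%N by rewrite leq_mul2r JJ' orbT.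
  move: kt; rewrite -/l mulSn; lia.
move: kt; rewrite -/l mulSn; lia.
Qed.

Lemma good_window_close b J t : (0 < J)%N -> good_window b J t ->
  let k := (b.+1 * (J * l0))%N in
  `|log_cost t + ln (window_posterior (fun u => A (t - k + u)%N) k (v t))| <=
  2%:R * (delta ^- 2 * (1 - delta) ^+ b).
Proof.
set l := (J * l0)%N => J0 [/=]; set k := (b.+1 * l)%N => kt tk gl gr.
have tn : (0 < t <= n)%N by lia.
have [/andP[S0 S1] _] := smoothed_bounds tn.
have M0 s u i j : 0 <= mprod A s u i j by exact: mprod_ge0.
set L := mprod A 0 t; set M := mprod A t n.+1.
have LM0 : 0 < L (v 0%N) (v t) * M (v t) (v n.+1).
  by move: S0; rewrite /smoothed pmulr_lgt0// invr_gt0.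
have L0 : 0 < L (v 0%N) (v t).
  by rewrite lt_neqAle M0 andbT eq_sym; apply: contraTneq LM0 => ->; rewrite mul0r ltxx.
have R0 : 0 < M (v t) (v n.+1).
  by rewrite lt_neqAle M0 andbT eq_sym; apply: contraTneq LM0 => ->; rewrite mulr0 ltxx.
have kl i : (i <= b)%N -> (i * l + l <= k)%N.
  by move=> ib; rewrite /k -mulSnr leq_mul2r ltnS ib orbT.
have LE : row (v 0%N) (mprod A 0 (t - k)) *m mprod A (t - k) (t - k + b.+1 * l)
    = row (v 0%N) L.
  rewrite -row_mul subnK ?(ltnW kt)//; congr (row _ _).
  by rewrite /L (@mprod_cat _ _ A (t - k) 0 t) ?leq_subr//.
have ME : mprod A t (t + b.+1 * l) *m col (v n.+1) (mprod A (t + k) n.+1)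
    = col (v n.+1) M.
  rewrite !colE mulmxA; congr (_ *m _).
  by rewrite /M (@mprod_cat _ _ A (t + k) t n.+1) ?leq_addr// leqW.
have [|||lo [hi [lo0 lohi hilo sw]]] :=
  @left_sandwich _ _ A delta b l (t - k) (row (v 0%N) (mprod A 0 (t - k))) A0 delta01.
- move=> i ib; have := kl i ib => kli.
  rewrite mulSnr addnA; apply: window_anchored (gl i ib).
    by rewrite addn_gt0 subn_gt0 kt.
  by rewrite -addnA; apply: leq_trans tk; exact: leq_add (leq_subr _ _) kli.
- by move=> j; rewrite mxE.
- by exists (v t); rewrite LE mxE.
have [|||lo2 [hi2 [lo20 lohi2 hilo2 sw2]]] :=
  @right_sandwich _ _ A delta b l t (col (v n.+1) (mprod A (t + k) n.+1)) A0 delta01.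
- move=> i ib; have := kl i ib => kli.
  rewrite mulSnr addnA; apply: window_anchored (gr i ib).
    by rewrite addn_gt0 (leq_ltn_trans _ kt).
  by rewrite -addnA; apply: leq_trans tk; rewrite leq_add2l.
- by move=> j; rewrite mxE.
- by exists (v t); rewrite ME mxE.
have tkk : (t - k + b.+1 * l = t)%N by rewrite subnK// ltnW.
rewrite LE tkk in sw; rewrite ME -/k in sw2.
rewrite /log_cost /window_posterior !mprod_shift addn0 addnA subnK ?(ltnW kt)//.
rewrite /smoothed -/total (@totalE t) ?leqW//; last by case/andP: tn.
set al : 'rV[R]_K.+1 := const_mx 1 *m mprod A (t - k) t.
set be : 'cV[R]_K.+1 := mprod A t (t + k) *m const_mx 1.
rewrite addrC -normrN opprD opprK addrC.
apply: le_trans (@posterior_ln_close R K (fun i => L (v 0%N) i) (fun i => al 0 i)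
  (fun i => M i (v n.+1)) (fun i => be i 0) lo hi lo2 hi2 (v t) _ _ _ _ lo0 lohi lo20 lohi2 _ _ LM0) _ => //.
- by move=> i; exact: M0.
- by move=> i; exact: M0.
- by move=> i; rewrite mxE sumr_ge0// => j _; rewrite mulr_ge0// mxE.
- by move=> i; rewrite mxE sumr_ge0// => j _; rewrite mulr_ge0// mxE.
- by move=> i; have := sw i; rewrite [row _ _ _ _]mxE.
- by move=> i; have := sw2 i; rewrite [col _ _ _ _]mxE.
rewrite mulr_natl mulr2n; apply: lerD; by rewrite ler_pdivrMr.
Qed.

(** A bad time is within [k] of an end, or beyond [s], or has a blockless stretch; a given blockless
    stretch is charged at most once for each of its [2 * (b + 1)] positions relative to [t]. *)
Lemma bad_windows b J s :
  (\sum_(1 <= t < n.+1 | ~~ (`[< good_window b J t >] && (t <= s))) 1 <=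
   2 * (b.+1 * (J * l0)) + (n - s) + 2 * b.+1 * \sum_(1 <= u < n.+1) nb u J)%N.
Proof.
set l := (J * l0)%N; set k := (b.+1 * l)%N; set N := (\sum_(1 <= u < n.+1) _)%N.
have lt_count m : (\sum_(1 <= t < n.+1) (t <= m) <= m)%N.
  have [nm|mn] := leqP n m.
    apply: leq_trans nm; apply: (@leq_trans (\sum_(1 <= t < n.+1) 1)).
      by apply: leq_sum => t _; exact: leq_b1.
    by rewrite sum_nat_const_nat muln1 subn1.
  rewrite (@big_cat_nat _ _ _ m.+1)//=; last exact: leqW.
  rewrite [X in (_ + X)%N]big_nat_cond [X in (_ + X)%N]big1 ?addn0; last first.
    by move=> t /andP[/andP[mt _] _]; rewrite leqNgt mt.
  apply: (@leq_trans (\sum_(1 <= t < m.+1) 1)).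
    by apply: leq_sum => t _; exact: leq_b1.
  by rewrite sum_nat_const_nat muln1 subn1.
have gt_count m : (\sum_(1 <= t < n.+1) (m < t) <= n - m)%N.
  rewrite big_nat_rev/=; apply: leq_trans (lt_count (n - m)%N).
  rewrite big_nat_cond [leqRHS]big_nat_cond; apply: leq_sum => t /andP[/andP[t1 tn] _].
  by case: (ltnP m (1 + n.+1 - t.+1)) => // h; rewrite lt0b; lia.
apply: (@leq_trans (\sum_(1 <= t < n.+1) ((t <= k) + (n - k < t) + (s < t) +
   (\sum_(i < b.+1) ((k - i * l < t) && nb (t - (k - i * l)) J) +
    \sum_(i < b.+1) ((t + i * l <= n) && nb (t + i * l) J)))))%N.
  rewrite big_mkcond; apply: leq_sum => t _.
  case: ifP => // h; rewrite lt0n; apply/negP; rewrite !addn_eq0 !eqb0 -!leqNgt -!ltnNge.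
  move=> /andP[/andP[/andP[kt tk] ts] /andP[]]; rewrite !sum_nat_eq0 => /forallP hl /forallP hr.
  move: h => /negP; apply; rewrite ts andbT; apply/asboolP; split => //=.
  - by rewrite -leq_subRL; lia.
  - move=> i ib; have /= := hl (Ordinal (ib : (i < b.+1)%N)).
    rewrite eqb0 negb_and.
    have il : (i * l <= k)%N by rewrite leq_mul2r (leqW ib) orbT.
    rewrite (_ : t - (k - i * l) = t - k + i * l)%N; last by lia.
    by case/orP => //; lia.
  - move=> i ib; have /= := hr (Ordinal (ib : (i < b.+1)%N)).
    rewrite eqb0 negb_and.
    have il : (i * l <= k)%N by rewrite leq_mul2r (leqW ib) orbT.
    by case/orP => //; lia.
rewrite !big_split/=.
have left_count : (\sum_(1 <= t < n.+1) \sum_(i < b.+1)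
    ((k - i * l < t) && nb (t - (k - i * l)) J) <= b.+1 * N)%N.
  rewrite exchange_big/=; apply: (@leq_trans (\sum_(i < b.+1) N)); last first.
    by rewrite sum_nat_const card_ord.
  apply: leq_sum => i _.
  apply: leq_trans (sum_shift_le (fun u => nb u J : nat) (k - i * l) n).
  rewrite [leqRHS]big_mkcond; apply: leq_sum => t _.
  by case: (ltnP (k - i * l) t).
have right_count : (\sum_(1 <= t < n.+1) \sum_(i < b.+1)
    ((t + i * l <= n) && nb (t + i * l) J) <= b.+1 * N)%N.
  rewrite exchange_big/=; apply: (@leq_trans (\sum_(i < b.+1) N)); last first.
    by rewrite sum_nat_const card_ord.
  apply: leq_sum => i _.
  apply: leq_trans (sum_shift_ge (fun u => nb u J : nat) (i * l) n).
  rewrite [leqRHS]big_mkcond; apply: leq_sum => t _.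
  by case: (leqP (t + i * l) n).
have h1 := lt_count k; have h2 := gt_count (n - k)%N; have h3 := gt_count s.
rewrite mul2n -addnn -mulnA mul2n -addnn.
apply: leq_add; last exact: leq_add.
apply: leq_add => //; apply: leq_add => //.
by apply: leq_trans h2 _; rewrite leq_subLR; lia.
Qed.

(** At good times the summands are compared one by one; elsewhere the two sums are bounded
    separately. [I2] lists the good times in the indexing of [Phi], so both complements have the
    same size. *)
Lemma window_comparison (Phi : nat -> R) B e b b' J s :
  (0 < J)%N -> 0 <= e -> (forall i, 0 <= Phi i <= B) ->
  (forall t, (t <= s)%N -> good_window b J t ->
     `|log_cost t - Phi (t - (b.+1 * (J * l0)).+1)%N| <= e) ->
  `|\sum_(1 <= t < n.+1) log_cost t - \sum_(0 <= i < n) Phi i| <=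
  e * n%:R + (cost0 + cost1 * (2 * b')%:R + B) *
    (2 * (b.+1 * (J * l0)) + (n - s) +
      2 * b.+1 * \sum_(1 <= u < n.+1) nb u J)%N%:R +
  cost1 * (2 * excess b')%:R.
Proof.
set k := (b.+1 * (J * l0))%N => J0 e0 PhiB close.
set bad := (_ + _ + _)%N.
pose I t := `[< good_window b J t >] && (t <= s)%N.
pose I2 i := (i + k.+1 <= n)%N && I (i + k.+1)%N.
have Ik t : I t -> (k < t)%N by case/andP => /asboolP[].
have B0 : 0 <= B by have /andP[h1 h2] := PhiB 0%N; exact: le_trans h2.
have nI : (\sum_(1 <= t < n.+1 | ~~ I t) 1 <= bad)%N by exact: bad_windows.
have nI2 : \sum_(0 <= i < n | ~~ I2 i) (1 : R) = (\sum_(1 <= t < n.+1 | ~~ I t) 1)%:R.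
  have h1 : \sum_(0 <= i < n) (1 : R) = n%:R.
    by rewrite big_const_nat iter_addr_0 subn0.
  have h2 : \sum_(1 <= i < n.+1) (1 : R) = n%:R.
    by rewrite big_const_nat iter_addr_0 subn1.
  have := sum_window_shift (fun=> 1 : R) n Ik.
  rewrite (bigID I2)/= in h1; rewrite (bigID I)/= in h2.
  rewrite natr_sum -/I2 => h3; apply: (@addrI _ (\sum_(0 <= i < n | I2 i) 1)).
  by rewrite h1 h3.
rewrite (bigID I)/= [X in _ - X](bigID I2)/=.
rewrite (sum_window_shift Phi n Ik) opprD addrACA -sumrB -addrA.
apply: le_trans (ler_normD _ _) _; apply: lerD.
  apply: le_trans (ler_norm_sum _ _ _) _.
  apply: (@le_trans _ _ (\sum_(1 <= t < n.+1) e)).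
    rewrite [leRHS](bigID I)/= -[leLHS]addr0 lerD ?sumr_ge0//.
    by apply: ler_sum => t /andP[/asboolP g ts]; exact: close.
  by rewrite big_const_nat iter_addr_0 subn1 mulr_natr.
have c0 : 0 <= cost0 + cost1 * (2 * b')%:R.
  by rewrite addr_ge0 ?cost0_ge0// mulr_ge0 ?cost1_ge0.
have L0 : 0 <= \sum_(1 <= t < n.+1 | ~~ I t) log_cost t.
  by rewrite big_nat_cond sumr_ge0// => t /andP[tn _]; exact: log_cost_ge0.
have P0 : 0 <= \sum_(0 <= i < n | ~~ I2 i) Phi i.
  by rewrite sumr_ge0// => i _; case/andP: (PhiB i).
have L1 := sum_log_cost b' (fun t => ~~ I t).
have P1 : \sum_(0 <= i < n | ~~ I2 i) Phi i <= B * bad%:R.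
  apply: (@le_trans _ _ (\sum_(0 <= i < n | ~~ I2 i) (B * 1))).
    by apply: ler_sum => i _; rewrite mulr1; case/andP: (PhiB i).
  by rewrite -mulr_sumr nI2 ler_wpM2l// ler_nat.
have L2 : \sum_(1 <= t < n.+1 | ~~ I t) log_cost t <=
    (cost0 + cost1 * (2 * b')%:R) * bad%:R + cost1 * (2 * excess b')%:R.
  apply: le_trans L1 _; rewrite lerD2r ler_wpM2l// ler_nat; exact: nI.
have c1 : 0 <= cost1 * (2 * excess b')%:R by rewrite mulr_ge0 ?cost1_ge0.
have c2 : 0 <= (cost0 + cost1 * (2 * b')%:R) * bad%:R by rewrite mulr_ge0.
rewrite ler_norml; rewrite [in X in X && _]mulrDl [in X in _ && X]mulrDl.
have c3 : 0 <= B * bad%:R by rewrite mulr_ge0.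
apply/andP; split; lra.
Qed.

End PathBounds.

(** * Window functionals *)

Section WindowFunctional.
Context {d d' : measure_display} {Omega : measurableType d}
  {X : measurableType d'} {R : realType} {K : nat}.
Variable (P : probability Omega R).
Variables (Xt : nat -> {RV P >-> X}) (Yt : nat -> {RV P >-> 'I_K.+1}).
Variables (mu : {measure set X -> \bar R}) (p : 'M[R]_K.+1).
Variables (Ps : 'I_K.+1 -> probability X R) (f : 'I_K.+1 -> X -> R).
Hypothesis hmm : ergodic_hmm Xt Yt mu p Ps f.
Variables (C : {set 'I_K.+1}) (r : nat) (Xo : set X).
Hypothesis hXo : observation_set mu f C Xo.

Let E := seqspace (X * 'I_K.+1 * 'I_K.+1)%type.

Let obs_part (z : E) (t : nat) : X := (z t).1.1.

Let measurable_obs_part t : measurable_fun [set: E] (fun z => obs_part z t).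
Proof.
apply: measurableT_comp; first exact: measurable_fst.
by apply: measurableT_comp; [exact: measurable_fst|exact: measurable_coordinate].
Qed.

Lemma measurable_mprod_hmat s t i j :
  measurable_fun [set: E] (fun z => mprod (hmat p f (obs_part z)) s t i j).
Proof.
have [ts|st] := leqP t s.
  rewrite (_ : (fun z : E => _) = cst ((1 : 'M[R]_K.+1) i j)).
    exact: measurable_cst.
  by apply/funext => z; rewrite /mprod big_geq.
elim: t st i j => // t IH; rewrite ltnS leq_eqVlt => /orP[/eqP <- i j|st i j].
  rewrite (_ : (fun z : E => _) =
      (fun z => p i j * emis f j (obs_part z s.+1))); last first.
    by apply/funext => z; rewrite /mprod big_nat1 mxE.
  apply: measurable_funM; first exact: measurable_cst.
  by apply: measurableT_comp; [exact: (measurable_emis hmm)|exact: measurable_obs_part].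
rewrite (_ : (fun z : E => _) = (fun z => \sum_k
    mprod (hmat p f (obs_part z)) s t i k * (p k j * emis f j (obs_part z t.+1)))).
  apply: measurable_sum => k; apply: measurable_funM; first exact: IH.
  apply: measurable_funM; first exact: measurable_cst.
  by apply: measurableT_comp; [exact: (measurable_emis hmm)|exact: measurable_obs_part].
apply/funext => z; rewrite mprodS ?(ltnW st)// mxE.
by apply: eq_bigr => k _; rewrite mxE.
Qed.

Lemma measurable_window_posterior k a :
  measurable_fun [set: E] (fun z => window_posterior (hmat p f (obs_part z)) k a).
Proof.
have m1 i : measurable_fun [set: E] (fun z =>
    ((const_mx 1 : 'rV_K.+1) *m mprod (hmat p f (obs_part z)) 0 k) 0 i).
  rewrite (_ : (fun z : E => _) = (fun z => \sum_j mprod (hmat p f (obs_part z)) 0 k j i)).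
    by apply: measurable_sum => j; exact: measurable_mprod_hmat.
  by apply/funext => z; rewrite mxE; apply: eq_bigr => j _; rewrite mxE mul1r.
have m2 i : measurable_fun [set: E] (fun z =>
    (mprod (hmat p f (obs_part z)) k (k + k) *m (const_mx 1 : 'cV_K.+1)) i 0).
  rewrite (_ : (fun z : E => _) = (fun z => \sum_j mprod (hmat p f (obs_part z)) k (k + k) i j)).
    by apply: measurable_sum => j; exact: measurable_mprod_hmat.
  by apply/funext => z; rewrite mxE; apply: eq_bigr => j _; rewrite mxE mulr1.
have M0 z s t i j : 0 <= mprod (hmat p f (obs_part z)) s t i j.
  by apply: mprod_ge0 => u; exact: (hmat_ge0 hmm).
apply: measurable_funM; first exact: measurable_funM.
pose S (z : E) := \sum_i
  ((const_mx 1 : 'rV_K.+1) *m mprod (hmat p f (obs_part z)) 0 k) 0 i *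
  (mprod (hmat p f (obs_part z)) k (k + k) *m (const_mx 1 : 'cV_K.+1)) i 0.
rewrite (_ : (fun z : E => _) = (fun z => S z `^ (-1))).
  apply: (measurableT_comp (measurable_powR (-1))).
  by apply: measurable_sum => i; exact: measurable_funM.
apply/funext => z; rewrite powR_inv1// sumr_ge0// => i _.
by rewrite !mxE mulr_ge0// sumr_ge0// => j _; rewrite mxE mulr_ge0.
Qed.

(** Clipping makes the functional bounded, hence integrable. For the level [B] used below the true
    cost at good times lies in [[0, B]], so clipping never increases the distance to it. *)
Definition window_cost (B : R) (k : nat) (z : nat -> X * 'I_K.+1 * 'I_K.+1) : R :=
  Num.min B (Num.max 0
    (- ln (window_posterior (hmat p f (fun t => (z t).1.1)) k (z k).2))).

Lemma window_cost_bounds B k z : 0 <= B -> 0 <= window_cost B k z <= B.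
Proof.
by move=> B0; rewrite /window_cost le_min B0 le_max lexx/= ge_min lexx.
Qed.

Lemma measurable_window_cost B k :
  measurable_fun [set: E] (window_cost B k : E -> R).
Proof.
apply: measurable_minr; first exact: measurable_cst.
apply: measurable_maxr; first exact: measurable_cst.
apply: measurable_funN.
apply: measurableT_comp; first exact: measurable_ln.
pose g n (z : E) := window_posterior (hmat p f (obs_part z)) k (inord n).
rewrite (_ : (fun z : E => _) = (fun z => g (nat_of_ord (z k).2) z)); last first.
  by apply/funext => z; rewrite /g inord_val.
apply: measurable_select => [|n]; last exact: measurable_window_posterior.
apply: measurableT_comp; first by move=> _ D _.
by apply: measurableT_comp; [exact: measurable_snd|exact: measurable_coordinate].
Qed.

Lemma measurable_no_block_seq s l :
  measurable [set z : E | no_block r Xo (obs_part z) s l].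
Proof.
have [mXo _ _ _] := hXo.
rewrite (_ : [set z | _] = \bigcap_(u in [set u | (s < u)%N /\ (u + r <= s + l)%N])
    \bigcup_(t in [set t | (u <= t <= u + r)%N])
      ((fun z : E => obs_part z t) @^-1` (~` Xo))).
  apply: bigcap_measurableType => u _; apply: bigcup_measurable => t _.
  rewrite -[X in measurable X]setTI; apply: measurable_obs_part => //.
  exact: measurableC.
apply/seteqP; split => z /= h.
  by move=> u [su ul]; have [t [tu nX]] := h u su ul; exists t.
by move=> u su ul; have [t tu nX] := h u (conj su ul); exists t.
Qed.

Lemma no_block_shift (x : nat -> X) s l :
  no_block r Xo (fun t => x (s + t)%N) 0 l <-> no_block r Xo x s l.
Proof.
split=> [nb u su ul|nb u u0 ul].
  have [||t [tu nX]] := nb (u - s)%N; [by rewrite subn_gt0|lia|].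
  by exists (s + t)%N; split => //; lia.
have [||t [tu nX]] := nb (s + u)%N; [lia|lia|].
exists (t - s)%N; split; first lia.
by rewrite subnKC//; lia.
Qed.

End WindowFunctional.

Lemma geometric_sum_le (R : realFieldType) (rho : R) n : 0 <= rho < 1 ->
  \sum_(i < n) rho ^+ i <= (1 - rho)^-1.
Proof.
move=> /andP[r0 r1]; have h : 0 < 1 - rho by rewrite subr_gt0.
rewrite -[leRHS]mul1r ler_pdivlMr// mulrC -opprB mulNr -subrX1 opprB.
by rewrite gerBl exprn_ge0.
Qed.

(** * Mean number of long blockless windows *)

Section TailCount.
Context {d d' : measure_display} {Omega : measurableType d}
  {X : measurableType d'} {R : realType} {K : nat}.
Variable (P : probability Omega R).
Variables (Xt : nat -> {RV P >-> X}).
Variables (mu : {measure set X -> \bar R}) (f : 'I_K.+1 -> X -> R).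
Variables (C : {set 'I_K.+1}) (r : nat) (Xo : set X).
Hypothesis hXo : observation_set mu f C Xo.
Variables (l0 : nat) (rho : R).
Hypothesis rho01 : 0 <= rho < 1.
Hypothesis tail : forall s k, (0 < s)%N ->
  (P [set w | no_block r Xo (Xt ^~ w) s (k * l0)] <= (rho ^+ k)%:E)%E.

Definition blockless (x : nat -> X) (s J : nat) : bool :=
  `[< no_block r Xo x s (J * l0) >].

Let E := seqspace (X * 'I_K.+1 * 'I_K.+1)%type.

(** The infinite series does not depend on [n], so that [excess] is bounded by a sum of forward
    shifts of one functional. *)
Definition long_gaps (b : nat) (x : nat -> X) : \bar R :=
  (\sum_(j <oo) ((blockless x 0 (b + j))%:R)%:E)%E.

Let term_ge0 b x j : (0 <= ((blockless x 0 (b + j))%:R : R)%:E)%E.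
Proof. by rewrite lee_fin. Qed.

Lemma blockless_shift x s J : blockless (fun t => x (s + t)%N) 0 J = blockless x s J.
Proof. by apply/asboolP/asboolP => /no_block_shift. Qed.

Lemma long_gaps_ge0 b x : (0 <= long_gaps b x)%E.
Proof. by apply: nneseries_ge0 => j _ _; exact: term_ge0. Qed.

Lemma measurable_blockless J : measurable_fun [set: E]
  (fun z : E => ((blockless (fun t => (z t).1.1) 0 J)%:R : R)).
Proof.
rewrite (_ : (fun z : E => _) =
    \1_[set z : E | no_block r Xo (fun t => (z t).1.1) 0 (J * l0)]).
  by apply: measurable_indic; exact: measurable_no_block_seq hXo _ _.
by apply/funext => z; rewrite indicE; congr (nat_of_bool _)%:R.
Qed.

Lemma measurable_long_gaps b : measurable_fun [set: E]
  (fun z : E => fine (long_gaps b (fun t => (z t).1.1))).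
Proof.
apply: measurableT_comp => //.
apply: (@ge0_emeasurable_sum _ E R setT
  (fun j (z : E) => ((blockless (fun t => (z t).1.1) 0 (b + j))%:R)%:E) xpredT).
  by move=> j z _ _; exact: term_ge0.
by move=> j _; apply/measurable_EFinP; exact: measurable_blockless.
Qed.

Lemma integral_blockless s J : (0 < s)%N ->
  (\int[P]_w ((blockless (Xt ^~ w) s J)%:R)%:E <= (rho ^+ J)%:E)%E.
Proof.
move=> s0; apply: le_trans (tail J s0).
pose N := [set w | no_block r Xo (Xt ^~ w) s (J * l0)].
rewrite (eq_integral (fun w => (\1_N w)%:E)); last first.
  by move=> w _; rewrite indicE; congr ((nat_of_bool _)%:R)%:E.
by rewrite integral_indic ?setIT//; exact: measurable_no_block hXo _ _.
Qed.

Let gaps b s w := long_gaps b (fun t => Xt (s + t)%N w).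

Lemma measurable_gaps b s : measurable_fun [set: Omega]
  (fun w => long_gaps b (fun t => Xt (s + t)%N w)).
Proof.
apply: (@ge0_emeasurable_sum _ Omega R setT (fun j w =>
  ((blockless (fun t => Xt (s + t)%N w) 0 (b + j))%:R)%:E) xpredT).
  by move=> j w _ _; exact: term_ge0.
move=> j _; apply/measurable_EFinP.
rewrite (_ : (fun w => _) = \1_[set w | no_block r Xo (Xt ^~ w) s ((b + j) * l0)]).
  by apply: measurable_indic; exact: measurable_no_block hXo _ _.
by apply/funext => w; rewrite (blockless_shift (Xt ^~ w)) indicE; congr (nat_of_bool _)%:R.
Qed.

Lemma integral_long_gaps b s : (0 < s)%N ->
  (\int[P]_w gaps b s w <= (rho ^+ b / (1 - rho))%:E)%E.
Proof.
move=> s0.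
have mN J : measurable_fun [set: Omega]
    (fun w => ((blockless (Xt ^~ w) s J)%:R : R)%:E).
  apply/measurable_EFinP.
  rewrite (_ : (fun w => _) = \1_[set w | no_block r Xo (Xt ^~ w) s (J * l0)]).
    by apply: measurable_indic; exact: measurable_no_block hXo _ _.
  by apply/funext => w; rewrite indicE; congr (nat_of_bool _)%:R.
rewrite (eq_integral (fun w => \sum_(j <oo) ((blockless (Xt ^~ w) s (b + j))%:R)%:E)%E); last first.
  by move=> w _; apply: eq_eseriesr => j _; rewrite (blockless_shift (Xt ^~ w)).
rewrite integral_nneseries//.
apply: lime_le.
  by apply: is_cvg_nneseries => j _ _; apply: integral_ge0 => w _; rewrite lee_fin.
apply: nearW => n; rewrite big_mkord.
apply: (@le_trans _ _ (\sum_(j < n) (rho ^+ (b + j))%:E)%E).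
  by apply: lee_sum => j _; exact: integral_blockless.
rewrite sumEFin lee_fin; under eq_bigr do rewrite exprD.
rewrite -mulr_sumr ler_wpM2l ?geometric_sum_le//.
by case/andP: rho01 => r0 _; rewrite exprn_ge0.
Qed.

Lemma integral_fine_long_gaps b s : (0 < s)%N ->
  (\int[P]_w (fine (gaps b s w))%:E <= (rho ^+ b / (1 - rho))%:E)%E.
Proof.
move=> s0; apply: le_trans (integral_long_gaps b s0).
apply: ge0_le_integral => //.
- by move=> w _; rewrite lee_fin fine_ge0// long_gaps_ge0.
- apply/measurable_EFinP; apply: measurableT_comp => //; exact: measurable_gaps.
- exact: measurable_gaps.
- move=> w _; have := long_gaps_ge0 b (fun t => Xt (s + t)%N w).
  by rewrite -/(gaps b s w); case: (gaps b s w) => //= _; rewrite leey.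
Qed.

(** Since [fine] sends [+oo] to [0], the series must first be shown finite; it is almost surely,
    having finite mean. *)
Lemma long_gaps_lb : {ae P, forall w, forall b s n, (0 < s)%N ->
  (\sum_(b <= J < n) blockless (Xt ^~ w) s J)%N%:R <=
    fine (long_gaps b (fun t => Xt (s + t)%N w))}.
Proof.
apply: (filterS (P := fun w => forall b s, gaps b s.+1 w \is a fin_num)); last first.
  apply: ae_foralln => b; apply: ae_foralln => s.
  have gi : P.-integrable setT (gaps b s.+1).
    apply/integrableP; split; first exact: measurable_gaps.
    rewrite (eq_integral (gaps b s.+1)); last first.
      by move=> w _; rewrite gee0_abs// long_gaps_ge0.
    by rewrite (le_lt_trans (integral_long_gaps b (ltn0Sn s)))// ltry.
  by apply: filterS (integrable_ae measurableT gi) => w; exact.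
move=> w fin b [//|s] n _; rewrite -lee_fin fineK; last exact: fin.
have [nb|bn] := leqP n b; first by rewrite big_geq// long_gaps_ge0.
have -> : (\sum_(b <= J < n) blockless (Xt ^~ w) s.+1 J =
    \sum_(0 <= j < n - b) blockless (Xt ^~ w) s.+1 (b + j))%N.
  by rewrite -{1}[b]add0n big_addn; apply: eq_bigr => j _; rewrite addnC.
rewrite natr_sum -sumEFin.
apply: le_trans (nneseries_lim_ge (n - b) (P := xpredT) _); last first.
  by move=> j _ _; exact: term_ge0.
by rewrite le_eqVlt; apply/orP; left; apply/eqP/eq_bigr => j _; rewrite (blockless_shift (Xt ^~ w)).
Qed.

Lemma excess_le_long_gaps : {ae P, forall w, forall b n,
  (excess n (blockless (Xt ^~ w)) b)%:R <=
    \sum_(i < n) fine (long_gaps b.+1 (fun t => Xt (i.+1 + t)%N w))}.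
Proof.
apply: filterS long_gaps_lb => w h b n.
rewrite /excess natr_sum big_add1 big_mkord.
by apply: ler_sum => i _; exact: h.
Qed.

End TailCount.

(** * Pathwise bounds on the risk *)

Section RiskBounds.
Context {d d' : measure_display} {Omega : measurableType d}
  {X : measurableType d'} {R : realType} {K : nat}.
Variable (P : probability Omega R).
Variables (Xt : nat -> {RV P >-> X}) (Yt : nat -> {RV P >-> 'I_K.+1}).
Variables (mu : {measure set X -> \bar R}) (p : 'M[R]_K.+1).
Variables (Ps : 'I_K.+1 -> probability X R) (f : 'I_K.+1 -> X -> R).
Hypothesis hmm : ergodic_hmm Xt Yt mu p Ps f.
Variables (r : nat) (Xo : set X).
Variables (q : forall n, n.-tuple 'I_K.+1 -> n.-tuple X -> R)
  (pt : forall n, 'I_n -> 'I_K.+1 -> n.-tuple X -> R)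
  (v : forall n, n.-tuple X -> n.-tuple 'I_K.+1).
Arguments q {n}. Arguments pt {n}. Arguments v {n}.
Hypothesis hq : path_posterior Xt Yt (@q).
Hypothesis hpt : state_posterior Xt Yt (@pt).
Hypothesis hv : viterbi_alignment (@q) (@v).

Notation weights n w := (hmat_n Yt p f (Xt ^~ w) n).
Notation aligned n w := (ext_path (v (obs Xt n w))).

Definition optimally_aligned n w : Prop :=
  [/\ forall y, y 0%N = aligned n w 0 -> y n.+1 = aligned n w n.+1 ->
        pathw (weights n w) y 0 n.+1 <= pathw (weights n w) (aligned n w) 0 n.+1,
      0 < pathw (weights n w) (aligned n w) 0 n.+1 &
      n%:R * R1_risk Xt (@pt) (@v) n w =
        \sum_(1 <= t < n.+1) log_cost (weights n w) n (aligned n w) t].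

Lemma optimally_aligned_as :
  {ae P, forall w, forall n, (0 < n)%N -> optimally_aligned n w}.
Proof.
apply: filterS (posteriors_as hmm hq hpt) => w h n n0.
have [e0 hqj hptj] := h n.
have jle s : joint Yt f s (obs Xt n w) <= joint Yt f (v (obs Xt n w)) (obs Xt n w).
  have [_ /(_ (obs Xt n w) s)] := hv n.
  by rewrite !hqj ler_pM2r ?invr_gt0.
split.
- by move=> y y0 yn; exact: (optimal_pathw hmm n0 jle y0 yn).
(* If the optimal path had weight zero, every path would, and the evidence would vanish. *)
- rewrite -(joint_pathw hmm)// ltNge; apply/negP => h0; move: e0.
  rewrite /evidence big1 ?ltxx// => s _; apply/eqP.
  by rewrite eq_le (le_trans (jle s) h0) (joint_ge0 hmm).
- rewrite /R1_risk mulrN mulrA mulfV ?mul1r ?pnatr_eq0 -?lt0n//.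
  rewrite big_add1 big_mkord -sumrN; apply: eq_bigr => i _.
  rewrite hptj (joint_through_mprod hmm) (evidence_mprod hmm)// /log_cost /smoothed.
  rewrite ext_path_last.
  have -> : aligned n w i.+1 = tnth (v (obs Xt n w)) i by rewrite (tnth_nth ord0).
  by [].
Qed.

Variables (delta : R) (l0 : nat).
Hypothesis delta01 : 0 < delta <= 1.
Hypothesis l0_gt0 : (0 < l0)%N.
Hypothesis block : forall (x : nat -> X) s,
  (forall t, (s < t <= s + r.+1)%N -> Xo (x t)) ->
  anchored delta (mprod (hmat p f x) s (s + r.+1)).

Notation nb w := (blockless r Xo l0 (Xt ^~ w)).
Notation c0 := (@cost0 R K r l0 delta).
Notation c1 := (@cost1 R K l0).

Let nb_anch w n s J : (0 < s)%N -> (s + J * l0 <= n)%N -> ~~ nb w s J ->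
  exists u, [/\ (s <= u)%N, (u + r.+1 <= s + J * l0)%N &
                anchored delta (mprod (weights n w) u (u + r.+1))].
Proof.
move=> s0 sn /asboolPn h.
have [u [su ul hu]] : exists u, [/\ (s < u)%N, (u + r <= s + J * l0)%N &
    forall t, (u <= t <= u + r)%N -> Xo (Xt t w)].
  apply: contrapT => h'; apply: h => u su ul; apply: contrapT => h2; apply: h'.
  exists u; split => // t tu; apply: contrapT => nX; apply: h2; by exists t.
have u0 : (0 < u)%N by exact: leq_ltn_trans su.
exists u.-1; rewrite addnS -addSn prednK//; split => //.
  by rewrite -ltnS prednK.
have E : (u + r = u.-1 + r.+1)%N by rewrite addnS -addSn prednK.
rewrite mprod_hmat_n; last exact: leq_trans sn; last first.
  by rewrite -ltnS prednK// (leq_trans _ su).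
by rewrite E; apply: block => t; rewrite addnS -addSn prednK//; exact: hu.
Qed.

Let nb_sub w s J s' J' : (s <= s')%N -> (s' + J' * l0 <= s + J * l0)%N ->
  nb w s J -> nb w s' J'.
Proof. by move=> ss sJ /asboolP h; apply/asboolP; exact: no_block_sub h. Qed.

Let first_anch w n : anchored delta (mprod (weights n w) 0 1).
Proof. by apply: (anchored_first hmm); case/andP: delta01. Qed.

Let last_anch w n : (0 < n)%N -> anchored delta (mprod (weights n w) n n.+1).
Proof. by move=> n0; apply: anchored_last => //; case/andP: delta01. Qed.

Lemma risk_ge0 n w : (0 < n)%N -> optimally_aligned n w ->
  0 <= R1_risk Xt (@pt) (@v) n w.
Proof.
move=> n0 [vopt vpos E]; rewrite -(@pmulr_rge0 _ n%:R) ?ltr0n// E big_nat_cond.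
apply: sumr_ge0 => t /andP[tn _].
exact: (log_cost_ge0 (hmat_n_ge0 hmm _ _) l0_gt0 n0 delta01 vopt vpos
  (first_anch w n) (last_anch w n0) (@nb_anch w n) tn).
Qed.

Lemma risk_ub b n w : (0 < n)%N -> optimally_aligned n w ->
  n%:R * R1_risk Xt (@pt) (@v) n w <=
  (c0 + c1 * (2 * b)%:R) * n%:R + c1 * (2 * excess n (nb w) b)%:R.
Proof.
move=> n0 [vopt vpos ->].
have := sum_log_cost (hmat_n_ge0 hmm _ _) l0_gt0 n0 delta01 vopt vpos
  (first_anch w n) (last_anch w n0) (@nb_anch w n) b predT.
by rewrite sum_nat_const_nat muln1 subn1.
Qed.

(** Up to [s] the finite alignment equals [V], so at good times the centre state read from [Zt] is
    the aligned one, and [window_comparison] applies. *)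
Lemma risk_window (vinf : (nat -> X) -> nat -> 'I_K.+1) B b b' J s n w :
  (0 < n)%N -> optimally_aligned n w -> (0 < J)%N -> c0 + c1 * (2 * J)%:R <= B ->
  (forall i : 'I_n, (i.+1 <= s)%N -> tnth (v (obs Xt n w)) i = Vt Xt vinf i.+1 w) ->
  let k := (b.+1 * (J * l0))%N in
  `|n%:R * R1_risk Xt (@pt) (@v) n w -
    \sum_(i < n) window_cost p f B k (fun u => Zt Xt Yt vinf (i.+1 + u) w)| <=
  2%:R * (delta ^- 2 * (1 - delta) ^+ b) * n%:R +
  (c0 + c1 * (2 * b')%:R + B) *
    (2 * k + (n - s) + 2 * b.+1 * \sum_(1 <= u < n.+1) nb w u J)%N%:R +
  c1 * (2 * excess n (nb w) b')%:R.
Proof.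
move=> n0 [vopt vpos ->] J0 cB agree /=; set k := (b.+1 * (J * l0))%N.
have d1 : 0 <= 1 - delta by rewrite subr_ge0; case/andP: delta01.
have d0 : 0 <= delta by case/andP: delta01 => /ltW.
have B0 : 0 <= B.
  by rewrite (le_trans _ cB)// addr_ge0 ?cost0_ge0// mulr_ge0 ?cost1_ge0.
rewrite -(big_mkord xpredT (fun i =>
  window_cost p f B k (fun u => Zt Xt Yt vinf (i.+1 + u) w))).
have H := hmat_n_ge0 hmm (Xt ^~ w) n.
apply: (window_comparison H l0_gt0 n0 delta01 vopt vpos (first_anch w n)
  (last_anch w n0) (@nb_anch w n)) => //.
- by rewrite !mulr_ge0// ?invr_ge0 exprn_ge0.
- by move=> i; exact: window_cost_bounds.
move=> t ts gw; have [kt tk _ _] := gw; rewrite -/k in kt tk.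
have tn : (0 < t <= n)%N by lia.
have close := good_window_close H l0_gt0 n0 delta01 vopt vpos (first_anch w n)
  (last_anch w n0) (@nb_anch w n) J0 gw.
have cost := good_window_cost H l0_gt0 n0 delta01 vopt vpos (first_anch w n)
  (last_anch w n0) (@nb_anch w n) (@nb_sub w) J0 gw.
have cost_0 := log_cost_ge0 H l0_gt0 n0 delta01 vopt vpos (first_anch w n)
  (last_anch w n0) (@nb_anch w n) tn.
apply: le_trans close; rewrite /window_cost.
set y := log_cost _ _ _ _ in cost cost_0 *.
have -> : window_posterior (hmat p f (fun u => (Zt Xt Yt vinf
      ((t - k.+1).+1 + u) w).1.1)) k (Zt Xt Yt vinf ((t - k.+1).+1 + k) w).2 =
    window_posterior (fun u => weights n w (t - k + u)%N) k (aligned n w t).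
  rewrite subnSK// subnK ?(ltnW kt)//.
  have -> : (Zt Xt Yt vinf t w).2 = aligned n w t.
    case: t ts tn {gw cost cost_0 kt tk y} => // t ts /andP[_ tn].
    by rewrite /= -(agree (Ordinal tn) ts) (tnth_nth ord0).
  have E s1 s2 : (s2 <= k + k)%N -> mprod (hmat p f (fun u => (Zt Xt Yt vinf
      (t - k + u) w).1.1)) s1 s2 = mprod (fun u => weights n w (t - k + u)%N) s1 s2.
    move=> s2k; apply: eq_big_nat => u /andP[_ us].
    rewrite hmat_n_inner; last 2 first.
      by rewrite addn_gt0 subn_gt0 kt.
    apply: leq_trans (_ : t - k + (k + k) <= n)%N; first by rewrite ltn_add2l (leq_trans us).
    by rewrite addnA subnK ?(ltnW kt).
    by rewrite /hmat addnS.
  by rewrite /window_posterior !E// leq_addr.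
set z := ln _.
have h : y <= B by exact: le_trans cB.
rewrite minEle maxEle; case: ifP; case: ifP => h1 h2; rewrite ler_norml;
  move: h1 h2; case: (ger0P (y + z)) => ? ? ?; lra.
Qed.

End RiskBounds.

(** * Convergence of the risk *)

Lemma geometric_small (R : realType) (x a eta : R) : 0 <= x < 1 -> 0 < eta ->
  exists n, a * x ^+ n <= eta.
Proof.
move=> /andP[x0 x1] eta0.
have x1' : `|x| < 1 by rewrite ger0_norm.
have /cvgrPdist_le/(_ _ eta0)[n _ /(_ n (leqnn n))/=] := cvg_geometric a x1'.
by rewrite sub0r normrN /geometric/= => h; exists n; exact: le_trans (ler_norm _) h.
Qed.

(** At [2 * n + 2] the power is at most [x ^ n * x ^ n]; one factor absorbs the linear term because
    [n * x ^ n] is at most the geometric sum. *)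
Lemma linear_geometric_small (R : realType) (x a b eta : R) :
  0 <= x < 1 -> 0 <= a -> 0 <= b -> 0 < eta ->
  exists2 n, (0 < n)%N & (a + b * n%:R) * x ^+ n <= eta.
Proof.
move=> x01 a0 b0 eta0; have [x0 x1] := andP x01.
have [n hn] := geometric_small (a + b * (2%:R / (1 - x) + 2%:R)) x01 eta0.
exists (n + n).+2 => //; apply: le_trans hn.
have nx : n%:R * x ^+ n <= (1 - x)^-1.
  apply: le_trans (geometric_sum_le n x01).
  rewrite mulr_natl -[X in _ *+ X]card_ord -sumr_const; apply: ler_sum => i _.
  by rewrite ler_wiXn2l ?(ltW x1)// ltnW.
have xn0 : 0 <= x ^+ n by rewrite exprn_ge0.
have xn1 : x ^+ n <= 1 by rewrite exprn_ile1 ?(ltW x1).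
apply: (@le_trans _ _ ((a + b * (2%:R * n%:R + 2%:R)) * (x ^+ n * x ^+ n))).
  rewrite -natrM -natrD mul2n -addnn addn2 -exprD.
  rewrite ler_wpM2l ?addr_ge0 ?mulr_ge0//.
  by rewrite -addn2 exprD ler_piMr ?exprn_ge0// expr2 mulr_ile1 ?(ltW x1).
rewrite mulrA ler_wpM2r// mulrDl; apply: lerD; first by rewrite ler_piMr.
rewrite -mulrA ler_wpM2l// mulrDl; apply: lerD; last by rewrite ler_piMr.
by rewrite -mulrA ler_wpM2l.
Qed.

Section AlmostSureLimit.
Context {d d' : measure_display} {Omega : measurableType d}
  {X : measurableType d'} {R : realType} {K : nat}.
Variable (P : probability Omega R).
Variables (Xt : nat -> {RV P >-> X}) (Yt : nat -> {RV P >-> 'I_K.+1}).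
Variables (mu : {measure set X -> \bar R}) (p : 'M[R]_K.+1).
Variables (Ps : 'I_K.+1 -> probability X R) (f : 'I_K.+1 -> X -> R).
Hypothesis hmm : ergodic_hmm Xt Yt mu p Ps f.
Variables (C : {set 'I_K.+1}) (r : nat) (Xo : set X).
Hypothesis hA1 : A1 p Ps f C r.
Hypothesis hXo : observation_set mu f C Xo.
Variables (q : forall n, n.-tuple 'I_K.+1 -> n.-tuple X -> R)
  (pt : forall n, 'I_n -> 'I_K.+1 -> n.-tuple X -> R)
  (v : forall n, n.-tuple X -> n.-tuple 'I_K.+1).
Arguments q {n}. Arguments pt {n}. Arguments v {n}.
Hypothesis hq : path_posterior Xt Yt (@q).
Hypothesis hpt : state_posterior Xt Yt (@pt).
Hypothesis hv : viterbi_alignment (@q) (@v).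
Hypothesis hcons : consistent Xt Yt Xo r (@v).

(** [c] is the limiting average of [window_cost]. The frequencies of blockless windows and of long
    gaps also converge, to limits bounded by their means at fixed times, so every error term of
    [risk_window] is eventually a small multiple of [n]. *)
Lemma risk_near_constant eps : 0 < eps ->
  exists c : R, {ae P, forall w, \forall n \near \oo,
    `|R1_risk Xt (@pt) (@v) n w - c| <= eps}.
Proof.
move=> eps0.
have [delta [delta01 block]] := block_anchored hmm hA1 hXo.
have [l0 [rho [l00 rho01 tail]]] := no_block_tail hmm hA1 hXo.
have [vinf [S [m [_ regZ _ agree _]]]] := hcons.
have S0 : {ae P, forall w, (0 < S 0%N w)%N}.
  by apply: filterS agree => w [h _ _]; exact: leq_trans h.
have [[mZ _] _ _ _ _] := regZ.
have [d0 d1] := andP delta01; have [rho0 rho1] := andP rho01.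
set c0 := @cost0 R K r l0 delta; set c1 := @cost1 R K l0.
have c00 : 0 <= c0 by exact: cost0_ge0.
have c10 : 0 <= c1 by exact: cost1_ge0.
(* One [eta] each goes to the window average, the forgetting error, the regeneration gap and the
   additive constants, two each to the blockless windows and to the excess. *)
pose eta := eps / 8%:R.
have eta0 : 0 < eta by rewrite divr_gt0.
have [b' hb'] := geometric_small (2%:R * c1 * rho / (1 - rho)) rho01 eta0.
have [b hb] : exists b, 2%:R * delta ^- 2 * (1 - delta) ^+ b <= eta.
  by apply: geometric_small => //; rewrite subr_ge0 d1/=; lra.
(* The bracket is the later [D], written out as an affine function of [J]: the truncation level
   grows with [J], but [rho ^ J] wins. *)
have [J J0 hJ] : exists2 J, (0 < J)%N &
    ((2%:R * c0 + c1 * (2 * b')%:R) * (2 * b.+1)%:R +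
      (2%:R * c1 * (2 * b.+1)%:R) * J%:R) * rho ^+ J <= eta.
  clearbody c0 c1.
  by apply: linear_geometric_small => //; do ?[apply: mulr_ge0|apply: addr_ge0].
pose B := c0 + c1 * (2 * J)%:R.
have B0 : 0 <= B.
  by rewrite /B; clearbody c0 c1; rewrite addr_ge0 ?mulr_ge0.
pose k := (b.+1 * (J * l0))%N.
pose E := seqspace (X * 'I_K.+1 * 'I_K.+1)%type.
have mshift s : measurable_fun [set: Omega]
    ((fun w t => Zt Xt Yt vinf (s + t) w) : Omega -> E).
  by apply: measurable_to_seqspace => t; exact: mZ.
have E1 s : (0 < s)%N -> (\int[P]_w (window_cost p f B k
    (fun t => Zt Xt Yt vinf (s + t) w))%:E <= B%:E)%E.
  move=> _; apply: (@le_trans _ _ (\int[P]_w (cst B%:E w))%E).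
    apply: ge0_le_integral => //.
    - by move=> w _; rewrite lee_fin; case/andP: (window_cost_bounds p f k (fun t => Zt Xt Yt vinf (s + t) w) B0).
    - apply/measurable_EFinP; apply: (measurableT_comp (measurable_window_cost hmm B k) (mshift s)).
    - by move=> w _; rewrite lee_fin; case/andP: (window_cost_bounds p f k (fun t => Zt Xt Yt vinf (s + t) w) B0).
  by rewrite integral_cst// [X in (_ * X)%E]probability_setT mule1.
have [c [_ _ lim1]] := regenerative_lln regZ S0 (measurable_window_cost hmm B k)
  (fun z => proj1 (andP (window_cost_bounds p f k z B0))) E1.
have E2 s : (0 < s)%N -> (\int[P]_w ((blockless r Xo l0
    (fun t => (Zt Xt Yt vinf (s + t) w).1.1) 0 J)%:R)%:E <= (rho ^+ J)%:E)%E.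
  move=> s0; apply: le_trans (integral_blockless hXo tail J s0).
  rewrite (eq_integral (fun w => ((blockless r Xo l0 (Xt ^~ w) s J)%:R)%:E))// => w _.
  by rewrite -(blockless_shift r Xo l0 (Xt ^~ w)).
have [cJ [_ cJle lim2]] := regenerative_lln regZ S0 (measurable_blockless r hXo l0 J)
  (fun z => ler0n _ _) E2.
have [cb [_ cble lim3]] := regenerative_lln regZ S0 (measurable_long_gaps r hXo l0 b'.+1)
  (fun z => fine_ge0 (long_gaps_ge0 r Xo l0 b'.+1 _))
  (fun s s0 => integral_fine_long_gaps hXo rho01 tail b'.+1 s0).
exists c.
have gap := regeneration_gap regZ S0 m.
have opt := optimally_aligned_as hmm hq hpt hv.
have exc := excess_le_long_gaps hXo rho01 tail.
pose Q := c0 + c1 * (2 * b')%:R + B.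
have Q0 : 0 <= Q.
  by rewrite /Q; clearbody c0 c1 B; rewrite !addr_ge0 ?mulr_ge0.
(* Tolerances [eta / (a + 1)] remain below [eta] after multiplication by their coefficient,
   including [a = 0]. *)
have small a : 0 <= a -> a * (eta / (a + 1)) <= eta.
  move=> a0; rewrite mulrA ler_pdivrMr ?ltr_wpDl// mulrC ler_wpM2l ?(ltW eta0)//.
  by rewrite lerDl.
have small0 a : 0 <= a -> 0 < eta / (a + 1).
  by move=> a0; rewrite divr_gt0// ltr_wpDl.
pose D := Q * (2 * b.+1)%:R.
have D0 : 0 <= D by rewrite mulr_ge0.
have DJ : D * cJ <= eta.
  apply: le_trans hJ; apply: (@le_trans _ _ (D * rho ^+ J)); first by rewrite ler_wpM2l.
  rewrite le_eqVlt; apply/orP; left; apply/eqP; congr (_ * _).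
  by rewrite /D /Q /B; clearbody c0 c1; rewrite (natrM _ 2 J); ring.
have Db : c1 * 2%:R * cb <= eta.
  apply: le_trans hb'; apply: le_trans (ler_wpM2l _ cble) _; first exact: mulr_ge0.
  rewrite le_eqVlt; apply/orP; left; apply/eqP; rewrite exprS; clearbody c0 c1; ring.
apply: filterS (filterI lim1 (filterI lim2 (filterI lim3
  (filterI gap (filterI opt (filterI exc agree)))))) =>
  w [l1 [l2 [l3 [g [al [ex ag]]]]]].
have [M hM] := g _ (small0 _ Q0).
have /cvgrPdist_le/(_ _ eta0) n1 := l1.
have /cvgrPdist_le/(_ _ (small0 _ D0)) n2 := l2.
have c20 : 0 <= c1 * 2%:R by exact: mulr_ge0.
have /cvgrPdist_le/(_ _ (small0 _ c20)) n3 := l3.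
have n4 := @nbhs_infty_ger R (Q * (M + (2 * k)%:R) / eta).
have n5 : \forall n \near \oo, (0 < n)%N by exists 1%N.
apply: filterS (filterI n1 (filterI n2 (filterI n3 (filterI n4 n5)))) =>
  n [m1 [m2 [m3 [m4 n0]]]].
have N0 : 0 < n%:R :> R by rewrite ltr0n.
have [s [sn hs gs]] := hM n.
have agree_s (i : 'I_n) : (i.+1 <= s)%N ->
    tnth (v (obs Xt n w)) i = Vt Xt vinf i.+1 w.
  move=> is_; case: hs => [s0|[j [sE hS]]]; first by rewrite s0 in is_.
  by case: ag => _ /(_ j n hS i) + _; apply; rewrite -sE.
have := risk_window hmm delta01 l00 block b b' n0 (al n n0) J0 (lexx B) agree_s.
rewrite /= -/k -/c0 -/c1 -/Q => main.
set u := (\sum_(1 <= u < n.+1) _)%N in main.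
set W := \sum_(i < n) _ in main.
have avg (x y z : R) : `|x - n%:R^-1 * y| <= z -> `|y - n%:R * x| <= n%:R * z.
  move=> h; rewrite -(ler_pM2l (_ : 0 < n%:R^-1)) ?invr_gt0// mulKf ?gt_eqF//.
  rewrite -{1}(ger0_norm (_ : 0 <= n%:R^-1)) ?invr_ge0// -normrM mulrBr mulKf ?gt_eqF//.
  by rewrite distrC.
have hW : `|W - n%:R * c| <= n%:R * eta by exact: avg m1.
have hu : u%:R <= n%:R * (cJ + eta / (D + 1)).
  have := avg _ _ _ m2; rewrite ler_norml => /andP[_].
  rewrite lerBlDr -mulrDr addrC; apply: le_trans.
  rewrite le_eqVlt; apply/orP; left; apply/eqP; rewrite /u natr_sum big_add1 big_mkord.
  by apply: eq_bigr => i _; rewrite -(blockless_shift r Xo l0 (Xt ^~ w)).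
have he : (excess n (blockless r Xo l0 (Xt ^~ w)) b')%:R <=
    n%:R * (cb + eta / (c1 * 2%:R + 1)).
  have := avg _ _ _ m3; rewrite ler_norml => /andP[_].
  by rewrite lerBlDr -mulrDr addrC; apply: le_trans; exact: ex.
have h4 : Q * (M + (2 * k)%:R) <= eta * n%:R by rewrite [leRHS]mulrC -ler_pdivrMr.
have t1 : Q * (n - s)%:R <= eta * n%:R + Q * M.
  apply: le_trans (ler_wpM2l Q0 gs) _; rewrite mulrDr lerD2r mulrA ler_wpM2r ?(ltW N0)//.
  exact: small.
have t2 : D * u%:R <= 2%:R * eta * n%:R.
  apply: le_trans (ler_wpM2l D0 hu) _; rewrite mulrCA mulrC ler_wpM2r ?(ltW N0)//.
  by rewrite mulrDr mulr_natl mulr2n; apply: lerD; [exact: DJ|exact: small].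
have t3 : c1 * 2%:R * (excess n (blockless r Xo l0 (Xt ^~ w)) b')%:R <=
    2%:R * eta * n%:R.
  apply: le_trans (ler_wpM2l c20 he) _; rewrite mulrCA mulrC ler_wpM2r ?(ltW N0)//.
  by rewrite mulrDr mulr_natl mulr2n; apply: lerD; [exact: Db|exact: small].
have t4 : 2%:R * (delta ^- 2 * (1 - delta) ^+ b) * n%:R <= eta * n%:R.
  by rewrite ler_wpM2r ?(ltW N0)// mulrA.
rewrite -(ler_pM2l N0) -{1}(ger0_norm (ltW N0)) -normrM mulrBr.
have -> : n%:R * eps = 8%:R * eta * n%:R by rewrite /eta mulrCA divff// mulr1 mulrC.
apply: le_trans (ler_distD W _ _) _.
have Eb : (2 * k + (n - s) + 2 * b.+1 * u)%:R =
    (2 * k)%:R + (n - s)%:R + (2 * b.+1)%:R * u%:R :> R by rewrite -natrM -!natrD.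
have Ee : c1 * (2 * excess n (blockless r Xo l0 (Xt ^~ w)) b')%:R =
    c1 * 2%:R * (excess n (blockless r Xo l0 (Xt ^~ w)) b')%:R by rewrite natrM mulrA.
rewrite Eb Ee in main.
apply: le_trans (lerD main hW) _.
have E4 : Q * ((2 * k)%:R + (n - s)%:R + (2 * b.+1)%:R * u%:R) =
  Q * (2 * k)%:R + Q * (n - s)%:R + D * u%:R by rewrite !mulrDr /D mulrA.
rewrite E4; rewrite mulrDr in h4.
move: t1 t2 t3 t4 h4.
rewrite [n%:R * eta]mulrC -[8%:R * eta * n%:R]mulrA -[2%:R * eta * n%:R]mulrA.
move: (eta * n%:R) (Q * (n - s)%:R) (Q * M) (Q * (2 * k)%:R) (D * u%:R)
  (c1 * 2%:R * (excess n (blockless r Xo l0 (Xt ^~ w)) b')%:R)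
  (2%:R * (delta ^- 2 * (1 - delta) ^+ b) * n%:R).
by move=> *; lra.
Qed.

End AlmostSureLimit.

(** On one path in all the full-measure events, any two intervals of radius [e j] around [c j]
    contain a common value of the sequence. The supremum of their left ends then lies in all of
    them. *)
Lemma cvg_as_of_near_constants d (Omega : measurableType d) (R : realType)
    (P : probability Omega R) (Z : nat -> Omega -> R) :
  (forall eps, 0 < eps -> exists c : R,
     {ae P, forall w, \forall n \near \oo, `|Z n w - c| <= eps}) ->
  exists c, cvg_as P Z c.
Proof.
move=> near_c; pose e (j : nat) : R := j.+1%:R^-1.
have e0 j : 0 < e j by rewrite invr_gt0.
have [c hc] := choice (fun j => near_c (e j) (e0 j)).
have hall : {ae P, forall w, forall j, \forall n \near \oo, `|Z n w - c j| <= e j}.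
  exact: ae_foralln.
have P1 : (0 < P [set: Omega])%E by rewrite [X in (0 < X)%E]probability_setT lte01.
have [w0 hw0] := @filter_ex _ _ (ae_properfilter_algebraOfSetsType P1) _ hall.
have cross j k : c j - e j <= c k + e k.
  have [n [nj nk]] := filter_ex (filterI (hw0 j) (hw0 k)).
  by move: nj nk; rewrite !ler_distl => /andP[h1 h2] /andP[h3 h4]; lra.
pose A := [set c j - e j | j in [set: nat]].
have A_ub : has_ubound A by exists (c 0%N + e 0%N) => _ [j _ <-]; exact: cross.
have hL j : `|c j - sup A| <= e j.
  have h1 : c j - e j <= sup A by apply: ub_le_sup => //; exists j.
  have h2 : sup A <= c j + e j.
    by apply: ge_sup => [|_ [i _ <-]]; [exists (c j - e j), j|exact: cross].
  by rewrite ler_distl; apply/andP; split; lra.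
exists (sup A); apply: filterS hall => w hw; apply/cvgrPdist_le => eps eps0.
have [j hj] := filter_ex (@nbhs_infty_ger R (2%:R / eps)).
have ej : e j <= eps / 2%:R.
  rewrite /e -[leRHS]invrK invf_div lef_pV2 ?posrE ?divr_gt0//.
  by apply: le_trans hj _; rewrite ler_nat.
apply: filterS (hw j) => n hn; have := hL j; move: hn; rewrite !ler_distl.
by move=> /andP[h1 h2] /andP[h3 h4]; apply/andP; split; lra.
Qed.

(** Dominated convergence handles the truncated sequence, and the part cut off is at most [U n],
    whose mean is small uniformly in [n]. *)
Lemma cvg_L1_of_tails d (Omega : measurableType d) (R : realType)
    (P : probability Omega R) (Z : nat -> Omega -> R) (c : R) :
  (forall n, measurable_fun [set: Omega] (Z n)) -> cvg_as P Z c ->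
  {ae P, forall w, forall n, (0 < n)%N -> 0 <= Z n w} ->
  (forall eps, 0 < eps -> exists (B : R) (U : nat -> Omega -> R),
    [/\ forall n, measurable_fun [set: Omega] (U n),
        forall n w, 0 <= U n w,
        {ae P, forall w, forall n, (0 < n)%N -> Z n w <= B + U n w} &
        forall n, (0 < n)%N -> (\int[P]_w (U n w)%:E <= eps%:E)%E]) ->
  ('N[P]_1[EFin \o (fun w => Z n w - c)%R] @[n --> \oo] --> 0)%E.
Proof.
move=> mZ Zc Z0 tails.
have small eps : 0 < eps ->
    \forall n \near \oo, (\int[P]_w (`|Z n w - c|)%:E <= eps%:E)%E.
  move=> eps0; have e20 : 0 < eps / 2%:R by rewrite divr_gt0.
  have [B [U [mU U0 ZU EU]]] := tails _ e20.
  (* The level is at least [c] so that truncation keeps the limit, and at least [0] so that the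
     truncated values stay nonnegative. *)
  pose B' := Num.max (Num.max B c) 0.
  have [BB cB B'0] : [/\ B <= B', c <= B' & 0 <= B'].
    by rewrite /B' !le_max !lexx !orbT.
  pose T n w := Num.min (Z n.+1 w) B'.
  have mT n : measurable_fun [set: Omega] (T n) by exact: measurable_minr.
  have [|||||_ + _] := @dominated_convergence _ _ _ P setT measurableT
    (fun n w => (T n w)%:E) (fun=> c%:E) (fun=> B'%:E).
    - by move=> n; apply/measurable_EFinP.
    - exact: measurable_cst.
    - apply: filterS Zc => w hw _; apply: cvg_EFin; first exact: nearW.
      apply/cvgrPdist_le => e e0.
      have /cvgrPdist_le/(_ _ e0)[N _ hN] := hw.
      exists N => // n Nn; have := hN n.+1 (leqW Nn).
      rewrite /= /T minEle !ler_distl => /andP[h1 h2].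
      by case: ifP => h3; apply/andP; split; lra.
    - exact: finite_measure_integrable_cst.
    - apply: filterS Z0 => w hw n _; rewrite lee_fin ger0_norm.
        by rewrite /T ge_min lexx orbT.
      by rewrite /T le_min hw.
  move=> /fine_cvgP[[N1 _ fin] /cvgrPdist_le/(_ _ e20)[N2 _ hN]].
  exists (maxn N1 N2).+1 => // -[//|n]; rewrite /= ltnS geq_max => /andP[n1 n2].
  have mI : measurable_fun setT (fun w => (`|T n w - c|)%:E).
    apply/measurable_EFinP; apply: measurableT_comp => //.
    by apply: measurable_funB.
  apply: (@le_trans _ _ (\int[P]_w ((`|T n w - c|)%:E + (U n.+1 w)%:E))%E).
    apply: ae_ge0_le_integral => //.
    - apply/measurable_EFinP; apply: measurableT_comp => //.
      exact: measurable_funB.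
    - by move=> w _; rewrite adde_ge0// lee_fin.
    - by apply: emeasurable_funD => //; apply/measurable_EFinP.
    - apply: filterS ZU => w /(_ n.+1 isT) h _; rewrite -EFinD lee_fin /T.
      have := U0 n.+1 w; move: h; rewrite minEle; case: ifP => h1 h2 h3.
        by rewrite lerDl.
      rewrite !ger0_norm; lra.
  rewrite ge0_integralD//; last 2 first.
  - by move=> w _; rewrite lee_fin.
  - exact/measurable_EFinP.
  rewrite (_ : eps%:E = (eps / 2%:R)%:E + (eps / 2%:R)%:E)%E; last first.
    by rewrite -EFinD -splitr.
  apply: leeD; last exact: EU.
  have := hN n n2; rewrite sub0r normrN /= => h.
  have E : (\int[P]_w (`|T n w - c|)%:E = \int[P]_w `|(T n w)%:E - c%:E|)%E by [].
  rewrite E -[X in (X <= _)%E]fineK; last exact: fin.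
  by rewrite lee_fin; apply: le_trans (ler_norm _) h.
apply/fine_cvgP; split.
  apply: filterS (small 1 ltr01) => n h; rewrite Lnorm1.
  rewrite ge0_fin_numE ?integral_ge0//.
  exact: le_lt_trans h (ltry _).
apply/cvgrPdist_le => eps eps0; apply: filterS (small eps eps0) => n h.
rewrite /= sub0r normrN Lnorm1 ger0_norm ?fine_ge0 ?integral_ge0//.
rewrite -lee_fin fineK//.
rewrite ge0_fin_numE ?integral_ge0//.
exact: le_lt_trans h (ltry _).
Qed.

Lemma ae_bounded_Lfun1 d (Omega : measurableType d) (R : realType)
    (P : probability Omega R) (g : Omega -> R) (B : R) :
  measurable_fun [set: Omega] g -> {ae P, forall w, `|g w| <= B} ->
  g \in Lfun P 1%E.
Proof.
move=> mg gB; apply/Lfun1_integrable/integrableP; split.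
  exact/measurable_EFinP.
have [B0|B0] := leP 0 B; last first.
  have P1 : (0 < P [set: Omega])%E by rewrite [X in (0 < X)%E]probability_setT lte01.
  have [w h] := @filter_ex _ _ (ae_properfilter_algebraOfSetsType P1) _ gB.
  by have := le_lt_trans h B0; rewrite normr_lt0.
apply: (@le_lt_trans _ _ (\int[P]_w (cst B%:E w))%E); last first.
  by rewrite integral_cst// [X in (_ * X)%E]probability_setT mule1 ltry.
apply: ae_ge0_le_integral => //.
- by apply: measurableT_comp => //; exact/measurable_EFinP.
- by apply: filterS gB => w h _; rewrite /= lee_fin.
Qed.

(** * Integrability of the risk and conclusion *)

Section Conclusion.
Context {d d' : measure_display} {Omega : measurableType d}
  {X : measurableType d'} {R : realType} {K : nat}.
Variable (P : probability Omega R).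
Variables (Xt : nat -> {RV P >-> X}) (Yt : nat -> {RV P >-> 'I_K.+1}).
Variables (mu : {measure set X -> \bar R}) (p : 'M[R]_K.+1).
Variables (Ps : 'I_K.+1 -> probability X R) (f : 'I_K.+1 -> X -> R).
Hypothesis hmm : ergodic_hmm Xt Yt mu p Ps f.
Variables (C : {set 'I_K.+1}) (r : nat) (Xo : set X).
Hypothesis hA1 : A1 p Ps f C r.
Hypothesis hXo : observation_set mu f C Xo.
Variables (q : forall n, n.-tuple 'I_K.+1 -> n.-tuple X -> R)
  (pt : forall n, 'I_n -> 'I_K.+1 -> n.-tuple X -> R)
  (v : forall n, n.-tuple X -> n.-tuple 'I_K.+1).
Arguments q {n}. Arguments pt {n}. Arguments v {n}.
Hypothesis hq : path_posterior Xt Yt (@q).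
Hypothesis hpt : state_posterior Xt Yt (@pt).
Hypothesis hv : viterbi_alignment (@q) (@v).

Lemma measurable_risk n : measurable_fun [set: Omega] (R1_risk Xt (@pt) (@v) n).
Proof.
apply: measurable_funN; apply: measurable_funM; first exact: measurable_cst.
apply: measurable_sum => i; apply: measurableT_comp; first exact: measurable_ln.
pose g a w := pt i (inord a) (obs Xt n w).
rewrite (_ : (fun w => _) =
    (fun w => g (nat_of_ord (tnth (v (obs Xt n w)) i)) w)); last first.
  by apply/funext => w; rewrite /g inord_val.
have mo : measurable_fun [set: Omega] (obs Xt n) by exact: measurable_obs.
apply: measurable_select => [|a].
  apply: (@measurableT_comp _ _ _ _ _ _ (@nat_of_ord K.+1)).
    by move=> _ D _.
  apply: (measurableT_comp (measurable_tnth i)).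
  by apply: measurableT_comp mo; have [] := hv n.
by apply: measurableT_comp mo; have [] := hpt i (inord a).
Qed.

Lemma risk_ae_ge0 : {ae P, forall w, forall n, (0 < n)%N ->
  0 <= R1_risk Xt (@pt) (@v) n w}.
Proof.
have [delta [delta01 block]] := block_anchored hmm hA1 hXo.
apply: filterS (optimally_aligned_as hmm hq hpt hv) => w opt n n0.
exact: (risk_ge0 hmm delta01 (ltn0Sn 0) block n0 (opt n n0)).
Qed.

(** For fixed [n] the risk is almost surely bounded: with cutoff [n] the sum defining [excess] is
    empty. No tail estimate enters, so [l0] is taken to be [1]. *)
Lemma risk_Lfun1 n : R1_risk Xt (@pt) (@v) n \in Lfun P 1%E.
Proof.
have [delta [delta01 block]] := block_anchored hmm hA1 hXo.
apply: (@ae_bounded_Lfun1 _ _ _ _ _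
  (@cost0 R K r 1 delta + @cost1 R K 1 * (2 * n)%:R)).
  exact: measurable_risk.
apply: filterS2 risk_ae_ge0 (optimally_aligned_as hmm hq hpt hv) => w R0 opt.
have [->|n0] := posnP n.
  rewrite /R1_risk big_ord0 mulr0 oppr0 normr0.
  apply: addr_ge0; first exact: cost0_ge0.
  by apply: mulr_ge0 => //; exact: cost1_ge0.
rewrite ger0_norm ?R0// -(@ler_pM2l _ n%:R) ?ltr0n//.
apply: le_trans (risk_ub hmm delta01 (ltn0Sn 0) block n n0 (opt n n0)) _.
rewrite /excess big1 ?muln0 ?mulr0 ?addr0 1?mulrC// => s _.
by rewrite big_geq.
Qed.

(** [U] bounds the excess part of [risk_ub] by an average of [long_gaps], whose mean is of order
    [rho ^ b] for every [n]. *)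
Lemma risk_tails eps : 0 < eps -> exists (B : R) (U : nat -> Omega -> R),
  [/\ forall n, measurable_fun [set: Omega] (U n),
      forall n w, 0 <= U n w,
      {ae P, forall w, forall n, (0 < n)%N -> R1_risk Xt (@pt) (@v) n w <= B + U n w} &
      forall n, (0 < n)%N -> (\int[P]_w (U n w)%:E <= eps%:E)%E].
Proof.
move=> eps0.
have [delta [delta01 block]] := block_anchored hmm hA1 hXo.
have [l0 [rho [l00 rho01 tail]]] := no_block_tail hmm hA1 hXo.
set c0 := @cost0 R K r l0 delta; set c1 := @cost1 R K l0.
have c10 : 0 <= c1 by exact: cost1_ge0.
have [b hb] := geometric_small (c1 * 2%:R * rho / (1 - rho)) rho01 eps0.
pose G i w : R := fine (long_gaps r Xo l0 b.+1 (fun t => Xt (i.+1 + t)%N w)).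
have mG i : measurable_fun [set: Omega] (G i).
  by apply: measurableT_comp => //; exact: measurable_gaps hXo _ _ _.
have G0 i w : 0 <= G i w by rewrite fine_ge0// long_gaps_ge0.
have c20 (n : nat) : 0 <= n%:R^-1 * (c1 * 2%:R).
  by rewrite mulr_ge0 ?invr_ge0// mulr_ge0.
exists (c0 + c1 * (2 * b)%:R), (fun n w => n%:R^-1 * (c1 * 2%:R) * \sum_(i < n) G i w).
split.
- move=> n; apply: measurable_funM; first exact: measurable_cst.
  by apply: measurable_sum => i; exact: mG.
- by move=> n w; rewrite mulr_ge0// sumr_ge0.
- apply: filterS2 (excess_le_long_gaps hXo rho01 tail)
    (optimally_aligned_as hmm hq hpt hv) => w ex opt n n0.
  rewrite -(@ler_pM2l _ n%:R) ?ltr0n//.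
  apply: le_trans (risk_ub hmm delta01 l00 block b n0 (opt n n0)) _.
  rewrite mulrDr [n%:R * (c0 + _)]mulrC lerD2l natrM mulrA.
  rewrite -[n%:R^-1 * _ * _]mulrA mulVKf ?pnatr_eq0 -?lt0n//.
  by apply: ler_wpM2l; [exact: mulr_ge0|exact: ex].
- move=> n n0.
  rewrite (eq_integral (fun w =>
    (n%:R^-1 * (c1 * 2%:R))%:E * \sum_(i < n) (G i w)%:E)%E); last first.
    by move=> w _; rewrite sumEFin EFinM.
  rewrite ge0_integralZl_EFin//; last 2 first.
  + by move=> w _; rewrite sume_ge0// => i _; rewrite lee_fin.
  + by apply: emeasurable_sum => i; exact/measurable_EFinP.
  rewrite ge0_integral_sum//; last 2 first.
  + by move=> i; exact/measurable_EFinP.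
  + by move=> i w _; rewrite lee_fin.
  apply: (@le_trans _ _ ((n%:R^-1 * (c1 * 2%:R))%:E *
      \sum_(i < n) (rho ^+ b.+1 / (1 - rho))%:E)%E).
    rewrite lee_wpmul2l ?lee_fin//; apply: lee_sum => i _.
    exact: (integral_fine_long_gaps hXo rho01 tail b.+1 (ltn0Sn i)).
  rewrite sumEFin -EFinM lee_fin sumr_const card_ord.
  apply: le_trans hb; rewrite le_eqVlt; apply/orP; left; apply/eqP.
  have nn : n%:R != 0 :> R by rewrite pnatr_eq0 -lt0n.
  have r1 : 1 - rho != 0 by rewrite subr_eq0 gt_eqF//; case/andP: rho01.
  rewrite -[_ *+ n]mulr_natl exprS; clearbody c1.
  by field; rewrite nn r1.
Qed.

End Conclusion.

Theorem theorem4p1 (R : realType) (d d' : measure_display)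
    (Omega : measurableType d) (X : measurableType d') (K : nat)
    (P : probability Omega R)
    (Xt : nat -> {RV P >-> X}) (Yt : nat -> {RV P >-> 'I_K.+1})
    (mu : {measure set X -> \bar R})
    (p : 'M[R]_K.+1) (Ps : 'I_K.+1 -> probability X R) (f : 'I_K.+1 -> X -> R)
    (C : {set 'I_K.+1}) (r : nat) (Xo : set X)
    (q : forall n, n.-tuple 'I_K.+1 -> n.-tuple X -> R)
    (pt : forall n, 'I_n -> 'I_K.+1 -> n.-tuple X -> R)
    (v : forall n, n.-tuple X -> n.-tuple 'I_K.+1) :
  ergodic_hmm Xt Yt mu p Ps f ->
  A1 p Ps f C r ->
  A2 p Ps f ->
  observation_set mu f C Xo ->
  path_posterior Xt Yt q ->
  state_posterior Xt Yt pt ->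
  viterbi_alignment q v ->
  consistent Xt Yt Xo r v ->
  exists R1 : R,
    cvg_as P (R1_risk Xt pt v) R1 /\ cvg_L1 P (R1_risk Xt pt v) R1.
Proof.
move=> hmm hA1 _ hXo hq hpt hv hcons.
have [c Zc] := cvg_as_of_near_constants (fun eps eps0 =>
  risk_near_constant hmm hA1 hXo hq hpt hv hcons eps0).
exists c; split => //; split; first exact: (risk_Lfun1 hmm hA1 hXo hq hpt hv).
apply: cvg_L1_of_tails Zc _ _.
- exact: (measurable_risk hpt hv).
- exact: (risk_ae_ge0 hmm hA1 hXo hq hpt hv).
- exact: (risk_tails hmm hA1 hXo hq hpt hv).
Qed.
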